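(* Let $G$ be a finite simple connected graph with blocks $B_1,\dots,B_k$. Then $I_G$ is a complete intersection if and only if (i) all minimal generators of $I_G$, except at most one (up to sign), are of the form $B_w$ with $w$ an even cycle of $G$, and (ii) the ideal $I_{B_i}$ is a complete intersection for every $1\le i\le k$.
   Context: For a finite simple graph $G$ with edges $e_1,\dots,e_m$ and a field $K$, the toric ideal $I_G\subseteq K[e_1,\dots,e_m]$ is the kernel of the $K$-algebra map $e_i=\{v_j,v_k\}\mapsto v_jv_k$; an ideal $I_G$ is a complete intersection if it is generated by $\operatorname{ht}(I_G)$ elements. A block is a maximal biconnected subgraph of $G$. For a block $B$, $I_B=I_G\cap K[e_i : e_i\in E(B)]$ (the toric ideal of the subgraph $B$). A minimal generator of $I_G$ is a binomial belonging to at least one minimal system of binomial generators of $I_G$. For an even cycle $w=(e_{i_1},\dots,e_{i_{2q}})$, $B_w=\prod_{k=1}^q e_{i_{2k-1}}-\prod_{k=1}^q e_{i_{2k}}$. *)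

(* Defs.v *)
From HB Require Import structures.
From mathcomp Require Import all_boot all_order all_algebra.
From mathcomp Require Import mpoly.
Set Implicit Arguments. Unset Strict Implicit. Unset Printing Implicit Defensive.
Import GRing.Theory.
Local Open Scope ring_scope.

Section Ideals.
Variables (K : fieldType) (k : nat).
Notation P := {mpoly K[k]}.

Definition is_ideal (I : P -> Prop) :=
  [/\ I 0, (forall a b, I a -> I b -> I (a + b)) & (forall r a, I a -> I (r * a))].

Definition is_prime_ideal (I : P -> Prop) :=
  [/\ is_ideal I, ~ I 1 & (forall a b, I (a * b) -> I a \/ I b)].

Definition generates (S : seq P) (I : P -> Prop) :=
  forall p, I p <-> exists c : 'I_(size S) -> P, p = \sum_(i < size S) c i * S`_i.

Definition prime_chain_to (Q : P -> Prop) (h : nat) :=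
  exists C : nat -> P -> Prop,
    [/\ (forall i, (i <= h)%N -> is_prime_ideal (C i)),
        (forall i, (i < h)%N ->
           (forall x, C i x -> C i.+1 x) /\ exists x, C i.+1 x /\ ~ C i x)
      & (forall x, C h x <-> Q x)].

(* ht(Q) of a prime Q is the sup of lengths of prime chains ending at Q;
   ht(I) is the minimum of ht(Q) over primes Q containing I.
   has_height I h  <->  ht(I) = h. *)
Definition has_height (I : P -> Prop) (h : nat) :=
  (exists Q, [/\ is_prime_ideal Q, (forall x, I x -> Q x)
                & forall h', prime_chain_to Q h' -> (h' <= h)%N]) /\
  (forall Q, is_prime_ideal Q -> (forall x, I x -> Q x) -> prime_chain_to Q h).

Definition complete_intersection (I : P -> Prop) :=
  exists S : seq P, generates S I /\ has_height I (size S).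

Definition is_binomial (p : P) := exists u v : 'X_{1..k}, p = 'X_[u] - 'X_[v].

Definition minimal_binomial_system (S : seq P) (I : P -> Prop) :=
  [/\ (forall p, p \in S -> is_binomial p), generates S I
    & forall S' : seq P, {subset S' <= S} -> generates S' I -> {subset S <= S'}].

Definition minimal_generator (I : P -> Prop) (g : P) :=
  exists S, minimal_binomial_system S I /\ g \in S.
End Ideals.

Section Graphs.
Variables (n m : nat) (ends : 'I_m -> 'I_n * 'I_n).
(* edge e_i = {(ends i).1, (ends i).2} *)

Definition joins (i : 'I_m) (x y : 'I_n) :=
  (ends i == (x, y)) || (ends i == (y, x)).

Definition simple_graph :=
  (forall i, (ends i).1 != (ends i).2) /\
  (forall i j, joins i (ends j).1 (ends j).2 -> i = j).

Definition adj_in (Vs : {set 'I_n}) (Es : {set 'I_m}) : rel 'I_n :=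
  fun x y => [&& x \in Vs, y \in Vs & [exists i in Es, joins i x y]].

Definition graph_connected :=
  (0 < n)%N /\ forall x y : 'I_n, connect (adj_in setT setT) x y.

Definition subgraph (Vs : {set 'I_n}) (Es : {set 'I_m}) :=
  forall i, i \in Es -> ((ends i).1 \in Vs) && ((ends i).2 \in Vs).

Definition sub_connected (Vs : {set 'I_n}) (Es : {set 'I_m}) :=
  forall x y, x \in Vs -> y \in Vs -> connect (adj_in Vs Es) x y.

Definition del_vertex (Vs : {set 'I_n}) (Es : {set 'I_m}) (v : 'I_n) :=
  (Vs :\ v, [set i in Es | ((ends i).1 != v) && ((ends i).2 != v)]).

Definition biconnected (Vs : {set 'I_n}) (Es : {set 'I_m}) :=
  [/\ subgraph Vs Es, Vs != set0, sub_connected Vs Es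
    & forall v, v \in Vs ->
        sub_connected (del_vertex Vs Es v).1 (del_vertex Vs Es v).2].

Definition is_block (Vs : {set 'I_n}) (Es : {set 'I_m}) :=
  biconnected Vs Es /\
  forall Vs' Es', biconnected Vs' Es' -> Vs \subset Vs' -> Es \subset Es' ->
    Vs' = Vs /\ Es' = Es.

Definition even_cycle (w : seq 'I_m) :=
  [/\ ~~ odd (size w), (4 <= size w)%N, uniq w &
    exists vs : seq 'I_n, [/\ size vs = size w, uniq vs &
      forall (j : nat) (d : 'I_m) (dv : 'I_n), (j < size w)%N ->
        joins (nth d w j) (nth dv vs j) (nth dv vs (j.+1 %% size w))]].

Definition toric_images (K : fieldType) : m.-tuple {mpoly K[n]} :=
  [tuple 'X_(ends i).1 * 'X_(ends i).2 | i < m].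

Definition toric_ideal (K : fieldType) : {mpoly K[m]} -> Prop :=
  fun p => comp_mpoly (toric_images K) p = 0.

(* B_w = e_{i_1} e_{i_3} ... - e_{i_2} e_{i_4} ... *)
Definition odd_places (w : seq 'I_m) :=
  mask [seq ~~ odd j | j <- iota 0 (size w)] w.
Definition even_places (w : seq 'I_m) :=
  mask [seq odd j | j <- iota 0 (size w)] w.
Definition Bw (K : fieldType) (w : seq 'I_m) : {mpoly K[m]} :=
  \prod_(e <- odd_places w) 'X_e - \prod_(e <- even_places w) 'X_e.

(* the subgraph with edge set Es, its edges reindexed by 'I_#|Es|;
   its toric ideal lives in K[e_i : e_i in Es] *)
Definition sub_ends (Es : {set 'I_m}) : 'I_#|Es| -> 'I_n * 'I_n :=
  fun j => ends (enum_val j).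
End Graphs.

Arguments toric_ideal {n m} ends K _.
Arguments Bw {m} K w.
Arguments sub_ends {n m} ends Es _.

(* Main.v *)
Require Import Defs.
From HB Require Import structures.
From mathcomp Require Import all_boot all_order all_algebra.
From mathcomp Require Import mpoly.
From mathcomp Require Import zify ring lra.
From Stdlib Require Import Classical.
Set Implicit Arguments. Unset Strict Implicit. Unset Printing Implicit Defensive.
Import GRing.Theory Num.Theory Order.TTheory.
Local Open Scope ring_scope.

(** A binomial X^u - X^w of the toric ideal I corresponds to the relation u - w
    between the vertex vectors of the edges, and the height of I is the dimension of
    the space L of all relations.  The relations of a binomial generating system span
    L, and by the graded Nakayama lemma an irredundant system has the least possible
    number of elements.  Hence I is a complete intersection iff the relations of an
    irredundant system S are linearly independent, and then those of every
    irredundant system are.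

    Suppose S is independent.  A generator of degree at most one at every vertex is
    a difference of two perfect matchings of its support; independence forbids
    splitting it, so it is a single even cycle.  If a generator q has degree at
    least two at v, its support falls apart at v into two pieces that both carry an
    odd closed walk through v.  Conversely two odd closed walks on different sides
    of v give a relation, which some generator of degree two at v must account for.
    Comparing these relations, in a connected graph there is only one such q, its
    two pieces are minimal odd closed walks supporting no relation, so no other
    generator lives on the support of q; this determines q up to sign even when S
    varies.  The generators supported in a vertex set W generate the ideal of the
    subgraph induced by W, and blocks are induced, which gives (ii).

    For the converse, even cycles lie in blocks, so by (ii) the generators supported
    in blocks are independent, blocks being edge-disjoint.  If the remaining
    generator f were in their span, the restriction of f to each block would be a
    relation, and telescoping over the blocks would express f by other generators. *)

(** * Binomial ideals and kernels of monomial maps *)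

(** [complete_intersection] allows generators that are neither binomial nor homogeneous, and
    [has_height] speaks of chains of arbitrary primes. So two pieces of commutative algebra cannot
    be avoided: an upper bound for the length of chains, drawn from the algebraic dependence of more
    than [m] polynomials, and a Nakayama argument that compares an irredundant binomial system with
    any generating family. That some generator must exist is always proved by one invariant: a
    function of monomials unchanged by all moves from w + q.1 to w + q.2 takes equal values on the
    two terms of a binomial in the ideal. Coefficients live in [K] and relations in rational
    vectors, so the characteristic of [K] never enters. Spans are handled through functionals,
    because extending or truncating a functional moves independence between a graph and its
    subgraphs. *)

Section Ideals.
Variables (K : fieldType) (m : nat).
Implicit Types (p q : {mpoly K[m]}) (S : seq {mpoly K[m]}) (J : {mpoly K[m]} -> Prop).

Definition in_ideal S p :=
  exists c : 'I_(size S) -> {mpoly K[m]}, p = \sum_(i < size S) c i * S`_i.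

Lemma in_ideal_is_ideal S : is_ideal (in_ideal S).
Proof.
split.
- by exists (fun=> 0); rewrite big1 // => i _; rewrite mul0r.
- move=> _ _ [c ->] [d ->]; exists (fun i => c i + d i).
  by rewrite -big_split; apply: eq_bigr => i _; rewrite mulrDl.
- move=> r _ [c ->]; exists (fun i => r * c i).
  by rewrite mulr_sumr; apply: eq_bigr => i _; rewrite mulrA.
Qed.

Lemma ideal_sum J (I : Type) (r : seq I) (P : pred I) (F : I -> {mpoly K[m]}) :
  is_ideal J -> (forall i, P i -> J (F i)) -> J (\sum_(i <- r | P i) F i).
Proof.
move=> [J0 JD JM] JF; elim/big_rec: _ => // i x Pi Jx.
by apply: JD => //; apply: JF.
Qed.

Lemma idealN J p : is_ideal J -> J p -> J (- p).
Proof. by move=> [_ _ JM] /(JM (-1)); rewrite mulN1r. Qed.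

Lemma idealB J p q : is_ideal J -> J p -> J q -> J (p - q).
Proof. by move=> idJ Jp Jq; case: (idJ) => _ JD _; apply: JD => //; apply: idealN. Qed.

Lemma in_ideal_min S J p :
  is_ideal J -> (forall s, s \in S -> J s) -> in_ideal S p -> J p.
Proof.
move=> idJ JS [c ->]; apply: ideal_sum => // i _.
by case: idJ => _ _ JM; apply/JM/JS/mem_nth.
Qed.

Lemma mem_in_ideal S s : s \in S -> in_ideal S s.
Proof.
move=> sS; have lt_iS : (index s S < size S)%N by rewrite index_mem.
exists (fun i => (i == Ordinal lt_iS)%:R); rewrite (bigD1 (Ordinal lt_iS)) //=.
rewrite eqxx mul1r nth_index // big1 ?addr0 // => i /negPf ->.
by rewrite mul0r.
Qed.

Lemma in_ideal_sub S1 S2 p :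
  (forall s, s \in S1 -> in_ideal S2 s) -> in_ideal S1 p -> in_ideal S2 p.
Proof. by move=> S12; apply: in_ideal_min S12; apply: in_ideal_is_ideal. Qed.

Lemma generatesP S J : is_ideal J ->
  generates S J <-> (forall s, s \in S -> J s) /\ (forall p, J p -> in_ideal S p).
Proof.
move=> idJ; split=> [gS|[SJ JS] p]; last by split; [apply: JS | apply: in_ideal_min].
by split=> [s /mem_in_ideal Ss|p /(gS p).1 //]; apply: (gS s).2.
Qed.

End Ideals.

(** * Coefficient sums as invariants of binomial ideals *)

Section CoefficientSums.
Variables (K : fieldType) (m : nat).
Implicit Types (p : {mpoly K[m]}) (P : pred 'X_{1..m}).

Definition msum P p := \sum_(u <- msupp p | P u) p@_u.

Lemma msum_widen P p (r : seq 'X_{1..m}) :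
  uniq r -> {subset msupp p <= r} -> msum P p = \sum_(u <- r | P u) p@_u.
Proof.
move=> Ur sub_pr; rewrite /msum [RHS](bigID (mem (msupp p))) /=.
rewrite [X in _ + X]big1 ?addr0; last first.
  by move=> u /andP[_ /memN_msupp_eq0].
rewrite [RHS](eq_bigl (fun u => (u \in msupp p) && P u)); last by move=> u; apply: andbC.
rewrite -big_filter_cond; apply/perm_big/uniq_perm; rewrite ?filter_uniq ?msupp_uniq //.
by move=> u; rewrite mem_filter andb_idr //; apply: sub_pr.
Qed.

Lemma msumD P p (q : {mpoly K[m]}) : msum P (p + q) = msum P p + msum P q.
Proof.
pose r := undup (msupp p ++ msupp q).
have sub u : u \in msupp p ++ msupp q -> u \in r by rewrite mem_undup.
rewrite (@msum_widen P p r) ?undup_uniq //; last first.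
  by move=> u up; rewrite sub // mem_cat up.
rewrite (@msum_widen P q r) ?undup_uniq //; last first.
  by move=> u up; rewrite sub // mem_cat up orbT.
rewrite (@msum_widen P (p + q) r) ?undup_uniq // -?big_split; last first.
  by move=> u /msuppD_le; apply: sub.
by apply: eq_bigr => u _; rewrite mcoeffD.
Qed.

Lemma msumN P p : msum P (- p) = - msum P p.
Proof.
rewrite /msum (perm_big _ (msuppN p)) -sumrN.
by apply: eq_bigr => u _; rewrite mcoeffN.
Qed.

Lemma msum0 P : msum P 0 = 0.
Proof. by rewrite /msum -mpolyC0 msupp0 big_nil. Qed.

Lemma msumZ P c p : msum P (c *: p) = c * msum P p.
Proof.
rewrite (@msum_widen P (c *: p) (msupp p)) ?msupp_uniq //; last exact: msuppZ_le.
by rewrite mulr_sumr; apply: eq_bigr => u _; rewrite mcoeffZ.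
Qed.

Lemma msumX P u : msum P 'X_[u] = (P u)%:R.
Proof. by rewrite /msum msuppX big_mkcond big_seq1 mcoeffX eqxx; case: (P u). Qed.

Lemma msum_sum P (I : Type) (r : seq I) (Q : pred I) (F : I -> {mpoly K[m]}) :
  msum P (\sum_(i <- r | Q i) F i) = \sum_(i <- r | Q i) msum P (F i).
Proof. exact: (big_morph (msum P) (@msumD P) (@msum0 P)). Qed.

Definition bin (q : 'X_{1..m} * 'X_{1..m}) : {mpoly K[m]} := 'X_[q.1] - 'X_[q.2].

Lemma msum_bin_mul P (c : {mpoly K[m]}) (q : 'X_{1..m} * 'X_{1..m}) :
  (forall w, P (w + q.1)%MM = P (w + q.2)%MM) -> msum P (c * bin q) = 0.
Proof.
move=> Pq; rewrite (mpolyE c) mulr_suml msum_sum big1 // => w _.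
by rewrite -scalerAl msumZ mulrBr -!mpolyXD msumD msumN !msumX Pq subrr mulr0.
Qed.

(* The sum of the coefficients over a fibre of [tau] vanishes on the ideal. *)
Lemma bin_ideal_invariant (T : eqType) (tau : 'X_{1..m} -> T)
    (S : seq ('X_{1..m} * 'X_{1..m})) u v :
  (forall q, q \in S -> forall w, tau (w + q.1)%MM = tau (w + q.2)%MM) ->
  in_ideal (map bin S) (bin (u, v)) -> tau u = tau v.
Proof.
move=> tauS [c def_uv]; apply/eqP; apply: contraT => neq_tau.
have: msum (fun w => tau w == tau u) (bin (u, v)) = 0.
  rewrite def_uv msum_sum big1 // => i _.
  have lti : (i < size S)%N by rewrite -(size_map bin).
  rewrite (nth_map (0%MM, 0%MM)) //; apply: msum_bin_mul => w.
  by rewrite tauS // mem_nth.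
rewrite msumD msumN !msumX eqxx [_ v == _]eq_sym (negPf neq_tau) subr0.
by move/eqP; rewrite oner_eq0.
Qed.

End CoefficientSums.

Arguments bin {K m} q.

Section MonomialMaps.
Variables (K : fieldType) (m N : nat) (a : 'I_m -> 'X_{1..N}).
Implicit Types (u v w : 'X_{1..m}) (p : {mpoly K[m]}).

(** The exponent of the image of ['X_[u]]: the multidegree for which [mono_ideal] is graded. *)
Definition wdeg u : 'X_{1..N} := (\sum_(i < m) a i *+ u i)%MM.

Definition mono_ideal p := p \mPo [tuple 'X_[a i] | i < m] = 0.

Lemma wdegE u x : wdeg u x = (\sum_(i < m) a i x * u i)%N.
Proof. by rewrite /wdeg mnm_sumE; apply: eq_bigr => i _; rewrite mulmnE. Qed.

Lemma wdegD u v : wdeg (u + v)%MM = (wdeg u + wdeg v)%MM.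
Proof.
apply/mnmP => x; rewrite mnmDE !wdegE -big_split; apply: eq_bigr => i _.
by rewrite mnmDE mulnDr.
Qed.

Lemma wdegU i : wdeg U_(i) = a i.
Proof.
apply/mnmP => x; rewrite wdegE (bigD1 i) //= mnm1E eqxx muln1 big1 ?addn0 // => j.
by move/negPf; rewrite eq_sym mnm1E => ->; rewrite muln0.
Qed.

Lemma comp_monoX u : 'X_[u] \mPo [tuple 'X_[a i] | i < m] = 'X_[wdeg u] :> {mpoly K[N]}.
Proof.
rewrite comp_mpolyX /wdeg -mprodXE; apply: eq_bigr => i _.
by rewrite tnth_mktuple mpolyXn.
Qed.

Lemma mcoeff_comp_mono p d :
  (p \mPo [tuple 'X_[a i] | i < m])@_d = msum (fun u => wdeg u == d) p.
Proof.
rewrite comp_mpolyEX raddf_sum /= /msum [RHS]big_mkcond /=.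
apply: eq_bigr => u _; rewrite comp_monoX mcoeffZ mcoeffX.
by case: eqP; rewrite ?mulr1 ?mulr0.
Qed.

Lemma mono_idealP p : mono_ideal p <-> forall d, msum (fun u => wdeg u == d) p = 0.
Proof.
split=> [p0 d | p0]; first by rewrite -mcoeff_comp_mono p0 mcoeff0.
by apply/mpolyP => d; rewrite mcoeff_comp_mono p0 mcoeff0.
Qed.

Lemma mono_ideal_prime : is_prime_ideal mono_ideal.
Proof.
rewrite /mono_ideal; split; first split.
- exact: raddf0.
- by move=> p q p0 q0; rewrite raddfD /= p0 q0 addr0.
- by move=> r p p0; rewrite rmorphM /= p0 mulr0.
- by rewrite rmorph1; apply/eqP; rewrite oner_eq0.
- move=> p q; rewrite rmorphM /= => /eqP; rewrite mulf_eq0.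
  by case/orP=> /eqP; [left | right].
Qed.

Lemma mono_ideal_bin u v : mono_ideal (bin (u, v)) <-> wdeg u = wdeg v.
Proof.
rewrite /mono_ideal raddfB /= !comp_monoX; split=> [/eqP | ->]; last exact: subrr.
rewrite subr_eq0 => /eqP/(congr1 (mcoeff (wdeg u))); rewrite !mcoeffX eqxx.
by case: eqP => // _ /eqP; rewrite oner_eq0.
Qed.

(** The coefficients of [p] in one multidegree sum to zero, so the leading monomial [u] shares its
    multidegree with another monomial [v] of [p]. Subtracting [p@_u *: bin (u, v)] removes [u] and
    adds no monomial. *)
Lemma mono_ideal_ind (J : {mpoly K[m]} -> Prop) p : is_ideal J ->
  (forall u v, wdeg u = wdeg v -> J (bin (u, v))) -> mono_ideal p -> J p.
Proof.
move=> idJ Jbin; have [k] := ubnP (size (msupp p)); elim: k p => // k IHk p.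
move=> le_pk Ip; have [->|p_neq0] := eqVneq p 0; first by case: idJ.
have up := mlead_supp p_neq0; set u := mlead p in up.
have [v /andP[vp neq_vu] eq_w] : exists2 v, (v \in msupp p) && (v != u) & wdeg u = wdeg v.
  have /eqP := (mono_idealP p).1 Ip (wdeg u); rewrite /msum.
  have [[v [vp neq_vu eqw]] _|no_v] := classic (exists v, [/\ v \in msupp p, v != u & wdeg u = wdeg v]).
    by exists v; rewrite ?vp.
  rewrite big_mkcond (bigD1_seq u) ?msupp_uniq //= eqxx big1_seq ?addr0.
    by rewrite mcoeff_eq0 up.
  move=> v /andP[neq_vu vp]; case: eqP => // eqw; case: no_v.
  by exists v.
have J1 : J (p@_u *: bin (u, v)).
  by rewrite -mul_mpolyC; case: idJ => _ _; apply; apply: Jbin.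
rewrite -[p](subrK (p@_u *: bin (u, v))); case: (idJ) => _ JD _; apply: JD => //.
apply: IHk; last first.
  have [idI _ _] := mono_ideal_prime.
  apply: idealB => //; rewrite -mul_mpolyC; case: idI => _ _; apply.
  exact/mono_ideal_bin.
apply: leq_ltn_trans (_ : (size (rem u (msupp p)) < k)%N); last first.
  by rewrite size_rem // -ltnS (leq_trans _ le_pk) // ltnS prednK // (leq_trans _ (_ : 0 < _)%N) //; case: (msupp p) up.
apply: uniq_leq_size; first exact: msupp_uniq.
move=> w; rewrite mem_rem_uniq ?msupp_uniq // !inE !mcoeff_msupp.
rewrite mcoeffB mcoeffZ mcoeffB !mcoeffX [u == w]eq_sym.
have [->|neq_wu] := eqVneq w u.
  by rewrite (negPf neq_vu) subr0 mulr1 subrr eqxx.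
have [<-|neq_vw] := eqVneq v w; first by rewrite -mcoeff_msupp vp.
by rewrite subr0 mulr0 subr0.
Qed.

End MonomialMaps.

(** * Dickson's lemma and finite binomial generation *)

Lemma dickson (T : eqType) (I : finType) (c : T -> I -> nat) (P : T -> Prop) :
  exists M : seq T, (forall s, s \in M -> P s) /\
    forall t, P t -> exists2 s, s \in M & forall i, (c s i <= c t i)%N.
Proof.
(* Induction over the set [F] of coordinates on which [Q] is already constant. *)
suff dickson_fixed (F : {set I}) (Q : T -> Prop) :
    (forall s t, Q s -> Q t -> forall i, i \in F -> c s i = c t i) ->
    exists M : seq T, (forall s, s \in M -> Q s) /\
      forall t, Q t -> exists2 s, s \in M & forall i, (c s i <= c t i)%N.
  by apply: (dickson_fixed set0) => s t _ _ i; rewrite inE.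
have [k] := ubnP #|~: F|; elim: k F Q => // k IHk F Q le_Fk fixF.
have [[a Qa]|noQ] := classic (exists a, Q a); last first.
  by exists [::]; split=> // t Qt; case: noQ; exists t.
(* A point that does not dominate [a] has a coordinate below that of [a], hence below [B]. Such
   points fall into finitely many slices, each with one more constant coordinate. *)
pose B := (\max_i c a i)%N.
have slice (x : I * 'I_B) : exists M : seq T, (forall s, s \in M -> Q s) /\
    (x.1 \notin F -> forall t, Q t -> c t x.1 = x.2 ->
       exists2 s, s \in M & forall i, (c s i <= c t i)%N).
  case: x => i b /=; have [iF|iF] := boolP (i \in F); first by exists [::].
  have [|s t|M [MQ Mdom]] := IHk (i |: F) (fun t => Q t /\ c t i = b).
  - rewrite -ltnS (leq_trans _ le_Fk) // ltnS; apply: proper_card.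
    rewrite properC /proper subsetUr /=; apply/subsetPn; exists i => //.
    by rewrite !inE eqxx.
  - case=> Qs csi [Qt cti] j; rewrite !inE => /orP[/eqP->|jF]; last exact: fixF.
    by rewrite csi cti.
  - by exists M; split=> [s /MQ[]//|_ t Qt cti]; apply: Mdom.
have [M_ M_P] := fin_all_exists slice.
exists (a :: flatten [seq M_ x | x <- enum {: I * 'I_B}]); split=> [s|t Qt].
  rewrite inE => /predU1P[->//|/flatten_mapP[x _]].
  by case: (M_P x) => MQ _; apply: MQ.
have [le_at|] := boolP [forall i, (c a i <= c t i)%N].
  by exists a; [rewrite mem_head | apply/forallP].
rewrite negb_forall => /existsP[i]; rewrite -ltnNge => lt_ta.
have ltB : (c t i < B)%N by apply: leq_trans lt_ta _; apply: leq_bigmax.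
have iF : i \notin F by apply: contraL lt_ta => iF; rewrite (fixF t a) ?ltnn.
case: (M_P (i, Ordinal ltB)) => _ /(_ iF t Qt erefl)[s sM le_st].
exists s => //; rewrite inE; apply/orP; right; apply/flatten_mapP.
by exists (i, Ordinal ltB); rewrite ?mem_enum.
Qed.

Section Generators.
Variables (K : fieldType) (m N : nat) (a : 'I_m -> 'X_{1..N}).
Local Notation pairs := (seq ('X_{1..m} * 'X_{1..m})).
Local Notation bins S := (map (@bin K m) S).

(** In the manner of a Graver basis: the minimal nontrivial pairs of equal multidegree, ordered by
    the exponents of both monomials, generate. *)
Lemma mono_ideal_finite : exists S : pairs, generates (bins S) (@mono_ideal K m N a).
Proof.
pose c (q : 'X_{1..m} * 'X_{1..m}) (x : bool * 'I_m) := if x.1 then q.1 x.2 else q.2 x.2.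
have [S [S_I domS]] := dickson c (fun q => wdeg a q.1 = wdeg a q.2 /\ q.1 <> q.2).
have [idI _ _] := @mono_ideal_prime K m N a.
exists S; apply/generatesP => //; split=> [_ /mapP[[u v] /S_I[eq_uv _] ->]|p].
  exact/mono_ideal_bin.
apply: mono_ideal_ind; first exact: in_ideal_is_ideal.
have [I0 ID IM] := in_ideal_is_ideal (bins S).
move=> u v; have [k] := ubnP (mdeg u + mdeg v); elim: k u v => // k IHk u v le_uvk eq_uv.
have [->|/eqP neq_uv] := eqVneq u v; first by rewrite /bin subrr.
have [[u1 v1] uvS le_uv] := domS (u, v) (conj eq_uv neq_uv).
have /= [eq_uv1 neq_uv1] := S_I _ uvS.
have le_u1 : (u1 <= u)%MM by apply/mnm_lepP => i; apply: (le_uv (true, i)).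
have le_v1 : (v1 <= v)%MM by apply/mnm_lepP => i; apply: (le_uv (false, i)).
have def_u := submK le_u1; have def_v := submK le_v1.
have eq_uv2 : wdeg a (u - u1)%MM = wdeg a (v - v1)%MM.
  by apply: (@addIm _ (wdeg a u1)); rewrite -wdegD def_u eq_uv1 -wdegD def_v.
(* After splitting off [(u1, v1)] the remaining pair has smaller total degree, because [u1] and [v1]
   differ and so are not both zero. *)
have -> : bin (u, v) = 'X_[u - u1] * bin (u1, v1) + 'X_[v1] * bin ((u - u1)%MM, (v - v1)%MM) :> {mpoly K[m]}.
  rewrite /bin /= !mulrBr -!mpolyXD def_u [(v1 + _)%MM]addmC [(v1 + (_ - v1))%MM]addmC def_v.
  by rewrite addrA subrK.
apply: ID; apply: IM; first by apply/mem_in_ideal/map_f.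
apply: IHk => //; rewrite -ltnS (leq_trans _ le_uvk) // ltnS.
rewrite -[in X in (_ < X)%N]def_u -[in X in (_ < X)%N]def_v !mdegD addnACA -{1}[(_ + _)%N]addn0 ltn_add2l.
rewrite lt0n addn_eq0 !mdeg_eq0; apply/negP => /andP[/eqP u0 /eqP v0].
by apply: neq_uv1; rewrite u0 v0.
Qed.

Lemma mono_ideal_minimal :
  exists S : seq {mpoly K[m]}, minimal_binomial_system S (@mono_ideal K m N a).
Proof.
have [S0 gS0] := mono_ideal_finite.
have : forall p, p \in bins S0 -> is_binomial p.
  by move=> p /mapP[[u v] _ ->]; exists u, v.
move: (bins S0) gS0 => {}S0 gS0.
have [k] := ubnP (size (undup S0)); elim: k S0 gS0 => // k IHk S gS le_Sk binS.
have [[S' [subS' gS' nsub]]|noS'] := classic (exists S', [/\ {subset S' <= S},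
    generates S' (@mono_ideal K m N a) & ~ {subset S <= S'}]).
  apply: (IHk S') => // [|p /subS']; last exact: binS.
  rewrite -ltnS (leq_trans _ le_Sk) // ltnS ltnNge; apply/negP => le_SS'.
  have [|_ eqSS'] := uniq_min_size (undup_uniq S') _ le_SS'.
    by move=> p; rewrite !mem_undup; apply: subS'.
  by apply: nsub => p; have := eqSS' p; rewrite !mem_undup => <-.
exists S; split=> // S' subS' gS'; apply: NNPP => nsub; apply: noS'.
by exists S'.
Qed.

End Generators.

(** * The height of a toric ideal *)

Section AlgebraicDependence.
Variables (K : fieldType).

Lemma card_bmultinom m b : (#|{: 'X_{1..m < b}}| <= b ^ m)%N.
Proof.
have ltb (u : 'X_{1..m < b}) i : (bmnm u i < b)%N.
  by apply: leq_ltn_trans (bmdeg u); rewrite mdegE (bigD1 i) //= leq_addr.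
pose f (u : 'X_{1..m < b}) : {ffun 'I_m -> 'I_b} := [ffun i => Ordinal (ltb u i)].
have inj_f : injective f.
  move=> u v /ffunP eq_uv; apply/val_inj/mnmP => i /=.
  by have := congr1 val (eq_uv i); rewrite !ffunE.
by have := leq_card _ inj_f; rewrite card_ffun !card_ord.
Qed.

Lemma msize_mul_deg m (p q : {mpoly K[m]}) b c :
  (msize p <= b.+1)%N -> (msize q <= c.+1)%N -> (msize (p * q) <= (b + c).+1)%N.
Proof.
move=> le_p le_q; have [->|p0] := eqVneq p 0; first by rewrite mul0r msize0.
have [->|q0] := eqVneq q 0; first by rewrite mulr0 msize0.
by rewrite msizeM //; move: (msize p) (msize q) le_p le_q => i j; lia.
Qed.

Lemma msize_exp_deg m (p : {mpoly K[m]}) b e :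
  (msize p <= b.+1)%N -> (msize (p ^+ e) <= (e * b).+1)%N.
Proof.
move=> lep; elim: e => [|e IHe]; first by rewrite expr0 msize1.
by rewrite exprS mulSn; apply: msize_mul_deg.
Qed.

(** Dimension count: the [d ^ k] monomials in the [y i] with exponents below [d] lie in the space of
    polynomials of degree below [b], of dimension at most [b ^ m]. *)
Lemma algebraic_dependence m k (y : 'I_k -> {mpoly K[m]}) : (m < k)%N ->
  exists2 F : {mpoly K[k]}, F != 0 & F \mPo [tuple y i | i < k] = 0.
Proof.
move=> lt_mk; pose D := (\max_i msize (y i))%N.
have le_yD i : (msize (y i) <= D.+1)%N by apply: leqW; apply: leq_bigmax.
(* From [b <= c * d] and [c ^ m < d] follows [b ^ m <= c ^ m * d ^ m < d ^ m.+1 <= d ^ k]. *)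
pose c := (k * D).+1; pose d := (c ^ m).+1; pose b := (k * (d * D)).+1.
have lt_bd : (b ^ m < d ^ k)%N.
  have le_b : (b <= c * d)%N by rewrite /b /c; lia.
  apply: (@leq_ltn_trans ((c * d) ^ m)); first by case: (m) => // m'; rewrite leq_exp2r.
  apply: (@leq_trans (d ^ m.+1)); last by rewrite leq_pexp2l.
  by rewrite expnMn expnS ltn_pmul2r ?expn_gt0.
pose E := {ffun 'I_k -> 'I_d}; pose B := 'X_{1..m < b}.
pose mon (e : E) : 'X_{1..k} := [multinom (e i : nat) | i < k].
have inj_mon : injective mon.
  by move=> e f /mnmP eq_ef; apply/ffunP => i; apply/val_inj; have := eq_ef i; rewrite !mnmE.
pose t := [tuple y i | i < k].
pose M : 'M[K]_(#|{: E}|, #|{: B}|) :=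
  \matrix_(i, j) ('X_[mon (enum_val i)] \mPo t)@_(bmnm (enum_val j)).
have: kermx M != 0.
  rewrite -mxrank_eq0 mxrank_ker subn_eq0 -ltnNge.
  apply: leq_ltn_trans (rank_leq_col _) _; apply: leq_ltn_trans (card_bmultinom _ _) _.
  by rewrite card_ffun !card_ord.
case/rowV0Pn=> x /sub_kermxP xM0 x_neq0.
exists (\sum_i x 0 i *: 'X_[mon (enum_val i)]).
  case/rV0Pn: x_neq0 => i xi_neq0; apply: contraNneq xi_neq0 => /(congr1 (mcoeff (mon (enum_val i)))).
  rewrite mcoeff0 raddf_sum (bigD1 i) //= mcoeffZ mcoeffX eqxx mulr1 big1 ?addr0 => [->//|j neq_ji].
  rewrite mcoeffZ mcoeffX (inj_eq inj_mon) (inj_eq enum_val_inj) (negPf neq_ji).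
  exact: mulr0.
rewrite raddf_sum /=; apply/mpolyP => u; rewrite mcoeff0 raddf_sum /=.
have [ltu|geu] := ltnP (mdeg u) b; last first.
  rewrite big1 // => i _; rewrite comp_mpolyZ mcoeffZ [X in _ * X]memN_msupp_eq0 ?mulr0 //.
  apply: msize_mdeg_ge; apply: leq_trans geu.
  rewrite comp_mpolyX /b; set e := enum_val i.
  apply: (@leq_trans (\sum_(j < k) d * D)%N.+1); last first.
    by rewrite sum_nat_const card_ord.
  elim/big_rec2: _ => [|j s p _ IH]; first by rewrite msize1.
  apply: msize_mul_deg => //; apply: leq_trans (msize_exp_deg _ (_ : _ <= D.+1)%N) _.
    by rewrite tnth_mktuple.
  by rewrite ltnS leq_mul2r mnmE ltnW ?orbT.
have /rowP/(_ (enum_rank (BMultinom ltu))) := xM0; rewrite !mxE => xMu.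
rewrite -[RHS]xMu; apply: eq_bigr => i _; rewrite comp_mpolyZ mcoeffZ mxE.
by rewrite enum_rankK.
Qed.
End AlgebraicDependence.

(** * Prime chains and independence modulo primes *)

Section PrimeChains.
Variables (K : fieldType).

Lemma mpoly_split_var k (F : {mpoly K[k]}) (x : 'I_k) :
  exists F0 F1 : {mpoly K[k]}, [/\ F = F0 + 'X_x * F1,
    forall u, u \in msupp F0 -> u x = 0%N /\ u \in msupp F
  & forall u, u \in msupp F1 -> (u + U_(x))%MM \in msupp F].
Proof.
exists (\sum_(u <- msupp F | u x == 0%N) F@_u *: 'X_[u]).
exists (\sum_(u <- msupp F | u x != 0%N) F@_u *: 'X_[u - U_(x)]); split.
- rewrite {1}(mpolyE F) (bigID (fun u : 'X_{1..k} => u x == 0%N)) /=; congr (_ + _).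
  rewrite mulr_sumr; apply: eq_bigr => u ux; rewrite -scalerAr -mpolyXD addmC submK //.
  by rewrite lep1mP.
- move=> u /msupp_sum_le /flatten_mapP[v]; rewrite mem_filter => /andP[/eqP vx vF].
  by move=> /msuppZ_le /mem_msuppXP <-.
- move=> u /msupp_sum_le /flatten_mapP[v]; rewrite mem_filter => /andP[vx vF].
  by move=> /msuppZ_le /mem_msuppXP <-; rewrite submK // lep1mP.
Qed.

Definition small_vars k (s : nat) (F : {mpoly K[k]}) :=
  forall u, u \in msupp F -> forall i : 'I_k, (s <= i)%N -> u i = 0%N.

(* Elements [z] of a prime [Q] outside a smaller prime [P] extend families that
   are algebraically independent modulo [Q] to families independent modulo [P]. *)
Lemma prime_chain_indep m k r h (C : nat -> {mpoly K[m]} -> Prop)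
    (y : 'I_k -> {mpoly K[m]}) :
  (forall i, (i <= h)%N -> is_prime_ideal (C i)) ->
  (forall i, (i < h)%N -> forall p, C i p -> C i.+1 p) ->
  (forall j (x : 'I_k), (j < h)%N -> x = (r + j)%N :> nat ->
     C (h - j)%N (y x) /\ ~ C (h - j.+1)%N (y x)) ->
  (forall F, small_vars r F -> C h (F \mPo [tuple y i | i < k]) -> F = 0) ->
  forall j, (j <= h)%N -> (r + j <= k)%N ->
  forall F, small_vars (r + j) F -> C (h - j)%N (F \mPo [tuple y i | i < k]) -> F = 0.
Proof.
move=> primeC subC yC base; elim=> [|j IHj]; first by rewrite addn0 subn0.
rewrite addnS => lt_jh lt_rjk F.
have {IHj}IHj := IHj (ltnW lt_jh) (ltnW lt_rjk).
pose x := Ordinal lt_rjk; have [Cyx nCyx] := yC j x lt_jh erefl.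
have def_hj : (h - j = (h - j.+1).+1)%N by lia.
have lt_h : (h - j.+1 < h)%N by lia.
have [idC _ primeCj] := primeC _ (leq_subr j.+1 h).
have [idC' _ _] := primeC _ (leq_subr j h).
have [l] := ubnP (msize F); elim: l F => // l IHl F le_Fl smallF CF.
have [F0 [F1 [defF F0P F1P]]] := mpoly_split_var F x.
have yxE : 'X_x \mPo [tuple y i | i < k] = y x.
  by rewrite comp_mpolyXU -tnth_nth tnth_mktuple.
(* Modulo the larger prime [y x] vanishes, so [F0] is a relation there and the outer induction
   applies. *)
have F0_0 : F0 = 0.
  apply: IHj => [u /F0P[ux uF] i|].
    by rewrite leq_eqVlt => /predU1P[rji|/(smallF u uF)//]; rewrite -ux; congr (u _); apply/val_inj.
  have -> : F0 = F - F1 * 'X_x by rewrite {1}defF mulrC addrK.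
  rewrite raddfB /= rmorphM /= yxE; apply: idealB => //.
    by rewrite def_hj; apply: subC.
  by case: idC' => _ _; apply.
(* Primality cancels the factor [y x], and [F1] is a relation of smaller size. *)
move: CF; rewrite {1}defF F0_0 add0r rmorphM /= yxE => /primeCj[//|CF1].
have [F_0|F_neq0] := eqVneq F 0; first by [].
suff F1_0 : F1 = 0 by rewrite defF F0_0 F1_0 mulr0 addr0.
apply: IHl => //; last first.
  move=> u /F1P uF i le_i; have := smallF _ uF i le_i; rewrite mnmDE.
  by move/eqP; rewrite addn_eq0 => /andP[/eqP].
have F_gt0 : (0 < msize F)%N by rewrite lt0n msize_poly_eq0.
apply: leq_trans (_ : (msize F <= l)%N); last by rewrite -ltnS.
rewrite -[msize F]prednK // ltnS msizeE; apply/bigmax_leqP_seq => u /F1P uF _.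
by have := msize_mdeg_lt uF; rewrite mdegD mdeg1; lia.
Qed.

(** If [Q] is strictly larger than [I], dropping the smallest prime and appending [Q] keeps the
    length. *)
Lemma prime_chain_shift m (I Q : {mpoly K[m]} -> Prop) h :
  prime_chain_to I h -> is_prime_ideal Q -> (forall p, I p -> Q p) ->
  prime_chain_to Q h.
Proof.
move=> [C [primeC subC CI]] primeQ IQ.
have [QI|nQI] := classic (forall p, Q p -> I p).
  by exists C; split=> // p; split=> [/CI/IQ//|/QI/CI].
have [q [Qq nIq]] : exists q, Q q /\ ~ I q.
  by apply: NNPP => noq; apply: nQI => p Qp; apply: NNPP => nIp; apply: noq; exists p.
exists (fun i => if (i < h)%N then C i.+1 else Q); split=> [i _|i lt_ih|p].
- by case: ifP => // lt_ih; apply: primeC.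
- rewrite lt_ih; case: ltnP => [lt_i1h|ge_i1h]; first exact: subC.
  have def_h : h = i.+1 by apply/eqP; rewrite eqn_leq ge_i1h.
  by split=> [p|]; [rewrite -def_h => /CI/IQ | exists q; rewrite -def_h; split=> // /CI].
- by rewrite ltnn.
Qed.

End PrimeChains.

(** * The height as the dimension of the space of relations *)

Section Height.
Variables (K : fieldType) (m N : nat) (a : 'I_m -> 'X_{1..N}).

Definition expmx : 'M[rat]_(m, N) := \matrix_(i, x) (a i x)%:R.

Definition mvec k (u : 'X_{1..k}) : 'rV[rat]_k := \row_i (u i)%:R.

Lemma mvec_inj k : injective (@mvec k).
Proof.
move=> u v /rowP eq_uv; apply/mnmP => i; have := eq_uv i; rewrite !mxE => /eqP.
by rewrite eqr_nat => /eqP.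
Qed.

Lemma mvecD k (u v : 'X_{1..k}) : mvec (u + v)%MM = mvec u + mvec v.
Proof. by apply/rowP => i; rewrite !mxE mnmDE natrD. Qed.

Lemma mvec_wdeg u : mvec (wdeg a u) = mvec u *m expmx.
Proof.
apply/rowP => x; rewrite !mxE wdegE natr_sum; apply: eq_bigr => i _.
by rewrite !mxE natrM mulrC.
Qed.

(** The dimension of the left kernel of [expmx], the space of relations between the vectors
    [a i]. *)
Definition relation_rank := (m - \rank expmx)%N.

(** The vanishing clause keeps the supports of [u] and [v] inside that of [l], so that a relation on
    a subgraph yields monomials of that subgraph. *)
Lemma clear_denominators k (l : 'I_k -> rat) :
  exists D (u v : 'X_{1..k}), (0 < D)%N /\
    forall j, D%:R * l j = (u j)%:R - (v j)%:R /\ (l j = 0 -> u j = 0%N /\ v j = 0%N).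
Proof.
pose D := (\prod_j `|denq (l j)|)%N.
have D_gt0 : (0 < D)%N by rewrite prodn_gt0 // => j; rewrite absz_gt0 denq_eq0.
have int_l j : exists z : int, D%:R * l j = z%:~R.
  exists ((\prod_(i | i != j) `|denq (l i)|)%N%:Z * numq (l j)).
  rewrite /D (bigD1 j) //= natrM intrM mulrAC mulrC; congr (_ * _).
  rewrite pmulrn absz_denq numqE mulrC.
  by [].
have [z zP] := fin_all_exists int_l.
exists D, [multinom (if (0 <= z j)%R then `|z j|%N else 0%N) | j < k].
exists [multinom (if (0 <= z j)%R then 0%N else `|z j|%N) | j < k].
split=> // j; split; last first.
  move=> lj0; have := zP j; rewrite lj0 mulr0 => /esym/eqP; rewrite intr_eq0 => /eqP z0.
  by rewrite !mnmE z0.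
rewrite zP !mnmE; case: ifP => z_ge0.
  by rewrite subr0 pmulrn gez0_abs.
rewrite sub0r pmulrn ltz0_abs ?mulrNz ?opprK //.
by rewrite ltNge z_ge0.
Qed.

Local Notation r := (\rank expmx).
Local Notation b := (maxrankfun expmx).

(** The variables of a maximal independent set of rows are independent modulo the ideal, since their
    monomials have distinct multidegrees. Adding one element that separates each step of the chain
    gives [r + h] polynomials independent modulo the bottom prime, hence at most [m]. *)
Lemma mono_chain_upper h : prime_chain_to (@mono_ideal K m N a) h -> (h <= relation_rank)%N.
Proof.
move=> [C [primeC subC CI]]; rewrite /relation_rank.
have /fin_all_exists[y yP] (x : 'I_(r + h)) : exists p : {mpoly K[m]},
    (forall i, lshift h i = x -> p = 'X_(b i)) /\
    (forall j, (j < h)%N -> x = (r + j)%N :> nat -> C (h - j)%N p /\ ~ C (h - j.+1)%N p).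
  case: (split_ordP x) => [i ->|j ->].
    exists 'X_(b i); split=> [i' /lshift_inj->//|j _ /= def_i].
    by have := ltn_ord i; rewrite def_i ltnNge leq_addr.
  have [_ [p [Cp nCp]]] := subC (h - j.+1)%N ltac:(have := ltn_ord j; lia).
  exists p; split=> [i /eqP|j' _ /addnI <-]; first by rewrite eq_lrshift.
  by have -> : (h - j = (h - j.+1).+1)%N by have := ltn_ord j; lia.
pose t := [tuple y i | i < r + h].
pose c (i : 'I_(r + h)) : 'X_{1..m} :=
  match split i with inl i => U_(b i)%MM | inr _ => 0%MM end.
have compX (u : 'X_{1..r + h}) : (forall i : 'I_(r + h), (r <= i)%N -> u i = 0%N) ->
    'X_[u] \mPo t = 'X_[wdeg c u] :> {mpoly K[m]}.
  move=> small_u; rewrite comp_mpolyX /wdeg -mprodXE; apply: eq_bigr => i _.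
  rewrite tnth_mktuple -mpolyXn /c; case: (split_ordP i) => [j def_i|j def_i].
    by case: (yP i) => /(_ j (esym def_i)) -> _.
  by rewrite (small_u i) ?expr0 // def_i /= leq_addr.
pose rho (u : 'X_{1..r + h}) : 'rV[rat]_r := \row_i (u (lshift h i))%:R.
have rhoE u : mvec (wdeg a (wdeg c u)) = rho u *m rowsub b expmx.
  rewrite mvec_wdeg; apply/rowP => x; rewrite !mxE.
  under eq_bigr => j _ do rewrite !mxE wdegE natr_sum mulr_suml.
  rewrite exchange_big big_split_ord /= [X in _ + X]big1 ?addr0; last first.
    move=> i _; rewrite big1 // => j _.
    by rewrite /c (unsplitK (inr _ i)) mnm0E mul0n mul0r.
  apply: eq_bigr => i _; rewrite (bigD1 (b i)) //= big1 ?addr0.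
    by rewrite /c (unsplitK (inl _ i)) mnm1E eqxx mul1n !mxE.
  move=> j /negPf neq_j.
  by rewrite /c (unsplitK (inl _ i)) mnm1E eq_sym neq_j mul0n mul0r.
have inj_small (u v : 'X_{1..r + h}) : (forall i : 'I_(r + h), (r <= i)%N -> u i = 0%N) ->
    (forall i : 'I_(r + h), (r <= i)%N -> v i = 0%N) ->
    wdeg a (wdeg c u) = wdeg a (wdeg c v) -> u = v.
  move=> small_u small_v /(congr1 (@mvec _)); rewrite !rhoE.
  move/(row_free_inj (maxrowsub_free _)) => /rowP eq_uv; apply/mnmP => i.
  case: (split_ordP i) => j ->; last by rewrite small_u ?small_v //= leq_addr.
  by have := eq_uv j; rewrite !mxE => /eqP; rewrite eqr_nat => /eqP.
have indep := @prime_chain_indep K m (r + h) r h C y primeC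
  (fun i lt_ih => (subC i lt_ih).1) (fun j x => (yP x).2 j).
have base G : small_vars r G -> C h (G \mPo t) -> G = 0.
  move=> smallG /CI/mono_idealP G0; apply/mpolyP => u; rewrite mcoeff0.
  have [uG|/memN_msupp_eq0//] := boolP (u \in msupp G).
  have := G0 (wdeg a (wdeg c u)); rewrite comp_mpolyEX msum_sum big_seq.
  rewrite (eq_bigr (fun v => if v == u then G@_u else 0)) => [|v vG].
    rewrite -big_seq (bigD1_seq u) ?msupp_uniq //= eqxx big1 ?addr0 // => v.
    by move/negPf ->.
  rewrite msumZ compX; last exact: smallG.
  rewrite msumX; case: (eqVneq v u) => [->|/eqP neq_vu]; first by rewrite eqxx mulr1.
  case: eqP => [/inj_small eq_uv|_]; last by rewrite mulr0.
  by case: neq_vu; apply: eq_uv; apply: smallG.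
rewrite leqNgt; apply/negP => lt_h; have r_le := rank_leq_row expmx.
have [|F F_neq0 Ft0] := @algebraic_dependence K m (r + h) y; first by lia.
move/eqP: F_neq0; apply; apply: (indep base h) => //.
- by move=> u _ i; have := ltn_ord i; lia.
- by rewrite Ft0; have [[]] := primeC (h - h)%N (leq_subr _ _).
Qed.

(* Recording the exponents of fewer and fewer variables [T] gives the prime chain. *)
Definition marked (T : seq 'I_m) (j : 'I_m) : 'X_{1..N + m} :=
  [multinom match split x with
            | inl x => a j x
            | inr i => ((j == i) && (j \in T) : nat) end | x < N + m].

Lemma wdeg_marked T u v : wdeg (marked T) u = wdeg (marked T) v <->
  wdeg a u = wdeg a v /\ forall j, j \in T -> u j = v j.
Proof.
have lE w x : wdeg (marked T) w (lshift m x) = wdeg a w x.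
  by rewrite !wdegE; apply: eq_bigr => i _; rewrite mnmE (unsplitK (inl _ x)).
have rE w j : wdeg (marked T) w (rshift N j) = ((j \in T) * w j)%N.
  rewrite wdegE (bigD1 j) //= mnmE (unsplitK (inr _ j)) eqxx big1 ?addn0 // => i.
  by rewrite mnmE (unsplitK (inr _ j)) => /negPf ->.
split=> [/mnmP eq_uv|[/mnmP eq_uv eqT]].
  split=> [|j jT]; first by apply/mnmP => x; rewrite -!lE.
  by have := eq_uv (rshift N j); rewrite !rE jT !mul1n.
apply/mnmP => x; case: (split_ordP x) => j ->; rewrite ?lE ?rE //.
by case: (boolP (j \in T)) => // /eqT ->.
Qed.

Lemma marked_ideal_sub T T' p : {subset T' <= T} ->
  @mono_ideal K m _ (marked T) p -> mono_ideal (marked T') p.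
Proof.
move=> subT; have [idI _ _] := @mono_ideal_prime K m _ (marked T').
apply: mono_ideal_ind => // u v /wdeg_marked[eq_uv eqT].
by apply/mono_ideal_bin/wdeg_marked; split=> // j /subT/eqT.
Qed.

(** Unmarking [c], a row outside the maximal independent set, enlarges the ideal strictly: [row c]
    is a combination of the independent rows, and this relation involves no other row of [cs]. *)
Lemma mono_chain : prime_chain_to (@mono_ideal K m N a) relation_rank.
Proof.
pose cs := enum [predC codom b]; have Ucs : uniq cs by apply: enum_uniq.
have sub_cs : {subset cs <= [predC codom b]} by move=> j; rewrite mem_enum.
have size_cs : size cs = relation_rank.
  rewrite -cardE /relation_rank -[X in (X - _)%N](card_ord m) -(cardC (mem (codom b))).
  by rewrite (card_codom (@maxrankfun_inj _ _ _ _)) card_ord addKn.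
exists (fun i => mono_ideal (marked (drop i cs))); split=> [i _|i lt_ih|p].
- exact: mono_ideal_prime.
- have {}lt_ih : (i < size cs)%N by rewrite size_cs.
  have [c def_cs] : exists c, drop i cs = c :: drop i.+1 cs.
    case: (cs) lt_ih => // c0 cs' lt_ih; exists (nth c0 (c0 :: cs') i); exact: drop_nth.
  have c_in : c \in cs by rewrite (mem_drop (n0 := i)) // def_cs mem_head.
  have c_notin : c \notin drop i.+1 cs.
    by have := drop_uniq i Ucs; rewrite def_cs => /andP[].
  split=> [p|]; first by apply: marked_ideal_sub => j; rewrite def_cs inE orbC => ->.
  have /submxP[x def_x] : (row c expmx <= rowsub b expmx)%MS.
    by rewrite eq_maxrowsub row_sub.
  pose l : 'rV[rat]_m := delta_mx 0 c - \sum_k x 0 k *: delta_mx 0 (b k).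
  have lA : l *m expmx = 0.
    rewrite mulmxBl -rowE def_x mulmx_suml mulmx_sum_row -sumrB big1 // => k _.
    by rewrite -scalemxAl -rowE row_rowsub subrr.
  have lE j : j \in cs -> l 0 j = (j == c)%:R.
    move=> /sub_cs; rewrite !inE => j_cod; rewrite !mxE /= summxE big1 ?subr0 // => k _.
    rewrite !mxE eqxx /=; case: eqP => [def_j|]; last by rewrite mulr0.
    by rewrite def_j codom_f in j_cod.
  have [D [u [v [D_gt0 uvP]]]] := clear_denominators (l 0).
  exists (bin (u, v)); have eq_uv : wdeg a u = wdeg a v.
    apply/mvec_inj/eqP; rewrite -subr_eq0 !mvec_wdeg -mulmxBl.
    suff -> : mvec u - mvec v = D%:R *: l by rewrite -scalemxAl lA scaler0.
    by apply/rowP => j; rewrite [RHS]mxE (uvP _).1 !mxE.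
  split.
    apply/mono_ideal_bin/wdeg_marked; split=> // j jT; apply/eqP.
    rewrite -(eqr_nat rat) -subr_eq0 -(uvP _).1 lE ?(mem_drop jT) //.
    by have [def_j|] := eqVneq j c; [rewrite def_j (negPf c_notin) in jT | rewrite mulr0].
  move/mono_ideal_bin/wdeg_marked => [_ /(_ c)]; rewrite def_cs mem_head => /(_ isT) eq_c.
  by have := (uvP c).1; rewrite lE // eqxx mulr1 eq_c subrr => /eqP; rewrite pnatr_eq0 eqn0Ngt D_gt0.
- rewrite drop_oversize ?size_cs //.
  have [idI _ _] := @mono_ideal_prime K m _ a.
  have [idI' _ _] := @mono_ideal_prime K m _ (marked [::]).
  split; apply: mono_ideal_ind => // u v eq_uv; apply/mono_ideal_bin.
    by case/wdeg_marked: eq_uv.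
  by apply/wdeg_marked.
Qed.

Lemma mono_height h : has_height (@mono_ideal K m N a) h <-> h = relation_rank.
Proof.
have primeI := @mono_ideal_prime K m N a; split=> [[[Q [primeQ IQ leQ]] chainI]|->].
  apply/eqP; rewrite eqn_leq mono_chain_upper ?leQ //; last exact: chainI.
  exact: prime_chain_shift mono_chain _ _.
split; first by exists (mono_ideal a); split=> //; apply: mono_chain_upper.
by move=> Q primeQ IQ; apply: prime_chain_shift mono_chain _ _.
Qed.

End Height.

(** * Complete intersections and independent systems of binomials *)

Section Nakayama.
Variables (K : fieldType) (m : nat).
Implicit Types (S T : seq {mpoly K[m]}).

Lemma pihomog_mul_ideal (J : {mpoly K[m]} -> Prop) (g s : {mpoly K[m]}) d e :
  is_ideal J -> s \is e.-homog -> J s -> J (pihomog mdeg d (g * s)).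
Proof.
move=> idJ homs Js; rewrite (mpolyE g) mulr_suml raddf_sum.
apply: ideal_sum => // u _; rewrite -scalerAl /= linearZ /= -mul_mpolyC.
have [J0 _ JM] := idJ; apply: (JM).
have homXs : 'X_[u] * s \is (mdeg u + e).-homog by apply: dhomogM; rewrite ?dhomogX.
have [<-|neq_d] := eqVneq (mdeg u + e)%N d; first by rewrite pihomog_dE //; apply: JM.
by rewrite (pihomog_ne0 neq_d homXs).
Qed.

Lemma pihomog_mul_const (g s : {mpoly K[m]}) d :
  s \is d.-homog -> g@_0 = 0 -> pihomog mdeg d (g * s) = 0.
Proof.
move=> homs g0; rewrite (mpolyE g) mulr_suml raddf_sum big1_seq // => u /andP[_ ug].
rewrite -scalerAl /= linearZ /=.
have homXs : 'X_[u] * s \is (mdeg u + d).-homog by apply: dhomogM; rewrite ?dhomogX.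
rewrite (pihomog_ne0 _ homXs) ?scaler0 // -{2}[d]add0n eqn_add2r mdeg_eq0.
by apply: contraTneq ug => ->; rewrite mcoeff_msupp g0 eqxx.
Qed.

(** [T] may be inhomogeneous. If it is shorter than [S], some nonzero combination [x] of [S] is a
    combination of [T] with coefficients free of constant terms, and rewriting [T] in [S] keeps the
    constant terms zero. In the degree of an [s] with nonzero coefficient in [x], this expresses [s]
    by the others. *)
Lemma graded_nakayama S T : uniq S ->
  (forall s, s \in S -> exists d, s \is d.-homog) ->
  (forall s, s \in S -> in_ideal T s) -> (forall t, t \in T -> in_ideal S t) ->
  (forall s, s \in S -> ~ in_ideal (rem s S) s) -> (size S <= size T)%N.
Proof.
move=> US homS ST TS irrS; rewrite leqNgt; apply/negP => ltTS.
have /fin_all_exists[A A_P] (i : 'I_(size S)) := ST _ (mem_nth 0 (ltn_ord i)).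
have /fin_all_exists[C C_P] (j : 'I_(size T)) := TS _ (mem_nth 0 (ltn_ord j)).
pose M : 'M[K]_(size S, size T) := \matrix_(i, j) (A i j)@_0.
have: kermx M != 0.
  rewrite -mxrank_eq0 mxrank_ker subn_eq0 -ltnNge.
  exact: leq_ltn_trans (rank_leq_col _) ltTS.
case/rowV0Pn=> x /sub_kermxP xM0 /rV0Pn[i0 xi0].
pose e j := \sum_i x 0 i *: A i j; pose g k := \sum_j e j * C j k.
have e0 j : (e j)@_0 = 0.
  have /rowP/(_ j) := xM0; rewrite !mxE => xMj; rewrite -[RHS]xMj raddf_sum.
  by apply: eq_bigr => i _; rewrite /= mcoeffZ mxE.
have g0 k : (g k)@_0 = 0.
  rewrite raddf_sum big1 // => j _.
  by rewrite /= rmorphM /= e0 mul0r.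
have eq_xS : \sum_i x 0 i *: S`_i = \sum_k g k * S`_k.
  transitivity (\sum_j e j * T`_j).
    under eq_bigr => i _ do rewrite A_P scaler_sumr.
    rewrite exchange_big; apply: eq_bigr => j _; rewrite mulr_suml.
    by apply: eq_bigr => i _; rewrite scalerAl.
  under eq_bigr => j _ do rewrite C_P mulr_sumr.
  rewrite exchange_big; apply: eq_bigr => k _; rewrite mulr_suml.
  by apply: eq_bigr => j _; rewrite mulrA.
set s := S`_i0; have sS : s \in S by apply: mem_nth.
have [d homs] := homS s sS; apply: (irrS s sS).
have idJ := in_ideal_is_ideal (rem s S).
have JS k : k != i0 -> in_ideal (rem s S) S`_k.
  move=> neq_k; apply: mem_in_ideal; rewrite mem_rem_uniq // inE mem_nth // andbT.
  by rewrite nth_uniq.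
have J2 : in_ideal (rem s S) (x 0 i0 *: s).
  have := congr1 (pihomog mdeg d) eq_xS; rewrite !raddf_sum.
  rewrite (bigD1 i0) // [RHS](bigD1 i0) //= (pihomog_mul_const homs (g0 _)) add0r.
  rewrite /= linearZ /= (pihomog_dE homs) => /(canRL (addrK _)) ->.
  apply: idealB => //; apply: ideal_sum => // k neq_k;
    have [f homk] := homS _ (mem_nth 0 (ltn_ord k)).
    by apply: (pihomog_mul_ideal _ _ _ homk) => //; apply: JS.
  by rewrite -mul_mpolyC; apply: (pihomog_mul_ideal _ _ _ homk) => //; apply: JS.
have [_ _ /(_ (x 0 i0)^-1%:MP _ J2)] := idJ.
by rewrite mul_mpolyC scalerA mulVf // scale1r.
Qed.

End Nakayama.

Lemma mulmx_col (R : pzSemiRingType) m n p (A : 'M[R]_(m, n)) (B : 'M_(n, p)) j :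
  A *m col j B = col j (A *m B).
Proof. by rewrite !colE mulmxA. Qed.

(** * Spans of relations *)

Section Span.
Variables (K : fieldType) (m N : nat) (a : 'I_m -> 'X_{1..N}).
Local Notation pairs := (seq ('X_{1..m} * 'X_{1..m})).
Local Notation bins S := (map (@bin K m) S).
Local Notation I := (@mono_ideal K m N a).
Implicit Types (S : pairs) (q : 'X_{1..m} * 'X_{1..m}).

Definition pv q : 'rV[rat]_m := mvec q.1 - mvec q.2.

(* Linear span in dual form: every functional vanishing on [S] vanishes on [l]. *)
Definition in_span S (l : 'rV[rat]_m) :=
  forall x : 'cV[rat]_m, (forall q, q \in S -> pv q *m x = 0) -> l *m x = 0.

Definition indep S :=
  uniq S /\ forall q S', q \in S -> {subset S' <= S} -> q \notin S' -> ~ in_span S' (pv q).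

Definition pvmx S : 'M[rat]_(size S, m) := \matrix_(i < size S) pv (nth (0%MM, 0%MM) S i).

(** [good] passes to divisors and depends only on the multidegree, so going from [u] to [v] uses
    only good generators, and a functional vanishing on those is constant on the way; [None]
    collects the other monomials. Instances of [good] bound the support, the degree at a vertex or
    the total degree. *)
Lemma generates_span S (good : pred 'X_{1..m}) u v : generates (bins S) I ->
  (forall u v, wdeg a u = wdeg a v -> good u = good v) ->
  (forall u v, good (u + v)%MM -> good v) ->
  wdeg a u = wdeg a v -> good u -> in_span [seq q <- S | good q.1] (pv (u, v)).
Proof.
move=> gS goodE goodD eq_uv good_u x x0.
pose tau w := if good w then Some ((mvec w *m x) 0 0) else None.
have [idI _ _] := @mono_ideal_prime K m N a.
have [SI IS] := (generatesP _ idI).1 gS.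
have : tau u = tau v; last rewrite /tau -(goodE _ _ eq_uv) good_u => -[eq_x].
  apply: (@bin_ideal_invariant K m _ tau S); last by apply/IS/mono_ideal_bin.
  move=> q qS w; have /SI/mono_ideal_bin eq_q : bin q \in bins S by apply: map_f.
  rewrite /tau -(goodE (w + q.1)%MM); last by rewrite !wdegD eq_q.
  case: ifP => // /goodD good_q; rewrite !mvecD !mulmxDl.
  congr (Some ((_ + _ : 'M_1) 0 0)); apply/eqP; rewrite -subr_eq0 -mulmxBl.
  by apply/eqP/x0; rewrite mem_filter good_q.
apply/rowP => j; rewrite ord1 mulmxBl !mxE.
by move: eq_x; rewrite !mxE => ->; rewrite subrr.
Qed.

Lemma in_spanP S l : in_span S l <-> (l <= pvmx S)%MS.
Proof.
split=> [span_l|/submxP[c ->] x x0]; last first.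
  rewrite -mulmxA (_ : pvmx S *m x = 0) ?mulmx0 //; apply/row_matrixP => i.
  by rewrite row_mul rowK row0 x0 // mem_nth.
rewrite submxE; apply/eqP/rowP => j; rewrite [RHS]mxE.
have := span_l (col j (cokermx (pvmx S))) _; rewrite mulmx_col => span_j.
have /colP/(_ 0) : col j (l *m cokermx (pvmx S)) = 0; last by rewrite !mxE.
apply: span_j => q qS; have lt_q : (index q S < size S)%N by rewrite index_mem.
have <- : row (Ordinal lt_q) (pvmx S) = pv q by rewrite rowK /= nth_index.
by rewrite mulmx_col -row_mul mulmx_coker row0 col0.
Qed.

Lemma relation_in_span S (l : 'rV[rat]_m) : generates (bins S) I ->
  l *m expmx a = 0 -> in_span S l.
Proof.
move=> gS lA; have [D [u [v [D_gt0 uvP]]]] := clear_denominators (l 0).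
have def_l : D%:R *: l = pv (u, v).
  by apply/rowP => j; rewrite mxE (uvP _).1 !mxE.
have eq_uv : wdeg a u = wdeg a v.
  apply/mvec_inj/eqP; rewrite -subr_eq0 !mvec_wdeg -mulmxBl -/(pv (u, v)) -def_l.
  by rewrite -scalemxAl lA scaler0.
have := @generates_span S xpredT u v gS _ _ eq_uv isT; rewrite filter_predT => span_uv.
move=> x /span_uv; rewrite -def_l -scalemxAl => /(_ (fun _ _ _ => erefl) (fun _ _ _ => isT)).
by move/eqP; rewrite scaler_eq0 pnatr_eq0 eqn0Ngt D_gt0 => /eqP.
Qed.

(** The rows of [pvmx S] span the whole kernel, so they are independent once they are no more
    numerous than its dimension. *)
Lemma generates_indep S : uniq S -> generates (bins S) I ->
  (size S <= relation_rank a)%N -> indep S.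
Proof.
move=> US gS leS; split=> // q S' qS subS' qS' span_q.
have free_S : row_free (pvmx S).
  rewrite /row_free eqn_leq rank_leq_row /=; apply: leq_trans leS _.
  rewrite /relation_rank -mxrank_ker; apply/mxrankS/row_subP => i; apply/in_spanP.
  apply: relation_in_span => //; apply/sub_kermxP; exact: row_sub.
have lt_q : (index q S < size S)%N by rewrite index_mem.
have rowE q' (lt_q' : (index q' S < size S)%N) : row (Ordinal lt_q') (pvmx S) = pv q'.
  by rewrite rowK /= nth_index // -index_mem.
(* This column of the right inverse reads off the coefficient of [q]. *)
have := span_q (col (Ordinal lt_q) (pinvmx (pvmx S))) _; rewrite -(rowE q lt_q).
rewrite mulmx_col -row_mul mulmxVp // => col0.
have /rowP/(_ 0) : col (Ordinal lt_q) (row (Ordinal lt_q) 1%:M) = 0 :> 'M[rat]_1; last first.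
  by rewrite !mxE eqxx => /eqP; rewrite oner_eq0.
apply: col0 => q' qS''; have lt_q' : (index q' S < size S)%N by rewrite index_mem subS'.
rewrite -(rowE q' lt_q') mulmx_col -row_mul mulmxVp //.
apply/rowP => j; rewrite !mxE; case: eqP => // -[eq_i].
by case/negP: qS'; rewrite -(nth_index (0%MM, 0%MM) qS) -eq_i nth_index // subS'.
Qed.

Lemma indep_size S : indep S -> (forall q, q \in S -> wdeg a q.1 = wdeg a q.2) ->
  (size S <= relation_rank a)%N.
Proof.
move=> [US indS] S_L; rewrite /relation_rank -mxrank_ker.
have free_S : row_free (pvmx S).
  rewrite -kermx_eq0; apply: contraT => /rowV0Pn[x /sub_kermxP xS0 /rV0Pn[i xi]].
  pose q := nth (0%MM, 0%MM) S i; have qS : q \in S by apply: mem_nth.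
  case: (indS q (rem q S) qS (@mem_rem _ _ _)); first by rewrite mem_rem_uniqF.
  move=> y y0; have : x *m pvmx S *m y = 0 by rewrite xS0 mul0mx.
  rewrite (mulmx_sum_row x) mulmx_suml (bigD1 i) //= big1 ?addr0.
    rewrite rowK -scalemxAl => /eqP; rewrite scaler_eq0 (negPf xi) /=.
    by move/eqP.
  move=> j neq_ji; rewrite rowK -scalemxAl y0 ?scaler0 //.
  by rewrite mem_rem_uniq // inE mem_nth // nth_uniq // neq_ji.
rewrite -(eqP free_S); apply/mxrankS/row_subP => i; rewrite rowK.
apply/sub_kermxP; rewrite mulmxBl -!mvec_wdeg S_L ?subrr //.
exact: mem_nth.
Qed.

Lemma sub_indep S S' : indep S -> uniq S' -> {subset S' <= S} -> indep S'.
Proof.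
move=> [US indS] US' subS; split=> // q S'' qS' subS'' qS''.
by apply: indS qS'' => [|p /subS''/subS //]; apply: subS.
Qed.

End Span.

Section CompleteIntersections.
Variables (K : fieldType) (m N : nat) (a : 'I_m -> 'X_{1..N}).
Local Notation pairs := (seq ('X_{1..m} * 'X_{1..m})).
Local Notation bins S := (map (@bin K m) S).
Local Notation I := (@mono_ideal K m N a).
Implicit Types (S : pairs).

Definition irredundant S :=
  forall q, q \in S -> ~ in_ideal (bins (rem q S)) (bin q).

Lemma irredundant_neq S q : irredundant S -> q \in S -> q.1 <> q.2.
Proof.
move=> irrS qS eq_q; apply: (irrS q qS); rewrite /bin eq_q subrr.
by have [] := in_ideal_is_ideal (bins (rem q S)).
Qed.

Lemma irredundant_uniq S : irredundant S -> uniq S -> uniq (bins S).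
Proof.
move=> irrS US; rewrite map_inj_in_uniq // => p q pS qS eq_pq.
apply: NNPP => /eqP neq_pq; apply: (irrS p pS); rewrite eq_pq.
by apply/mem_in_ideal/map_f; rewrite mem_rem_uniq // inE qS eq_sym neq_pq.
Qed.

(** One pair is kept per distinct binomial, which turns minimality of a set into irredundance of a
    list. *)
Lemma minimal_system_pairs (Sp : seq {mpoly K[m]}) : minimal_binomial_system Sp I ->
  exists S, [/\ uniq S, bins S =i Sp, generates (bins S) I & irredundant S].
Proof.
move=> [binSp gSp minSp]; have [idI _ _] := @mono_ideal_prime K m N a.
have [S defS] : exists S, bins S = undup Sp.
  have: forall p, p \in undup Sp -> is_binomial p by move=> p; rewrite mem_undup => /binSp.
  elim: (undup Sp) => [|p U IH] binU; first by exists [::].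
  have [|S defS] := IH; first by move=> r rU; apply: binU; rewrite inE rU orbT.
  have [u [v ->]] := binU p (mem_head _ _); exists ((u, v) :: S).
  by rewrite /= defS.
have US : uniq S by apply: (@map_uniq _ _ (@bin K m)); rewrite defS undup_uniq.
have SSp : bins S =i Sp by move=> p; rewrite defS mem_undup.
have [SpI ISp] := (generatesP _ idI).1 gSp.
have gS : generates (bins S) I.
  apply/generatesP => //; split=> [p|p /ISp]; first by rewrite SSp => /SpI.
  by apply: in_ideal_sub => s; rewrite -SSp => /mem_in_ideal.
exists S; split=> // q qS redq.
have subR : {subset bins (rem q S) <= bins S}.
  by move=> _ /mapP[p /mem_rem pS ->]; apply: map_f.
have gR : generates (bins (rem q S)) I.
  have [SI IS] := (generatesP _ idI).1 gS.
  apply/generatesP => //; split=> [p /subR/SI//|p /IS].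
  apply: in_ideal_sub => _ /mapP[p' p'S ->].
  have [->//|neq_p] := eqVneq p' q.
  by apply/mem_in_ideal/map_f; rewrite mem_rem_uniq // inE neq_p.
have subS : {subset Sp <= bins (rem q S)}.
  by apply: minSp gR => p /subR; rewrite SSp.
have /subS bq : bin q \in Sp by rewrite -SSp map_f.
have : uniq (bins S) by rewrite defS undup_uniq.
by rewrite (perm_uniq (perm_map _ (perm_to_rem qS))) /= bq.
Qed.

(** Equal multidegrees then force equal degrees, so the binomials of the ideal are homogeneous, as
    graded Nakayama requires. *)
Hypothesis mdeg_a : forall i, mdeg (a i) = 2%N.

Lemma mdeg_wdeg u : mdeg (wdeg a u) = (2 * mdeg u)%N.
Proof.
rewrite /wdeg mdeg_sum mdegE big_distrr; apply: eq_bigr => i _.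
by rewrite mdegMn mdeg_a.
Qed.

Lemma wdeg_mdeg u v : wdeg a u = wdeg a v -> mdeg u = mdeg v.
Proof. by move/(congr1 (@mdeg _)); rewrite !mdeg_wdeg => /eqP; rewrite eqn_pmul2l // => /eqP. Qed.

Lemma bin_homog u v : wdeg a u = wdeg a v -> (bin (u, v) : {mpoly K[m]}) \is (mdeg u).-homog.
Proof.
by move/wdeg_mdeg => eq_uv; rewrite /bin rpredB //= dhomogX //= eq_uv.
Qed.

Lemma irredundant_size S (T : seq {mpoly K[m]}) :
  uniq S -> irredundant S -> (forall q, q \in S -> wdeg a q.1 = wdeg a q.2) ->
  (forall q, q \in S -> in_ideal T (bin q)) ->
  (forall t, t \in T -> in_ideal (bins S) t) -> (size S <= size T)%N.
Proof.
move=> US irrS S_L ST TS; rewrite -(size_map (@bin K m)).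
apply: graded_nakayama => //; first exact: irredundant_uniq.
- by move=> _ /mapP[[u v] qS ->]; exists (mdeg u); apply/bin_homog/(S_L _ qS).
- by move=> _ /mapP[q qS ->]; apply: ST.
move=> _ /mapP[q qS ->] redq; apply: (irrS q qS); apply: in_ideal_sub redq => s.
rewrite mem_rem_uniq ?irredundant_uniq // => /andP[neq_s /mapP[p pS def_s]].
rewrite def_s; apply/mem_in_ideal/map_f; rewrite mem_rem_uniq // inE pS andbT.
by apply: contraNneq neq_s => <-; rewrite def_s.
Qed.

Lemma bins_complete_intersection S :
  generates (bins S) I -> size S = relation_rank a -> complete_intersection I.
Proof. by move=> gS sizeS; exists (bins S); rewrite size_map; split=> //; apply/mono_height. Qed.

Lemma generates_wdeg S q : generates (bins S) I -> q \in S -> wdeg a q.1 = wdeg a q.2.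
Proof.
have [idI _ _] := @mono_ideal_prime K m N a => /(generatesP _ idI)[SI _] qS.
by case: q qS => u v qS; apply/(@mono_ideal_bin K)/SI/map_f.
Qed.

Lemma complete_intersection_indep S : complete_intersection I ->
  uniq S -> irredundant S -> generates (bins S) I -> indep S.
Proof.
move=> [T [gT /mono_height sizeT]] US irrS gS.
have [idI _ _] := @mono_ideal_prime K m N a.
have [TI IT] := (generatesP _ idI).1 gT; have [SI IS] := (generatesP _ idI).1 gS.
apply: (generates_indep US gS); rewrite -sizeT; apply: irredundant_size => //.
- by move=> q; apply: generates_wdeg.
- by move=> q qS; apply/IT/SI/map_f.
- by move=> t /TI/IS.
Qed.

Lemma indep_complete_intersection S :
  generates (bins S) I -> indep S -> complete_intersection I.
Proof.
move=> gS indS; apply: (bins_complete_intersection gS); apply/eqP.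
rewrite eqn_leq (indep_size indS) /=; last by move=> q; apply: generates_wdeg.
rewrite /relation_rank -mxrank_ker; apply: leq_trans (rank_leq_row (pvmx S)).
apply/mxrankS/row_subP => i; apply/in_spanP; apply: relation_in_span => //.
by apply/sub_kermxP; apply: row_sub.
Qed.

End CompleteIntersections.

(** * Edge vectors and odd closed walks *)

Section GraphVectors.
Variables (n m : nat) (ends : 'I_m -> 'I_n * 'I_n).
Implicit Types (U V W C : {set 'I_n}) (l : 'rV[rat]_m) (u w : 'X_{1..m}) (e : 'I_m).

Definition edge_mnm e : 'X_{1..n} := (U_((ends e).1) + U_((ends e).2))%MM.
Local Notation vdeg := (wdeg edge_mnm).

Lemma mdeg_edge e : mdeg (edge_mnm e) = 2%N.
Proof. by rewrite mdegD !mdeg1. Qed.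

Lemma toric_idealE (K : fieldType) : toric_ideal ends K = @mono_ideal K m n edge_mnm.
Proof.
rewrite /toric_ideal /mono_ideal.
suff -> : toric_images ends K = [tuple 'X_[edge_mnm i] | i < m] by [].
by apply: eq_from_tnth => i; rewrite !tnth_mktuple mpolyXD.
Qed.

Lemma edge_mnmE e x : edge_mnm e x = (((ends e).1 == x) + ((ends e).2 == x))%N.
Proof. by rewrite mnmDE !mnm1E. Qed.

Definition ein U : {set 'I_m} := [set e | ((ends e).1 \in U) && ((ends e).2 \in U)].

Definition touch C e := ((ends e).1 \in C) || ((ends e).2 \in C).

Lemma einS U V : U \subset V -> ein U \subset ein V.
Proof.
move=> sUV; apply/subsetP => e; rewrite !inE => /andP[e1 e2].
by rewrite !(subsetP sUV).
Qed.

Definition vd l x : rat := (l *m expmx edge_mnm) 0 x.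

Lemma vdE l x : vd l x = \sum_e l 0 e * (edge_mnm e x)%:R.
Proof. by rewrite /vd mxE; apply: eq_bigr => e _; rewrite mxE. Qed.

Lemma vdB l l' x : vd (l - l') x = vd l x - vd l' x.
Proof. by rewrite /vd mulmxBl !mxE. Qed.

Lemma vdD l l' x : vd (l + l') x = vd l x + vd l' x.
Proof. by rewrite /vd mulmxDl !mxE. Qed.

Lemma vdZ c l x : vd (c *: l) x = c * vd l x.
Proof. by rewrite /vd -scalemxAl !mxE. Qed.

Lemma vd_mvec u x : vd (mvec u) x = (vdeg u x)%:R.
Proof. by rewrite /vd -mvec_wdeg mxE. Qed.

Lemma vd_pv u w x : vd (pv (u, w)) x = (vdeg u x)%:R - (vdeg w x)%:R.
Proof. by rewrite vdB !vd_mvec. Qed.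

(** Double counting. If [s] changes sign along the edges of a subgraph, those edges cancel; the
    parity arguments below choose such an [s]. *)
Lemma sum_vd (s : 'I_n -> rat) l :
  \sum_x s x * vd l x = \sum_e l 0 e * (s (ends e).1 + s (ends e).2).
Proof.
under eq_bigr => x _ do rewrite vdE mulr_sumr.
rewrite exchange_big; apply: eq_bigr => e _.
have pick_sum y : \sum_x s x * (y == x)%:R = s y.
  rewrite (bigD1 y) //= eqxx mulr1 big1 ?addr0 // => x /negPf.
  by rewrite eq_sym => ->; rewrite mulr0.
rewrite mulrDr -!pick_sum !mulr_sumr -big_split; apply: eq_bigr => x _ /=.
by rewrite edge_mnmE natrD; ring.
Qed.

Definition resl (E : {set 'I_m}) l : 'rV[rat]_m := \row_e (if e \in E then l 0 e else 0).

Lemma reslB E l l' : resl E (l - l') = resl E l - resl E l'.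
Proof. by apply/rowP => e; rewrite !mxE; case: ifP; rewrite ?subrr. Qed.

Lemma reslD E l l' : resl E (l + l') = resl E l + resl E l'.
Proof. by apply/rowP => e; rewrite !mxE; case: ifP; rewrite ?addr0. Qed.

Lemma reslZ E c l : resl E (c *: l) = c *: resl E l.
Proof. by apply/rowP => e; rewrite !mxE; case: ifP; rewrite ?mulr0. Qed.

(* The total weight of the edges from [v] to [C]. *)
Definition phi v C l := vd (resl (ein (v |: C)) l) v.

Lemma phiB v C l l' : phi v C (l - l') = phi v C l - phi v C l'.
Proof. by rewrite /phi reslB vdB. Qed.

Lemma phiD v C l l' : phi v C (l + l') = phi v C l + phi v C l'.
Proof. by rewrite /phi reslD vdD. Qed.

Lemma phiZ v C c l : phi v C (c *: l) = c * phi v C l.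
Proof. by rewrite /phi reslZ vdZ. Qed.

Lemma phiE v C l : phi v C l = \sum_(e in ein (v |: C)) l 0 e * (edge_mnm e v)%:R.
Proof.
rewrite /phi vdE [RHS]big_mkcond; apply: eq_bigr => e _; rewrite mxE.
by case: ifP; rewrite ?mul0r.
Qed.

Definition dadj U : rel ('I_n * bool) :=
  fun a b => adj_in ends U setT a.1 b.1 && (a.2 != b.2).

(* An odd closed walk from [v] inside [v |: C], as a path in the double cover. *)
Definition odd_at v C := connect (dadj (v |: C)) (v, false) (v, true).

Lemma joinsC i x y : joins ends i x y = joins ends i y x.
Proof. exact: orbC. Qed.

Lemma adj_inC U E : ssrbool.symmetric (adj_in ends U E).
Proof.
move=> x y; rewrite /adj_in andbCA; congr [&& _, _ & _].
by apply: eq_existsb => i; rewrite joinsC.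
Qed.

Lemma dadjC U : ssrbool.symmetric (dadj U).
Proof. by move=> a b; rewrite /dadj adj_inC eq_sym. Qed.

Lemma dconnC U : connect_sym (dadj U).
Proof. exact/sym_connect_sym/dadjC. Qed.

Lemma adj_inP U x y : reflect (exists2 e, e \in ein U & ends e = (x, y) \/ ends e = (y, x))
  (adj_in ends U setT x y).
Proof.
apply: (iffP and3P) => [[xU yU /existsP[e]]|[e eU def_e]].
  rewrite inE /= => /orP[] /eqP def_e; exists e; rewrite ?inE ?def_e /= ?xU ?yU //; auto.
move: eU; rewrite inE => /andP[].
by case: def_e => def_e; rewrite def_e /= => -> ->; split=> //; apply/existsP; exists e;
  rewrite inE /joins def_e eqxx ?orbT.
Qed.

Lemma dadjS U V : U \subset V -> subrel (dadj U) (dadj V).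
Proof.
move=> sUV a b /andP[/adj_inP[e eU def_e] ab]; rewrite /dadj ab andbT.
by apply/adj_inP; exists e; rewrite ?(subsetP (einS sUV)).
Qed.

Lemma dconnS U V a b : U \subset V -> connect (dadj U) a b -> connect (dadj V) a b.
Proof.
by move=> sUV; apply: connect_sub => c d /(dadjS sUV); apply: connect1.
Qed.

Definition flip (a : 'I_n * bool) := (a.1, ~~ a.2).

Lemma dconn_flip U a b : connect (dadj U) (flip a) (flip b) = connect (dadj U) a b.
Proof.
suff half c d : connect (dadj U) c d -> connect (dadj U) (flip c) (flip d).
  by apply/idP/idP => [/half|/half //]; rewrite /flip /= !negbK -!surjective_pairing.
case/connectP=> p; elim: p c => [|c' p IHp] c /= => [_ ->//|/andP[cc' pathp] def_d].
apply: connect_trans (IHp c' pathp def_d); apply: connect1.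
by move: cc'; rewrite /dadj /=; case: (c.2) (c'.2) => [] [].
Qed.

Lemma dadj_edge U e b : e \in ein U -> dadj U ((ends e).1, b) ((ends e).2, ~~ b).
Proof.
move=> eU; apply/andP; split; last by case: b.
by apply/adj_inP; exists e => //; left; case: (ends e).
Qed.

(** Without an odd closed walk, the difference [s] of reachability with the two parities changes
    sign along every edge of [v |: C] and is 1 at [v]. Pairing it with the restriction of [l] leaves
    only [phi v C l], which must vanish. *)
Lemma phi_odd v C l : v \notin C ->
  (forall e, l 0 e != 0 -> touch C e -> e \in ein (v |: C)) ->
  (forall x, x \in C -> vd l x = 0) -> phi v C l != 0 -> odd_at v C.
Proof.
move=> vC clC l0; apply: contraR => not_odd.
pose reach x b : rat := (connect (dadj (v |: C)) (v, false) (x, b))%:R.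
pose s x := reach x false - reach x true.
have s_edge e : e \in ein (v |: C) -> s (ends e).1 + s (ends e).2 = 0.
  move=> eC; have reachE b : reach (ends e).1 b = reach (ends e).2 (~~ b).
    by rewrite /reach (same_connect_r (@dconnC _) (connect1 (dadj_edge b eC))).
  by rewrite /s !reachE /=; ring.
have : \sum_x s x * vd (resl (ein (v |: C)) l) x = 0.
  rewrite sum_vd big1 // => e _; rewrite mxE.
  by case: ifP => [/s_edge ->|_]; rewrite ?mulr0 ?mul0r.
rewrite (bigD1 v) //= big1 ?addr0 => [|x neq_xv].
  by rewrite /s /reach connect0 -/(odd_at v C) (negPf not_odd) subr0 mul1r => /eqP.
have [xC|xC] := boolP (x \in C).
  suff -> : vd (resl (ein (v |: C)) l) x = vd l x by rewrite l0 ?mulr0.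
  rewrite !vdE; apply: eq_bigr => e _; rewrite mxE.
  case: ifPn => // eC; have [->|le] := eqVneq (l 0 e) 0; first by [].
  rewrite edge_mnmE; case: eqP => [e1|_]; first by rewrite clC // /touch e1 xC in eC.
  by case: eqP => [e2|_]; [rewrite clC // /touch e2 xC orbT in eC | rewrite !mulr0].
rewrite vdE big1 ?mulr0 // => e _; rewrite mxE; case: ifP; rewrite ?mul0r // !inE edge_mnmE.
have [-> |_] := eqVneq (ends e).1 x; first by rewrite (negPf neq_xv) (negPf xC).
by have [-> |_] := eqVneq (ends e).2 x; [rewrite (negPf neq_xv) (negPf xC) andbF | rewrite mulr0].
Qed.

(** The edges of the walk go alternately into the two monomials, so inner degrees cancel; a closed
    odd walk keeps 2 at its base point. *)
Lemma walk_vector U x y b c : connect (dadj U) (x, b) (y, c) ->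
  exists2 q : 'X_{1..m} * 'X_{1..m}, (forall e, e \notin ein U -> q.1 e = 0%N /\ q.2 e = 0%N)
   & forall z, vd (pv q) z = (x == z)%:R - (-1) ^+ (b (+) c) * (y == z)%:R.
Proof.
case/connectP=> p; elim: p x b => [|[x' b'] p IHp] x b /=.
  move=> _ [-> ->]; exists (0%MM, 0%MM) => [e _|z]; first by rewrite !mnm0E.
  by rewrite addbb expr0 mul1r subrr vdB subrr.
case/andP=> /andP[/adj_inP[e eU /= def_e] /= neq_b] pathp lastp.
have [[u w] uwU uwE] := IHp x' b' pathp lastp.
(* Prepending an edge exchanges the two monomials. *)
exists ((w + U_(e))%MM, u) => [e' e'U|z] /=.
  have [/= u0 w0] := uwU e' e'U; rewrite mnmDE mnm1E u0 w0.
  by case: eqP => // eq_e; rewrite -eq_e eU in e'U.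
have := uwE z; rewrite !vd_pv wdegD wdegU mnmDE natrD => uwz.
have -> : b = ~~ b' by move: neq_b; clear; case: b b' => [] [].
rewrite addNb signrN mulNr opprK.
have -> : (edge_mnm e z)%:R = (x == z)%:R + (x' == z)%:R :> rat.
  by rewrite edge_mnmE natrD; case: def_e => -> //=; rewrite addrC.
by move: uwz; set A := (_ * _); lra.
Qed.

End GraphVectors.

Lemma class_sum_eq0 (R : pzRingType) (I T : finType) (A : {set I}) (k : I -> T) (l F : I -> R) :
  (forall t, \sum_(e in A | k e == t) l e = 0) ->
  (forall e e', e \in A -> e' \in A -> k e = k e' -> F e = F e') ->
  \sum_(e in A) l e * F e = 0.
Proof.
move=> l0 Fk; rewrite (partition_big k xpredT) //= big1 // => t _.
have [/existsP[e0 /andP[e0A /eqP k0]]|] := boolP [exists e0 in A, k e0 == t].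
  rewrite (eq_bigr (fun e => l e * F e0)); first by rewrite -mulr_suml l0 mul0r.
  by move=> e /andP[eA /eqP ke]; rewrite (Fk e e0) // ke k0.
rewrite negb_exists => /forallP noe; rewrite big1 // => e /andP[eA ke].
by have := noe e; rewrite eA ke.
Qed.

(** * Monomials supported in a vertex set, and the pieces around a vertex *)

Section GeneratorSupports.
Variables (K : fieldType) (n m : nat) (ends : 'I_m -> 'I_n * 'I_n).
Hypothesis loopless : forall i, (ends i).1 != (ends i).2.
Variable S : seq ('X_{1..m} * 'X_{1..m}).
Local Notation vdeg := (wdeg (edge_mnm ends)).
Local Notation ein := (ein ends).
Local Notation phi := (phi ends).
Local Notation vd := (vd ends).
Local Notation touch := (touch ends).
Local Notation odd_at := (odd_at ends).
Hypothesis gS : generates (map (@bin K m) S) (mono_ideal (edge_mnm ends)).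
Implicit Types (U V W C : {set 'I_n}) (l : 'rV[rat]_m) (u w : 'X_{1..m}) (e : 'I_m)
  (v x : 'I_n) (q : 'X_{1..m} * 'X_{1..m}).

(** Phrased by vertex degrees, so that it visibly depends only on the multidegree; [insuppP] gives
    the form with edges. *)
Definition insupp W u := [forall x, (x \notin W) ==> (vdeg u x == 0%N)].

Lemma leq_vdeg u e : (u e <= vdeg u (ends e).1)%N /\ (u e <= vdeg u (ends e).2)%N.
Proof.
by rewrite !wdegE !(bigD1 e (P := xpredT)) //= !edge_mnmE !eqxx ?addn1 ?add1n; split;
  rewrite mulSn -addnA leq_addr.
Qed.

Lemma insuppP W u : reflect (forall e, u e != 0%N -> e \in ein W) (insupp W u).
Proof.
apply: (iffP forallP) => [Wu e|uW x].
  rewrite -lt0n inE => ue; have [le1 le2] := leq_vdeg u e.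
  by apply/andP; split; apply: contraTT ue => /(implyP (Wu _))/eqP vu0; rewrite -leqNgt;
    [move: le1 | move: le2]; rewrite vu0.
apply/implyP => xW; rewrite wdegE big1 // => e _; rewrite edge_mnmE.
have [->|/uW] := eqVneq (u e) 0%N; first by rewrite muln0.
rewrite inE => /andP[e1 e2].
have [def_x|_] := eqVneq (ends e).1 x; first by rewrite -def_x e1 in xW.
by have [def_x|_] := eqVneq (ends e).2 x; first by rewrite -def_x e2 in xW.
Qed.

Lemma S_wdeg q : q \in S -> vdeg q.1 = vdeg q.2.
Proof. exact: generates_wdeg gS. Qed.

Lemma vd_S q x : q \in S -> vd (pv q) x = 0.
Proof. by case: q => u w /S_wdeg /= eq_uw; rewrite vd_pv eq_uw subrr. Qed.

Lemma insupp_wdeg W u w : vdeg u = vdeg w -> insupp W u = insupp W w.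
Proof. by move=> eq_uw; rewrite /insupp eq_uw. Qed.

Lemma insuppD W u w : insupp W (u + w)%MM -> insupp W w.
Proof.
move/insuppP => uwW; apply/insuppP => e we; apply: uwW; rewrite mnmDE.
by rewrite addn_eq0 negb_and we orbT.
Qed.

Lemma insuppS W W' u : W \subset W' -> insupp W u -> insupp W' u.
Proof.
move=> sWW' /insuppP uW; apply/insuppP => e /uW; exact: (subsetP (einS _ sWW')).
Qed.

Lemma pv_ein W q e : vdeg q.1 = vdeg q.2 -> insupp W q.1 -> pv q 0 e != 0 -> e \in ein W.
Proof.
move=> eq_q Wq; have Wq2 : insupp W q.2 by rewrite -(insupp_wdeg _ eq_q).
rewrite !mxE; apply: contraR => eW.
have /eqP -> : q.1 e == 0%N by apply: contraR eW; apply/insuppP.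
by have /eqP -> : q.2 e == 0%N by [apply: contraR eW; apply/insuppP]; rewrite subrr.
Qed.

Lemma ein_loop v C e : v \notin C -> e \in ein (v |: C) -> touch C e.
Proof.
move=> vC; rewrite !inE /touch; case/andP=> /predU1P[def1|->//] /predU1P[def2|->]; last by rewrite orbT.
by have := loopless e; rewrite def1 def2 eqxx.
Qed.

(* Two odd closed walks through [v] on different sides of [v] give a relation;
   some generator must account for it. *)
Lemma separated_generator v C1 C2 : v \notin C1 -> v \notin C2 ->
  (forall e, touch C1 e -> touch C2 e -> False) -> odd_at v C1 -> odd_at v C2 ->
  exists2 q, q \in S & insupp (v |: (C1 :|: C2)) q.1 /\ phi v C1 (pv q) != 0.
Proof.
move=> vC1 vC2 sep /walk_vector[[p1 q1] supp1 vd1] /walk_vector[[p2 q2] supp2 vd2].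
set W := v |: (C1 :|: C2).
have sW1 : v |: C1 \subset W by rewrite setUS ?subsetUl.
have sW2 : v |: C2 \subset W by rewrite setUS ?subsetUr.
have eq_vd : vdeg (p1 + q2)%MM = vdeg (q1 + p2)%MM.
  apply/mvec_inj/eqP; rewrite -subr_eq0; apply/eqP/rowP => z.
  have := vd1 z; have := vd2 z; rewrite !vd_pv !wdegD !mxE !mnmDE !natrD.
  lra.
(* The weight of the edges between [v] and [C1]: it differs by 2 between [p1] and [q1], and the
   second walk contributes nothing. *)
pose t u := \sum_(e in ein (v |: C1)) (u e)%:R * (edge_mnm ends e v)%:R : rat.
have tE u w : t u - t w = phi v C1 (pv (u, w)).
  by rewrite phiE -sumrB; apply: eq_bigr => e _; rewrite !mxE mulrBl.
have tD u w : t (u + w)%MM = t u + t w.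
  by rewrite -big_split; apply: eq_bigr => e _; rewrite mnmDE natrD mulrDl.
have [/hasP[q qS /andP[]]|noq] := boolP (has (fun q => insupp W q.1 && (phi v C1 (pv q) != 0)) S).
  by exists q.
(* If no generator inside [W] changes [t], then [t] is an invariant of the monomials supported in
   [W]. *)
pose tau u := if insupp W u then Some (t u) else None.
have [idI _ _] := @mono_ideal_prime K m n (edge_mnm ends).
have [_ IS] := (generatesP _ idI).1 gS.
have tau_eq : tau (p1 + q2)%MM = tau (q1 + p2)%MM.
  apply: (@bin_ideal_invariant K m _ tau S); last exact/IS/mono_ideal_bin.
  move=> q qS w; rewrite /tau (insupp_wdeg _ (_ : _ = vdeg (w + q.2)%MM)); last first.
    by rewrite !wdegD S_wdeg.
  case: ifP => // /insuppD Wq; rewrite !tD; congr (Some (_ + _)); apply/eqP.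
  rewrite -subr_eq0 tE; have := hasPn noq q qS.
  by rewrite (insupp_wdeg _ (S_wdeg qS)) Wq /= negbK; case: (q).
move: tau_eq; rewrite /tau -(insupp_wdeg _ eq_vd).
have -> : insupp W (p1 + q2)%MM.
  apply/insuppP => e; rewrite mnmDE addn_eq0 negb_and => /orP[]; apply: contraR => eW.
    by have [|->] // := supp1 e; apply: contra eW; apply: (subsetP (einS _ sW1)).
  by have [|_ ->] // := supp2 e; apply: contra eW; apply: (subsetP (einS _ sW2)).
case=> t_eq.
have t2 : t p2 = 0 /\ t q2 = 0.
  have zero2 e : e \in ein (v |: C1) -> p2 e = 0%N /\ q2 e = 0%N.
    move=> e1; apply: supp2; apply/negP => e2.
    by apply: (sep e); apply: ein_loop; eassumption.
  by split; apply: big1 => e /zero2[p0 q0]; rewrite ?p0 ?q0 mul0r.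
have t1 : t p1 - t q1 = 2.
  rewrite tE; transitivity (vd (pv (p1, q1)) v); last first.
    by rewrite vd1 eqxx /= expr1 mulN1r opprK -natrD.
  rewrite phiE vdE big_mkcond; apply: eq_bigr => e _; case: ifPn => // /supp1[p0 q0].
  by rewrite !mxE p0 q0 subrr mul0r.
move: t_eq; rewrite !tD t2.1 t2.2 !addr0 => t_eq.
by move: t1; rewrite t_eq subrr => /eqP; rewrite eq_sym pnatr_eq0.
Qed.

(** Handshake argument: the degrees over [C] add up to the number [N] of edges from [v] to [C] plus
    twice the number of edges inside [C]. So [N u] and [N w] have the same parity, and both are at
    most 1. *)
Lemma phi_parity v C u w : v \notin C -> vdeg u = vdeg w ->
  (forall e, u e != 0%N \/ w e != 0%N -> touch C e -> e \in ein (v |: C)) ->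
  (vdeg u v <= 1)%N -> phi v C (pv (u, w)) = 0.
Proof.
move=> vC eq_uw clC le1.
pose N y := (\sum_(e in ein (v |: C)) y e * edge_mnm ends e v)%N.
have phiN : phi v C (pv (u, w)) = (N u)%:R - (N w)%:R.
  rewrite phiE !natr_sum -sumrB; apply: eq_bigr => e _; rewrite !mxE !natrM.
  by rewrite mulrBl.
have leN y : vdeg y = vdeg u -> (N y <= 1)%N.
  move=> eq_y; apply: leq_trans le1; rewrite -eq_y wdegE (bigID (mem (ein (v |: C)))) /=.
  by apply: leq_trans (leq_addr _ _); apply: leq_sum => e _; rewrite mulnC.
have parN (y : 'X_{1..m}) : (forall e, y e != 0%N -> touch C e -> e \in ein (v |: C)) ->
    exists k, (\sum_(x in C) vdeg y x = N y + k.*2)%N.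
  move=> clCy; exists (\sum_(e in ein C) y e)%N.
  under eq_bigr => x _ do rewrite wdegE.
  rewrite exchange_big /= /N -mul2n big_distrr /= [in RHS]big_mkcond.
  rewrite [X in (_ + X)%N]big_mkcond -big_split; apply: eq_bigr => e _ /=.
  rewrite -big_distrl /=; have [->|ye] := eqVneq (y e) 0%N.
    by rewrite muln0 !mul0n !if_same.
  have sumE : (\sum_(x in C) edge_mnm ends e x = ((ends e).1 \in C) + ((ends e).2 \in C))%N.
    have pick_sum a : (\sum_(x in C) (a == x) = (a \in C))%N.
      rewrite big_mkcond (bigD1 a) //= eqxx big1 => [|x /negPf]; first by rewrite addn0; case: (a \in C).
      by rewrite eq_sym => ->; rewrite if_same.
    by under eq_bigr => x _ do rewrite edge_mnmE; rewrite big_split /= !pick_sum.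
  rewrite sumE; have [te|nte] := boolP (touch C e); last first.
    have /negPf -> : e \notin ein (v |: C) by apply: contra nte; apply: ein_loop.
    by move: nte; rewrite /touch negb_or inE => /andP[/negPf -> /negPf ->].
  have eC := clCy e ye te; rewrite eC; move: eC te; rewrite /touch !inE edge_mnmE.
  have neqv x : x \in C -> (x == v) = false by apply: contraTF => /eqP ->.
  case: (boolP ((ends e).1 \in C)) => [e1|_]; case: (boolP ((ends e).2 \in C)) => [e2|_] //=.
  - by move=> _ _; rewrite !neqv // addn0 muln0.
  - by rewrite orbF => /andP[_ ->] _; rewrite (neqv _ e1); lia.
  - by rewrite !orbF orbT andbT => -> _; rewrite (neqv _ e2); lia.
have [k1 k1E] := parN u (fun e ue => clC e (or_introl ue)).
have [k2 k2E] := parN w (fun e ue => clC e (or_intror ue)).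
rewrite phiN; suff -> : N u = N w by rewrite subrr.
have := leN u erefl; have := leN w (esym eq_uw).
by move: k1E k2E; rewrite eq_uw => ->; move: (N u) (N w); lia.
Qed.

Definition comp W v y : {set 'I_n} := [set z | connect (adj_in ends (W :\ v) setT) y z].

Definition star W v : {set 'I_m} := [set e in ein W | ((ends e).1 == v) || ((ends e).2 == v)].

Definition other v e := if (ends e).1 == v then (ends e).2 else (ends e).1.

Lemma adj_in_sym U : connect_sym (adj_in ends U setT).
Proof. exact/sym_connect_sym/adj_inC. Qed.

Lemma star_other W v e : e \in star W v -> other v e \in W :\ v /\
  forall z, edge_mnm ends e z = ((v == z) + (other v e == z))%N.
Proof.
rewrite /other !inE => /andP[/andP[e1 e2]]; have := loopless e.
have [def1 neq12 _|neq1 _ /eqP def2] := eqVneq (ends e).1 v.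
  by split=> [|z]; [rewrite -def1 eq_sym neq12 e2 | rewrite edge_mnmE def1].
by split=> [|z]; [rewrite neq1 e1 | rewrite edge_mnmE def2 addnC].
Qed.

Lemma ein_star W v e : e \in ein W -> e \notin star W v -> e \in ein (W :\ v).
Proof.
by move=> eW; rewrite inE eW /= negb_or !inE => /andP[-> ->] /=; move: eW; rewrite inE.
Qed.

(** A union of components of [W] without [v]: edges of [W] leave [C] only towards [v]. *)
Definition lobe W v C :=
  C \subset W :\ v /\ forall e, e \in ein W -> touch C e -> e \in ein (v |: C).

Lemma star_phi W v C l : v \in W -> C \subset W :\ v -> (forall e, l 0 e != 0 -> e \in ein W) ->
  phi v C l = \sum_(e in star W v | other v e \in C) l 0 e.
Proof.
move=> vW sCW lW; rewrite phiE big_mkcond [RHS]big_mkcond; apply: eq_bigr => e _.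
have [-> | /lW eW] := eqVneq (l 0 e) 0; first by rewrite mul0r !if_same.
have [eSt|eSt] := boolP (e \in star W v); last first.
  rewrite /= ; case: ifP => // _; rewrite edge_mnmE; move: eSt; rewrite inE eW /= negb_or.
  by case/andP=> /negPf -> /negPf ->; rewrite mulr0.
have [oW oE] := star_other eSt; rewrite /= oE eqxx.
have -> : (other v e == v) = false by move: oW; rewrite !inE => /andP[/negPf].
rewrite addn0 mulr1; congr (if _ then _ else _).
rewrite [e \in ein _]inE /other; move: eSt; rewrite inE eW /=.
have [def1 _|neq1 /= /eqP ->] := eqVneq (ends e).1 v.
  by have := loopless e; rewrite def1 setU11 in_setU1 eq_sym => /negPf ->.
by rewrite setU11 andbT in_setU1 (negPf neq1).
Qed.

Lemma comp_sub W v y : y \in W :\ v -> comp W v y \subset W :\ v.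
Proof.
move=> yW; apply/subsetP => z; rewrite inE => /connectP[p].
elim: p y yW => [|y' p IHp] y yW /=; first by move=> _ ->.
by case/andP=> /and3P[_ y'W _]; apply: IHp.
Qed.

Lemma adj_ein U e : e \in ein U -> adj_in ends U setT (ends e).1 (ends e).2.
Proof. by move=> eU; apply/adj_inP; exists e => //; left; case: (ends e). Qed.

Lemma comp_lobe W v y : y \in W :\ v -> lobe W v (comp W v y).
Proof.
move=> yW; split=> [|e eW te]; first exact: comp_sub.
have sub z : z \in comp W v y -> z \in v |: comp W v y by move=> zC; rewrite in_setU1 zC orbT.
have [eSt|eSt] := boolP (e \in star W v).
  rewrite inE; move: eSt; rewrite inE eW /= => /orP[] /eqP def_v; move: te; rewrite /touch.
    rewrite def_v setU11 => /orP[vC|/sub //].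
    by have := subsetP (comp_sub yW) _ vC; rewrite !inE eqxx.
  rewrite def_v setU11 andbT => /orP[/sub //|vC].
  by have := subsetP (comp_sub yW) _ vC; rewrite !inE eqxx.
have /adj_ein/connect1 c12 := ein_star eW eSt.
by rewrite inE; case/orP: te => eC; rewrite (sub _ eC) /= ?andbT; apply: sub;
  move: eC; rewrite !inE => eC; apply: connect_trans eC _; rewrite // adj_in_sym.
Qed.

Lemma lobe_compl W v C : v \in W -> lobe W v C -> lobe W v (W :\ v :\: C).
Proof.
move=> vW [sCW clC]; split=> [|e eW te]; first exact: subsetDl.
have vC : v \notin C by apply/negP => /(subsetP sCW); rewrite !inE eqxx.
have [tC|ntC] := boolP (touch C e).
  have nin x : x \in v |: C -> (x \in W :\ v :\: C) = false.
    by rewrite !inE; case: (x == v); rewrite ?andbF //= => ->.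
  have := clC e eW tC; rewrite [e \in _]inE => /andP[/nin n1 /nin n2].
  by move: te; rewrite /touch n1 n2.
move: ntC eW; rewrite /touch negb_or !inE => /andP[-> ->] /andP[-> ->].
by rewrite !andbT /=; do 2 case: (_ == v).
Qed.

Lemma lobe_phi_compl W v C l : v \in W -> lobe W v C -> (forall e, l 0 e != 0 -> e \in ein W) ->
  phi v (W :\ v :\: C) l = vd l v - phi v C l.
Proof.
move=> vW [sCW _] lW; rewrite !(star_phi (W := W)) ?subsetDl //.
have -> : vd l v = \sum_(e in star W v) l 0 e.
  rewrite vdE [RHS]big_mkcond; apply: eq_bigr => e _.
  have [-> | /lW eW] := eqVneq (l 0 e) 0; first by rewrite mul0r if_same.
  case: ifPn => [/star_other[oW ->]|].
    by rewrite eqxx (_ : _ == v = false) ?mulr1 //; move: oW; rewrite !inE => /andP[/negPf].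
  by rewrite inE eW /= negb_or edge_mnmE => /andP[/negPf -> /negPf ->]; rewrite mulr0.
rewrite [X in X - _](bigID (fun e => other v e \in C)) /= addrAC subrr add0r.
apply: eq_bigl => e; have [/star_other[oW _]|//] := boolP (e \in star W v).
by rewrite inE oW andbT.
Qed.

(** On a lobe, [phi] is the sum of its values on the components that make up the lobe. *)
Lemma phi_comp_neq0 W v D l : v \in W -> lobe W v D -> (forall e, l 0 e != 0 -> e \in ein W) ->
  phi v D l != 0 -> exists2 y, y \in D & phi v (comp W v y) l != 0.
Proof.
move=> vW [sDW clD] lW phiD0; have [/existsP[y /andP[]]|noy] :=
  boolP [exists y in D, phi v (comp W v y) l != 0]; first by exists y.
case/eqP: phiD0; rewrite (star_phi (W := W)) //.
pose k e := fingraph.root (adj_in ends (W :\ v) setT) (other v e).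
have kE e e' : (k e == k e') = connect (adj_in ends (W :\ v) setT) (other v e) (other v e').
  by apply: root_connect; apply: adj_in_sym.
have -> : \sum_(e in star W v | other v e \in D) l 0 e =
    \sum_(e in [set e in star W v | other v e \in D]) l 0 e * 1.
  by apply: eq_big => [e|e _]; rewrite ?mulr1 // [in RHS]inE.
apply: (class_sum_eq0 (k := k)) => // t.
have [/existsP[e0 /andP[e0A /eqP <-]]|] :=
  boolP [exists e0 in [set e in star W v | other v e \in D], k e0 == t]; last first.
  by rewrite negb_exists => /forallP noe; rewrite big1 // => e /andP[eSt ke]; have := noe e; rewrite eSt ke.
move: e0A; rewrite inE => /andP[e0St oD]; move: noy; rewrite negb_exists => /forallP/(_ (other v e0)).
rewrite oD negbK (star_phi (W := W)) ?comp_sub ?(subsetP sDW) // => /eqP phi00.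
rewrite -[RHS]phi00; apply: eq_bigl => e; rewrite [e \in [set _ in _ | _]]inE -andbA.
congr (_ && _); rewrite kE [in RHS]inE adj_in_sym andb_idl //.
move: (other v e) => z /connectP[p]; elim: p (other v e0) oD => [|y p IHp] x xD /=; first by move=> _ ->.
case/andP=> /adj_inP[f fU def_f] pathp; apply: IHp => //.
have fW : f \in ein W by apply: (subsetP (einS _ _)) fU; apply: subD1set.
have tf : touch D f by rewrite /touch; case: def_f => -> /=; rewrite xD ?orbT.
have := clD f fW tf; move: fU; rewrite !inE.
by case: def_f => -> /= /andP[/andP[/negPf -> _] /andP[/negPf -> _]] /andP[].
Qed.

Lemma adj_dconn U y z b :
  connect (adj_in ends U setT) y z -> exists c, connect (dadj ends U) (y, b) (z, c).
Proof.
case/connectP=> p; elim: p y b => [|y' p IHp] y b /=; first by move=> _ ->; exists b.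
case/andP=> yy' pathp lastp; have [c conn_c] := IHp y' (~~ b) pathp lastp; exists c.
by apply: connect_trans (connect1 _) conn_c; rewrite /dadj yy' /=; case: b.
Qed.

Lemma dconn_adj U a b :
  connect (dadj ends U) a b -> connect (adj_in ends U setT) a.1 b.1.
Proof.
case/connectP=> p; elim: p a => [|a' p IHp] a /=; first by move=> _ ->.
case/andP=> /andP[/connect1 aa' _] pathp lastp.
exact: connect_trans aa' (IHp a' pathp lastp).
Qed.

(** A functional [X] vanishing on these generators vanishes on all binomial relations in [W] of
    degree at most one at [v]. Edges at [v] are classed by the component of the other end and its
    parity relative to a root. Two edges of one class, closed up by walks to the root, form such a
    relation, so [X] treats them alike; [l] sums to zero over each class, and what remains of [l]
    avoids [v]. *)
Lemma span_deg1 W v l : v \in W ->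
  (forall e, l 0 e != 0 -> e \in ein W) -> (forall x, vd l x = 0) ->
  (forall y, y \in W :\ v -> phi v (comp W v y) l = 0) ->
  in_span [seq q <- S | insupp W q.1 && (vdeg q.1 v <= 1)%N] l.
Proof.
move=> vW lW l0 phi0 X X0.
have goodX u w : vdeg u = vdeg w -> insupp W u -> (vdeg u v <= 1)%N -> pv (u, w) *m X = 0.
  move=> eq_uw Wu le1; pose good y := insupp W y && (vdeg y v <= 1)%N.
  apply: (@generates_span K m n (edge_mnm ends) S good u w gS) X0 => //; last by rewrite /good Wu.
    by move=> u' w' eq_uw'; rewrite /good (insupp_wdeg _ eq_uw') eq_uw'.
  move=> u' w' /andP[/insuppD Ww]; rewrite wdegD mnmDE /good Ww => /(leq_trans _); apply.
  exact: leq_addl.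
set U := W :\ v; set St := star W v.
pose r y := fingraph.root (adj_in ends U setT) y.
pose dc := connect (dadj ends U).
(* An even walk to the root is preferred, so in a component with an odd closed walk [s] is false
   everywhere. *)
pose s y := ~~ dc (y, false) (r y, false).
have dc_root y : dc (y, false) (r y, s y).
  rewrite /s; case def_dc: (dc (y, false) (r y, false)) => //=.
  have [|c] := @adj_dconn U y (r y) false; first exact: connect_root.
  by case: c => // dcy; rewrite /dc dcy in def_dc.
have /fin_all_exists[tq tqP] (e : 'I_m) : exists q : 'X_{1..m} * 'X_{1..m},
    (forall e', e' \notin ein U -> q.1 e' = 0%N /\ q.2 e' = 0%N) /\
    forall z, vd (pv q) z = (other v e == z)%:R - (-1) ^+ s (other v e) * (r (other v e) == z)%:R.
  by have [q q0 qE] := walk_vector (dc_root (other v e)); exists q.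
pose k e := (r (other v e), s (other v e)).
pose lam (l' : 'rV[rat]_m) := (l' *m X) 0 0.
have lamD l1 l2 : lam (l1 + l2) = lam l1 + lam l2 by rewrite /lam mulmxDl mxE.
have lamB l1 l2 : lam (l1 - l2) = lam l1 - lam l2 by rewrite /lam mulmxBl !mxE.
have lamZ c l1 : lam (c *: l1) = c * lam l1 by rewrite /lam -scalemxAl mxE.
have lam_sum (F : 'I_m -> 'rV[rat]_m) : lam (\sum_(e in St) F e) = \sum_(e in St) lam (F e).
  by rewrite /lam mulmx_suml summxE.
pose F e := lam (mvec U_(e)%MM - pv (tq e)).
have tqU e e' : (ends e').1 = v \/ (ends e').2 = v -> (tq e).1 e' = 0%N /\ (tq e).2 e' = 0%N.
  move=> ev; apply: (tqP e).1; rewrite !inE.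
  by case: ev => ->; rewrite eqxx ?andbF.
have vdeg_tq e : vdeg (tq e).1 v = 0%N /\ vdeg (tq e).2 v = 0%N.
  split; rewrite wdegE big1 // => e' _; rewrite edge_mnmE.
    case: eqP => [/or_introl/(tqU e)[-> _]|_]; first by rewrite muln0.
    by case: eqP => [/or_intror/(tqU e)[-> _]|_]; first by rewrite muln0.
  case: eqP => [/or_introl/(tqU e)[_ ->]|_]; first by rewrite muln0.
  by case: eqP => [/or_intror/(tqU e)[_ ->]|_]; first by rewrite muln0.
have Fk e e' : e \in St -> e' \in St -> k e = k e' -> F e = F e'.
  move=> eSt e'St [eq_r eq_s]; apply/eqP; rewrite -subr_eq0 -lamB.
  pose u := (U_(e) + (tq e').1 + (tq e).2)%MM; pose w := (U_(e') + (tq e').2 + (tq e).1)%MM.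
  have -> : mvec U_(e)%MM - pv (tq e) - (mvec U_(e')%MM - pv (tq e')) = pv (u, w).
    by apply/rowP => j; rewrite !mxE !mnmDE !natrD; ring.
  have [_ eE] := star_other eSt; have [_ e'E] := star_other e'St.
  rewrite /lam goodX ?mxE //.
  - apply/mvec_inj/rowP => z; have := (tqP e).2 z; have := (tqP e').2 z.
    rewrite eq_r eq_s; case: (tq e) (tq e') @u @w => [p1 p2] [q1 q2] u w.
    rewrite !vd_pv /= !mxE /u /w !wdegD !mnmDE !wdegU eE e'E !natrD.
    by set Q := (-1) ^+ _ * _; lra.
  - apply/insuppP => f; rewrite !mnmDE mnm1E; have [<-|neq_ef] := eqVneq e f.
      by move: eSt; rewrite inE => /andP[].
    apply: contraR => fW; have fU : f \notin ein U.
      by apply: contra fW; apply: (subsetP (einS _ _)); apply: subD1set.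
    by have [-> _] := (tqP e').1 f fU; have [_ ->] := (tqP e).1 f fU.
  - rewrite !wdegD !mnmDE !wdegU eE eqxx (vdeg_tq e').1 (vdeg_tq e).2 addn0.
    by have [] := star_other eSt; rewrite !inE => /andP[/negPf ->].
(* In a component without odd closed walks the degrees force the two class sums to agree, while
   [phi0] makes their total zero; in any other component the class with parity [true] is empty. *)
have mk0 t : \sum_(e in St | k e == t) l 0 e = 0.
  have [/existsP[e0 /andP[e0St /eqP <-]]|] := boolP [exists e0 in St, k e0 == t]; last first.
    by rewrite negb_exists => /forallP noe; rewrite big1 // => e /andP[eSt ke]; have := noe e; rewrite eSt ke.
  have [y0U _] := star_other e0St; set y0 := other v e0 in y0U; set r0 := r y0.
  pose M b := \sum_(e in St | k e == (r0, b)) l 0 e.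
  have rE z : (r z == r0) = connect (adj_in ends U setT) z y0.
    by rewrite /r0 /r root_connect //; apply: adj_in_sym.
  have M_split (f : 'I_m -> rat) : \sum_(e in St | r (other v e) == r0) l 0 e * f e =
      \sum_(e in St | k e == (r0, false)) l 0 e * f e + \sum_(e in St | k e == (r0, true)) l 0 e * f e.
    rewrite (bigID (fun e => s (other v e))) addrC /=; congr (_ + _);
      apply: eq_bigl => e; rewrite /k xpair_eqE -!andbA; congr [&& _, _ & _];
      by case: (s _).
  have M_sum : M false + M true = 0.
    have := phi0 y0 y0U; rewrite (star_phi (W := W)) ?comp_sub // => phi00.
    have sum1 (P : pred 'I_m) : \sum_(e in St | P e) l 0 e * 1 = \sum_(e in St | P e) l 0 e.
      by apply: eq_bigr => e _; rewrite mulr1.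
    have := M_split (fun=> 1); rewrite !sum1.
    rewrite -/(M false) -/(M true) => <-; rewrite -[RHS]phi00; apply: eq_bigl => e.
    by rewrite rE [other v e \in _]inE adj_in_sym.
  pose sg x : rat := (dc (x, false) (r0, false))%:R - (dc (x, false) (r0, true))%:R.
  have sg_edge e : e \in ein U -> sg (ends e).1 + sg (ends e).2 = 0.
    move=> eU; have dcE b : dc ((ends e).1, false) (r0, b) = dc ((ends e).2, false) (r0, ~~ b).
      rewrite /dc (same_connect (@dconnC _ _ _ _) (connect1 (dadj_edge false eU))).
      by rewrite -dconn_flip /flip /=.
    by rewrite /sg !dcE /=; ring.
  have sgv : sg v = 0.
    have dcv b : dc (v, false) (r0, b) = false.
      apply/negP => /dconn_adj /= /connectP[[|y p] /=].
        by move=> _ def_r; have := connect_root (adj_in ends U setT) y0; rewrite -/(r y0) -/r0 def_r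
          adj_in_sym => /connectP[[|y p] /=]; [move=> _ def_y; move: y0U;
          rewrite def_y /U !inE eqxx | rewrite /adj_in /U !inE eqxx].
      by rewrite /adj_in /U !inE eqxx.
    by rewrite /sg !dcv subrr.
  have : \sum_x sg x * vd l x = 0 by rewrite big1 // => x _; rewrite l0 mulr0.
  rewrite sum_vd (bigID (mem St)) /= addrC big1 ?add0r => [|e eSt]; last first.
    have [->|/lW eW] := eqVneq (l 0 e) 0; first by rewrite mul0r.
    by rewrite sg_edge ?mulr0 //; apply: ein_star.
  rewrite (eq_bigr (fun e => l 0 e * sg (other v e))) => [|e eSt]; last first.
    congr (_ * _); rewrite /other; move: eSt; rewrite inE => /andP[_].
    by have [-> _|_ /= /eqP ->] := eqVneq (ends e).1 v; rewrite sgv ?add0r ?addr0.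
  rewrite (bigID (fun e => r (other v e) == r0)) /= addrC big1 ?add0r => [|e /andP[eSt ne]]; last first.
    have dcF b : dc (other v e, false) (r0, b) = false.
      apply: contraNF ne => /dconn_adj /= conn_r; rewrite rE.
      by apply: connect_trans conn_r _; rewrite adj_in_sym connect_root.
    by rewrite /sg !dcF subrr mulr0.
  have [odd_r|even_r] := boolP (dc (r0, false) (r0, true)).
    have Mt : M true = 0.
      rewrite /M big1 // => e /andP[eSt]; rewrite xpair_eqE => /andP[/eqP re].
      rewrite /s re; have := dc_root (other v e); rewrite re.
      case: (s _) => dcr; last by rewrite dcr.
      suff -> : dc (other v e, false) (r0, false) by [].
      by apply: connect_trans dcr _; rewrite dconnC.
    move=> _; rewrite -/(M (s y0)); case: (s y0) => //.
    by move: M_sum; rewrite Mt addr0.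
  rewrite M_split => M_diff.
  have Mf : \sum_(e in St | k e == (r0, false)) l 0 e * sg (other v e) = M false.
    apply: eq_bigr => e /andP[eSt]; rewrite xpair_eqE => /andP[/eqP re /eqP se]; rewrite /sg.
    have := dc_root (other v e); rewrite re se => dcr; rewrite dcr.
    suff -> : dc (other v e, false) (r0, true) = false by rewrite subr0 mulr1.
    by apply: contraNF even_r; apply: connect_trans; rewrite dconnC.
  have Mt : \sum_(e in St | k e == (r0, true)) l 0 e * sg (other v e) = - M true.
    rewrite -sumrN; apply: eq_bigr => e /andP[eSt]; rewrite xpair_eqE => /andP[/eqP re /eqP se]; rewrite /sg.
    have := dc_root (other v e); rewrite re se => dcr; rewrite dcr.
    suff -> : dc (other v e, false) (r0, false) = false by rewrite sub0r mulrN1.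
    by apply: contraNF even_r => dcf; apply: connect_trans dcr; rewrite dconnC.
  rewrite Mf Mt in M_diff; rewrite -/(M (s y0)); case: (s y0); lra.
have lam1 : \sum_(e in St) l 0 e * F e = 0 by apply: class_sum_eq0 mk0 Fk.
(* Every edge at [v] is traded for the walk from its other end to the root; the terms at the roots
   cancel class by class. *)
pose l' := l - \sum_(e in St) l 0 e *: (mvec U_(e)%MM - pv (tq e)).
have l'U e : e \notin ein U -> l' 0 e = 0.
  move=> eU; rewrite !mxE summxE (eq_bigr (fun f => (f == e)%:R * l 0 e)) => [|f fSt].
    have [eSt|eSt] := boolP (e \in St).
      rewrite (bigD1 e) //= eqxx mul1r big1 ?addr0 ?subrr // => f /andP[_ /negPf ->].
      by rewrite mul0r.
    have -> : l 0 e = 0.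
      by apply/eqP; apply: contraR eU => /lW eW; apply: ein_star.
    by rewrite big1 ?subrr // => f _; rewrite mulr0.
  rewrite !mxE mnm1E; have [-> ->] := (tqP f).1 e eU.
  by rewrite subrr subr0; case: eqP => [->|]; rewrite ?mulr1 ?mul1r ?mulr0 ?mul0r.
have vd_l' z : vd l' z = 0.
  have [->|neq_zv] := eqVneq z v.
    rewrite vdE big1 // => e _; have [eU|/l'U->] := boolP (e \in ein U); last by rewrite mul0r.
    by move: eU; rewrite !inE edge_mnmE => /andP[/andP[/negPf -> _] /andP[/negPf -> _]]; rewrite mulr0.
  rewrite vdB l0 sub0r; apply/eqP; rewrite oppr_eq0; apply/eqP.
  have -> : vd (\sum_(e in St) l 0 e *: (mvec U_(e)%MM - pv (tq e))) z =
      \sum_(e in St) l 0 e * ((-1) ^+ s (other v e) * (r (other v e) == z)%:R).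
    rewrite /vd mulmx_suml summxE; apply: eq_bigr => e eSt.
    rewrite -/(vd _ z) vdZ vdB vd_mvec wdegU (tqP e).2; have [_ ->] := star_other eSt.
    by rewrite [v == z]eq_sym (negPf neq_zv) add0n opprB addrCA subrr addr0.
  apply: class_sum_eq0 mk0 _ => e e' _ _ [-> ->] //.
have lam_l' : lam l' = 0.
  have [D [u [w [D_gt0 uwP]]]] := clear_denominators (l' 0).
  have def_l' : D%:R *: l' = pv (u, w) by apply/rowP => j; rewrite mxE (uwP _).1 !mxE.
  have uw0 e : e \notin ein U -> u e = 0%N /\ w e = 0%N by move/l'U; apply: (uwP e).2.
  have Uu : insupp U u.
    by apply/insuppP => e; apply: contraR => /uw0[-> _].
  have : D%:R * lam l' = 0.
    rewrite -lamZ def_l' /lam goodX ?mxE //.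
    - apply/mvec_inj/rowP => z; apply/eqP; rewrite !mxE -subr_eq0 -vd_pv -def_l' vdZ vd_l'.
      by rewrite mulr0.
    - by apply: insuppS Uu; apply: subD1set.
    - by have /forallP/(_ v) := Uu; rewrite !inE eqxx /= => /eqP ->.
  by move/eqP; rewrite mulf_eq0 pnatr_eq0 eqn0Ngt D_gt0 => /eqP.
have : lam l = lam l' + \sum_(e in St) l 0 e * F e.
  by rewrite lamB lam_sum; under eq_bigr => e _ do rewrite lamZ; rewrite subrK.
rewrite lam_l' lam1 addr0 => lam_l; apply/rowP => i; rewrite ord1 [RHS]mxE.
exact: lam_l.
Qed.

End GeneratorSupports.

(** * Generators with a vertex of degree two *)

Section DoubledVertices.
Variables (K : fieldType) (n m : nat) (ends : 'I_m -> 'I_n * 'I_n).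
Hypothesis loopless : forall i, (ends i).1 != (ends i).2.
Variable S : seq ('X_{1..m} * 'X_{1..m}).
Local Notation vdeg := (wdeg (edge_mnm ends)).
Local Notation ein := (ein ends).
Local Notation phi := (phi ends).
Local Notation vd := (vd ends).
Local Notation touch := (touch ends).
Local Notation odd_at := (odd_at ends).
Local Notation insupp := (insupp ends).
Local Notation comp := (comp ends).
Local Notation lobe := (lobe ends).
Hypothesis gS : generates (map (@bin K m) S) (mono_ideal (edge_mnm ends)).
Hypothesis indS : indep S.
Implicit Types (U V W C D : {set 'I_n}) (l : 'rV[rat]_m) (u w : 'X_{1..m}) (e : 'I_m)
  (v x : 'I_n) (q : 'X_{1..m} * 'X_{1..m}).

Lemma lobe_notin W v C : lobe W v C -> v \notin C.
Proof. by case=> sCW _; apply/negP => /(subsetP sCW); rewrite !inE eqxx. Qed.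

Lemma lobe_odd W v C l : lobe W v C -> (forall e, l 0 e != 0 -> e \in ein W) ->
  (forall x, vd l x = 0) -> phi v C l != 0 -> odd_at v C.
Proof.
move=> lobeC lW l0; apply: phi_odd; first exact: lobe_notin lobeC.
  by move=> e /lW; apply: lobeC.2.
by move=> x _.
Qed.

Lemma phi_deg2 W v C q : q \in S -> insupp W q.1 -> lobe W v C ->
  phi v C (pv q) != 0 -> (2 <= vdeg q.1 v)%N.
Proof.
move=> qS Wq lobeC; apply: contraNT; rewrite -leqNgt; case: q qS Wq => u w qS /= Wu le1.
have eq_uw := S_wdeg gS qS; apply/eqP/phi_parity => //; first exact: lobe_notin lobeC.
have /insuppP uW := Wu; have /insuppP wW : insupp W w by rewrite -(insupp_wdeg _ eq_uw).
by move=> e [/uW|/wW]; apply: lobeC.2.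
Qed.

Lemma insuppT u : insupp setT u.
Proof. by apply/forallP => x; rewrite inE. Qed.

Lemma insupp_mem W u x : insupp W u -> (0 < vdeg u x)%N -> x \in W.
Proof. by move=> /forallP/(_ x); rewrite implybE negbK => /orP[//|/eqP ->]. Qed.

(** Otherwise [q] would lie in the span of generators of degree at most one at [v], and [q] is none
    of these. *)
Lemma deg2_lobe W v q : q \in S -> insupp W q.1 -> (2 <= vdeg q.1 v)%N ->
  exists2 y, y \in W :\ v & phi v (comp W v y) (pv q) != 0.
Proof.
move=> qS Wq deg2; have vW : v \in W by apply: insupp_mem Wq (leq_trans _ deg2).
have [/existsP[y /andP[]]|] := boolP [exists y in W :\ v, phi v (comp W v y) (pv q) != 0].
  by exists y.
rewrite negb_exists => /forallP noy.
have span_q : in_span [seq q <- S | insupp W q.1 && (vdeg q.1 v <= 1)%N] (pv q).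
  apply: (@span_deg1 K n m ends loopless S gS W v (pv q) vW) => [e|x|y yW]; first exact: pv_ein (S_wdeg gS qS) Wq.
    exact: (vd_S gS x qS).
  by have := noy y; rewrite yW negbK => /eqP.
case: (indS.2 q _ qS _ _ span_q) => [p|]; first by rewrite mem_filter => /andP[].
by rewrite mem_filter leqNgt deg2 andbF.
Qed.

Lemma comp_eq W v y z : z \in comp W v y -> comp W v z = comp W v y.
Proof.
rewrite inE => conn_yz; apply/setP => t; rewrite !inE.
by rewrite (same_connect (adj_in_sym _ _) conn_yz).
Qed.

Lemma comp_disj W v y z : comp W v y != comp W v z -> [disjoint comp W v y & comp W v z].
Proof.
apply: contraR => /pred0Pn[t /andP[/= ty tz]].
by rewrite -(comp_eq ty) (comp_eq tz).
Qed.

Lemma lobe_sep W v C D : lobe W v C -> D \subset W :\ v -> [disjoint C & D] ->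
  forall e, touch C e -> touch D e -> False.
Proof.
move=> lobeC sDW disCD e tC tD.
have inW x : x \in C \/ x \in D -> x \in W.
  by case=> [/(subsetP lobeC.1)|/(subsetP sDW)]; rewrite in_setD1 => /andP[].
have eW : e \in ein W.
  rewrite inE; case/orP: (tC) => x1; case/orP: (tD); rewrite ?(disjointFr disCD x1) // => x2.
    by rewrite !inW; auto.
  by rewrite !inW; auto.
have := lobeC.2 e eW tC; rewrite inE.
have nD x : x \in v |: C -> x \notin D.
  rewrite in_setU1 => /predU1P[->|xC]; last by rewrite (disjointFr disCD).
  by apply/negP => /(subsetP sDW); rewrite !inE eqxx.
by case/andP=> /nD/negPf n1 /nD/negPf n2; move: tD; rewrite /touch n1 n2.
Qed.

Lemma phi_outside W v C l : v \notin C -> [disjoint C & W] ->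
  (forall e, l 0 e != 0 -> e \in ein W) -> phi v C l = 0.
Proof.
move=> vC disCW lW; rewrite phiE big1 // => e eC.
have [->|/lW] := eqVneq (l 0 e) 0; first by rewrite mul0r.
have := ein_loop loopless vC eC; rewrite inE => /orP[] xC; by rewrite (disjointFr disCW xC) ?andbF.
Qed.

(** Two such generators force three components at [v] with odd closed walks: a combination [h] with
    [phi] zero on one component is still nonzero on two others. The generators of the three pairs
    are then dependent modulo those of degree at most one at [v]. *)
Lemma deg2_unique v q q' : q \in S -> q' \in S ->
  (2 <= vdeg q.1 v)%N -> (2 <= vdeg q'.1 v)%N -> q = q'.
Proof.
move=> qS q'S deg_q deg_q'; apply/eqP/negPn/negP => neq_q.
have [US indS'] := indS; pose W : {set 'I_n} := setT.
have vW : v \in W by rewrite inE.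
have lowS (l : 'rV[rat]_m) : (forall x, vd l x = 0) ->
    (forall y, y \in W :\ v -> phi v (comp W v y) l = 0) ->
    in_span [seq q <- S | insupp W q.1 && (vdeg q.1 v <= 1)%N] l.
  by move=> l0 phi0; apply: (span_deg1 loopless gS vW _ l0 phi0) => e _; rewrite !inE.
set low := [seq q <- S | _] in lowS.
have sub_low p : p \in low -> p \in S by rewrite mem_filter => /andP[].
have notin_low p : (2 <= vdeg p.1 v)%N -> p \notin low by move=> deg2; rewrite mem_filter [(_ <= 1)%N]leqNgt deg2 andbF.
have [y1 y1W phi1] := deg2_lobe qS (insuppT _) deg_q.
set C1 := comp W v y1 in phi1.
pose h := phi v C1 (pv q') *: pv q - phi v C1 (pv q) *: pv q'.
have vd_h x : vd h x = 0 by rewrite vdB !vdZ !(vd_S gS) // !mulr0 subrr.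
have hW e : h 0 e != 0 -> e \in ein W by rewrite !inE.
have [y2 y2W phi2] : exists2 y, y \in W :\ v & phi v (comp W v y) h != 0.
  have [/existsP[y /andP[]]|] := boolP [exists y in W :\ v, phi v (comp W v y) h != 0].
    by exists y.
  rewrite negb_exists => /forallP noy; case: (indS' q' (q :: low) q'S).
  - by move=> p; rewrite inE => /predU1P[->|/sub_low].
  - by rewrite inE negb_or eq_sym neq_q notin_low.
  move=> x x0; have : h *m x = 0.
    apply: lowS => [//|y yW|p plow]; last by apply: x0; rewrite inE plow orbT.
    by have := noy y; rewrite yW negbK => /eqP.
  rewrite mulmxBl -!scalemxAl (x0 q (mem_head _ _)) scaler0 sub0r => /eqP.
  by rewrite oppr_eq0 scaler_eq0 (negPf phi1) => /eqP.
set C2 := comp W v y2 in phi2.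
have phi_h1 : phi v C1 h = 0 by rewrite phiB !phiZ mulrC subrr.
have neq12 : C1 != C2 by apply: contraNneq phi2 => <-; rewrite phi_h1.
have lobe1 : lobe W v C1 := comp_lobe _ y1W.
have lobe2 : lobe W v C2 := comp_lobe _ y2W.
have [y3 y3D phi3] : exists2 y, y \in W :\ v :\: C2 & phi v (comp W v y) h != 0.
  apply: phi_comp_neq0 => //; first exact: lobe_compl.
  by rewrite lobe_phi_compl // vd_h sub0r oppr_eq0.
set C3 := comp W v y3 in phi3.
have y3W : y3 \in W :\ v by move: y3D; rewrite inE => /andP[].
have lobe3 : lobe W v C3 := comp_lobe _ y3W.
have neq13 : C1 != C3 by apply: contraNneq phi3 => <-; rewrite phi_h1.
have neq23 : C2 != C3.
  by apply: contraTneq y3D => ->; rewrite !inE connect0.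
have dis12 : [disjoint C1 & C2] := comp_disj neq12.
have dis13 : [disjoint C1 & C3] := comp_disj neq13.
have dis23 : [disjoint C2 & C3] := comp_disj neq23.
have odd1 : odd_at v C1 by apply: lobe_odd lobe1 _ _ phi1 => [e|x]; [rewrite !inE | exact: (vd_S gS x qS)].
have odd2 : odd_at v C2 by apply: lobe_odd lobe2 _ _ phi2 => [e|x]; rewrite ?inE.
have odd3 : odd_at v C3 by apply: lobe_odd lobe3 _ _ phi3 => [e|x]; rewrite ?inE.
have pair_gen C D : lobe W v C -> lobe W v D -> [disjoint C & D] -> odd_at v C -> odd_at v D ->
    exists2 p, p \in S & [/\ (2 <= vdeg p.1 v)%N, phi v C (pv p) != 0,
       phi v D (pv p) = - phi v C (pv p) &
       forall C', v \notin C' -> [disjoint C' & C] -> [disjoint C' & D] -> phi v C' (pv p) = 0].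
  move=> lC lD disCD oC oD; have vC := lobe_notin lC; have vD := lobe_notin lD.
  have [|p pS [Wp phip]] := separated_generator loopless gS vC vD _ oC oD.
    exact: (lobe_sep lC lD.1 disCD).
  have pW e := pv_ein (e := e) (S_wdeg gS pS) Wp.
  exists p => //; split=> //; first exact: phi_deg2 pS (insuppT _) lC phip.
    set Z := v |: (C :|: D) in Wp pW.
    have lCZ : lobe Z v C.
      split=> [|e _]; last by apply: lC.2; rewrite !inE.
      by apply/subsetP => x xC; rewrite !inE xC orbT andbT; apply: contraNneq vC => <-.
    have defD : D = Z :\ v :\: C.
      apply/setP => x; rewrite !inE; have [->|_] := eqVneq x v; first by rewrite (negPf vD) /= andbF.
      by have [xC|xC] := boolP (x \in C); rewrite //= (disjointFr disCD xC).
    rewrite {1}defD lobe_phi_compl ?setU11 // (vd_S gS) // sub0r.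
    by [].
  move=> C' vC' disC disD; apply: (phi_outside (W := v |: (C :|: D))) => //.
  rewrite -setI_eq0; apply/eqP/setP => x; rewrite !inE; apply/negP.
  case/andP=> xC' /predU1P[def_x|/orP[]]; first by rewrite def_x (negPf vC') in xC'.
    by rewrite (disjointFr disC xC').
  by rewrite (disjointFr disD xC').
have [g12 g12S [d12 p12 p12' out12]] := pair_gen C1 C2 lobe1 lobe2 dis12 odd1 odd2.
have [g13 g13S [d13 p13 p13' out13]] := pair_gen C1 C3 lobe1 lobe3 dis13 odd1 odd3.
have [g23 g23S [d23 p23 p23' out23]] := pair_gen C2 C3 lobe2 lobe3 dis23 odd2 odd3.
have v1 := lobe_notin lobe1; have v2 := lobe_notin lobe2; have v3 := lobe_notin lobe3.
have p23_1 : phi v C1 (pv g23) = 0 by apply: out23.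
have p13_2 : phi v C2 (pv g13) = 0 by apply: out13; rewrite // disjoint_sym.
have p12_3 : phi v C3 (pv g12) = 0 by apply: out12; rewrite // disjoint_sym.
(* On the three components the normalised [phi] vectors are e1 - e2, e1 - e3 and e2 - e3. *)
pose h3 := (phi v C1 (pv g12))^-1 *: pv g12 - (phi v C1 (pv g13))^-1 *: pv g13
  + (phi v C2 (pv g23))^-1 *: pv g23.
have phi_h3 y : y \in W :\ v -> phi v (comp W v y) h3 = 0.
  move=> yW; rewrite phiD phiB !phiZ; have vy := lobe_notin (comp_lobe ends yW).
  have [->|ny1] := eqVneq (comp W v y) C1; first by rewrite p23_1 mulr0 addr0 !mulVf // subrr.
  have [->|ny2] := eqVneq (comp W v y) C2.
    by rewrite p12' p13_2 mulr0 subr0 mulrN !mulVf // addNr.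
  have [->|ny3] := eqVneq (comp W v y) C3.
    by rewrite p12_3 p13' p23' mulr0 sub0r !mulrN opprK !mulVf // subrr.
  have dy1 : [disjoint comp W v y & C1] := comp_disj ny1.
  have dy2 : [disjoint comp W v y & C2] := comp_disj ny2.
  have dy3 : [disjoint comp W v y & C3] := comp_disj ny3.
  by rewrite (out12 _ vy dy1 dy2) (out13 _ vy dy1 dy3) (out23 _ vy dy2 dy3) !mulr0 !addr0.
case: (indS' g23 [:: g12, g13 & low] g23S).
- by move=> p; rewrite !inE => /or3P[/eqP->|/eqP->|/sub_low].
- rewrite !inE !negb_or notin_low // andbT.
  by apply/andP; split; apply: contraTneq isT => eq_g; [move: p12 | move: p13]; rewrite -eq_g p23_1 eqxx.
move=> x x0; have : h3 *m x = 0.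
  apply: lowS => [z|//|p plow]; last by apply: x0; rewrite !inE plow !orbT.
  by rewrite vdD vdB !vdZ !(vd_S gS) // !mulr0 !addr0.
rewrite mulmxDl mulmxBl -!scalemxAl (x0 g12) ?mem_head // (x0 g13) ?inE ?eqxx ?orbT //.
rewrite !scaler0 subrr add0r => /eqP; rewrite scaler_eq0 invr_eq0 (negPf p23).
by move/eqP.
Qed.

End DoubledVertices.

(** * Distance levels and minimal odd closed walks *)

Section Levels.
Variables (n m : nat) (ends : 'I_m -> 'I_n * 'I_n).
Hypothesis loopless : forall i, (ends i).1 != (ends i).2.
Hypothesis simple : forall i j, joins ends i (ends j).1 (ends j).2 -> i = j.
Local Notation ein := (ein ends).
Local Notation vd := (vd ends).
Local Notation odd_at := (odd_at ends).
Local Notation R U := (adj_in ends U setT).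
Implicit Types (U V W C P : {set 'I_n}) (l : 'rV[rat]_m) (e : 'I_m) (v x y : 'I_n).

(** The properties of the distance from [v] in [U]; values outside the component of [v] are left
    open. *)
Definition levels U v (d : 'I_n -> nat) :=
  [/\ d v = 0%N,
      forall x, connect (R U) v x -> x != v ->
        exists z, [/\ R U z x, connect (R U) v z & d x = (d z).+1]
    & forall x y, connect (R U) v x -> R U x y -> (d y <= (d x).+1)%N].

Lemma levels_exist U v : exists d, levels U v d.
Proof.
pose P x k := [exists p : k.-tuple 'I_n, path (R U) v p && (last v p == x)].
have PP x k : reflect (exists p, [/\ size p = k, path (R U) v p & last v p = x]) (P x k).
  apply: (iffP existsP) => [[p /andP[pathp /eqP lastp]]|[p [sizep pathp lastp]]].
    by exists p; rewrite size_tuple.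
  by move/eqP: sizep => sizep; exists (Tuple sizep); rewrite /= pathp lastp eqxx.
have /fin_all_exists[d dP] x : exists k, connect (R U) v x ->
    P x k /\ forall k', P x k' -> (k <= k')%N.
  have [conn_x|] := boolP (connect (R U) v x); last by exists 0%N.
  have exP : exists k, P x k.
    by have /connectP[p pathp lastp] := conn_x; exists (size p); apply/PP; exists p.
  by case: (ex_minnP exP) => k Pk mink; exists k.
have conn_of x k : P x k -> connect (R U) v x.
  by move/PP=> [p [_ pathp lastp]]; apply/connectP; exists p.
have P_step x y k : P x k -> R U x y -> P y k.+1.
  move=> /PP[p [sizep pathp lastp]] xy; apply/PP; exists (rcons p y).
  by rewrite size_rcons sizep rcons_path pathp lastp last_rcons.
have d3 x y : connect (R U) v x -> R U x y -> (d y <= (d x).+1)%N.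
  move=> conn_x xy; have [Px _] := dP x conn_x.
  have [_] := dP y (connect_trans conn_x (connect1 xy)); apply.
  exact: P_step Px xy.
exists d; split=> //.
  have [_ /(_ 0%N)] := dP v (connect0 _ _); rewrite leqn0 => d0; apply/eqP/d0.
  by apply/PP; exists [::].
move=> x conn_x neq_xv; have [/PP[p [sizep pathp lastp]] _] := dP x conn_x.
case/lastP: p sizep pathp lastp => [|p x'].
  by move=> _ _ /= def_x; rewrite def_x eqxx in neq_xv.
rewrite size_rcons rcons_path last_rcons => sizep /andP[pathp zx] def_x; rewrite def_x in zx.
exists (last v p); have Pz : P (last v p) (size p) by apply/PP; exists p.
have conn_z := conn_of _ _ Pz; split=> //; apply/eqP; rewrite eqn_leq d3 // -sizep ltnS.
by have [_] := dP _ conn_z; apply.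
Qed.

Section Geodesics.
Variables (U : {set 'I_n}) (v : 'I_n) (d : 'I_n -> nat).
Hypothesis lev : levels U v d.

(** The vertices of a shortest walk from [v] to [t], one per level. A set rather than a sequence,
    because minimality of odd sides concerns vertex sets. *)
Definition geo t P :=
  [/\ t \in P, P \subset U, forall y, y \in P -> (d y <= d t)%N,
      {in P &, injective d}
    & forall y, y \in P -> y != v -> exists2 z, z \in P & R U z y /\ d y = (d z).+1].

Lemma geo_exist t : v \in U -> connect (R U) v t -> exists P, geo t P.
Proof.
have [d0 par _] := lev => vU; have [k] := ubnP (d t); elim: k t => // k IHk t le_tk conn_t.
have [->|neq_tv] := eqVneq t v.
  exists [set v]; split=> [||y|y z|y]; rewrite ?inE ?sub1set //.
  - by move=> /eqP ->.
  - by move=> /eqP -> /eqP ->.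
  - by move=> /eqP ->; rewrite eqxx.
have [z [zt conn_z def_d]] := par t conn_t neq_tv.
have [|P [zP PU leP injP parP]] := IHk z _ conn_z; first by rewrite -ltnS -def_d.
exists (t |: P); split=> [|||x y|y]; rewrite ?setU11 //.
- by rewrite subUset PU sub1set andbT; case/and3P: zt.
- by move=> y; rewrite !inE => /predU1P[->//|/leP]; rewrite def_d => /leqW.
- rewrite !inE => /predU1P[->|xP] /predU1P[->|yP] // eq_d; last exact: injP.
    by have := leP y yP; rewrite -eq_d def_d ltnn.
  by have := leP x xP; rewrite eq_d def_d ltnn.
- rewrite in_setU1 => /predU1P[->|yP] neq_yv; first by exists z; rewrite // in_setU1 zP orbT.
  by have [z' z'P] := parP y yP neq_yv; exists z'; rewrite // in_setU1 z'P orbT.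
Qed.

Lemma geo_walk t P y : geo t P -> y \in P ->
  connect (dadj ends P) (v, false) (y, odd (d y)).
Proof.
have [d0 _ _] := lev; move=> [_ PU _ _ parP].
have [k] := ubnP (d y); elim: k y => // k IHk y le_yk yP.
have [->|neq_yv] := eqVneq y v; first by rewrite d0 connect0.
have [z zP [zy def_d]] := parP y yP neq_yv.
apply: connect_trans (IHk z _ zP) (connect1 _); first by rewrite -ltnS -def_d.
rewrite /dadj /= def_d /=; apply/andP; split; last by case: (odd (d z)).
have /adj_inP[e _ def_e] := zy; apply/adj_inP; exists e => //.
by rewrite inE; case: def_e => ->; rewrite zP yP.
Qed.

Lemma geo_root t P : geo t P -> v \in P.
Proof.
move=> [tP _ _ _ parP]; have [k] := ubnP (d t); elim: k t tP => // k IHk t tP le_tk.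
have [<-//|neq_tv] := eqVneq t v; have [z zP [_ def_d]] := parP t tP neq_tv.
by apply: (IHk z) => //; rewrite -ltnS -def_d.
Qed.

Lemma geo_down t P y : geo t P -> y \in P -> geo y [set z in P | (d z <= d y)%N].
Proof.
move=> [tP PU leP injP parP] yP; split=> [||z|x z|z]; rewrite ?inE ?yP //=.
- by apply/subsetP => z; rewrite inE => /andP[/(subsetP PU)].
- by case/andP.
- by move=> /andP[xP _] /andP[zP _]; apply: injP.
- move=> /andP[zP le_zy] neq_zv; have [x xP [xz def_d]] := parP z zP neq_zv.
  by exists x => //; rewrite inE xP /=; apply: ltnW; rewrite -def_d.
Qed.

(** Below the level of [y], a shortest walk may be replaced by one to any neighbour of [y] one level
    down. *)
Lemma geo_splice t P y q P' : geo t P -> y \in P -> geo q P' -> R U q y -> d y = (d q).+1 ->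
  geo t (P' :|: [set z in P | (d y <= d z)%N]).
Proof.
move=> [tP PU leP injP parP] yP [qP' P'U leP' injP' parP'] qy def_d.
split=> [||z|x z|z]; rewrite ?inE.
- by rewrite tP leP ?orbT.
- rewrite subUset P'U; apply/subsetP => z; rewrite inE => /andP[/(subsetP PU)].
  by [].
- case/orP=> [/leP' le_zq|/andP[/leP //]].
  by apply: leq_trans le_zq _; apply: leq_trans (leP y yP); rewrite def_d.
- case/orP=> [xP'|/andP[xP le_yx]] /orP[zP'|/andP[zP le_yz]] eq_d.
  + exact: injP'.
  + by have := leP' x xP'; move: le_yz; rewrite -eq_d def_d; clear; lia.
  + by have := leP' z zP'; move: le_yx; rewrite eq_d def_d; clear; lia.
  + exact: injP.
- case/orP=> [zP'|/andP[zP le_yz]] neq_zv.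
    by have [x xP' xz] := parP' z zP' neq_zv; exists x => //; rewrite inE xP'.
  move: le_yz; rewrite leq_eqVlt => /predU1P[eq_yz|lt_yz].
    by have -> : z = y by [apply: injP]; exists q; rewrite ?inE ?qP'.
  have [x xP [xz def_z]] := parP z zP neq_zv; exists x => //.
  by rewrite !inE xP; move: lt_yz; rewrite def_z ltnS => ->; rewrite orbT.
Qed.

(** Two shortest walks of equal length and an edge between their ends close up to odd length. *)
Lemma level_edge_odd e P P' : e \in ein U -> d (ends e).1 = d (ends e).2 ->
  geo (ends e).1 P -> geo (ends e).2 P' -> odd_at v ((P :|: P') :\ v).
Proof.
move=> eU eq_d geoP geoP'; rewrite /odd_at setD1K; last by rewrite inE (geo_root geoP).
have [sP _ _ _ _] := geoP; have [s'P' _ _ _ _] := geoP'.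
have sU := subsetUl P P'; have sU' := subsetUr P P'.
apply: connect_trans (dconnS sU (geo_walk geoP sP)) _.
have eP : e \in ein (P :|: P') by rewrite inE (subsetP sU) // (subsetP sU').
apply: connect_trans (connect1 (dadj_edge _ eP)) _; rewrite eq_d dconnC.
by rewrite -dconn_flip /flip /= negbK; apply: dconnS sU' (geo_walk geoP' s'P').
Qed.

End Geodesics.
Lemma connect_adjS U V x y : U \subset V -> connect (R U) x y -> connect (R V) x y.
Proof.
move=> sUV; apply: connect_sub => a b /adj_inP[e eU def_e]; apply/connect1/adj_inP.
by exists e; rewrite ?(subsetP (einS _ sUV)).
Qed.

Lemma joins_uniq e f x y : joins ends e x y -> joins ends f x y -> e = f.
Proof.
move=> jx /orP[] /eqP def_f; apply: simple; rewrite def_f //=.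
by rewrite joinsC.
Qed.

(* Such a [v |: C] is an odd cycle with a path to [v]; it supports no relation. *)
Lemma minimal_odd_relation v C l : v \notin C -> odd_at v C ->
  (forall X : {set 'I_n}, X \subset C -> odd_at v X -> X = C) ->
  (forall e, l 0 e != 0 -> e \in ein (v |: C)) -> (forall x, vd l x = 0) -> l = 0.
Proof.
move=> vC oddC minC lU l0; set U := v |: C in lU *.
have vU : v \in U by rewrite setU11.
have [d lev] := levels_exist U v; have [d0 par step] := lev.
(* By minimality, an edge within a level and any shortest walks to its ends cover [U]. *)
have cover e P P' : e \in ein U -> d (ends e).1 = d (ends e).2 ->
    geo U v d (ends e).1 P -> geo U v d (ends e).2 P' -> P :|: P' = U.
  move=> eU eq_d geoP geoP'; have oddX := level_edge_odd lev eU eq_d geoP geoP'.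
  have vPP : v \in P :|: P' by rewrite inE (geo_root geoP).
  rewrite -(setD1K vPP) (minC _ _ oddX) //; apply/subsetP => x; rewrite !inE => /andP[neq_xv].
  have [_ PU _ _ _] := geoP; have [_ P'U _ _ _] := geoP'.
  by case/orP=> [/(subsetP PU)|/(subsetP P'U)]; rewrite in_setU1 (negPf neq_xv).
(* Otherwise the parity of [d] properly colours the component of [v], which excludes odd closed
   walks. *)
have [e0 e0U [conn1 eq_d0]] : exists2 e, e \in ein U &
    connect (R U) v (ends e).1 /\ d (ends e).1 = d (ends e).2.
  have [/existsP[e /andP[eU /andP[conn_e /eqP eq_d]]]|noe] :=
    boolP [exists e in ein U, connect (R U) v (ends e).1 && (d (ends e).1 == d (ends e).2)].
    by exists e.
  have inv p a : connect (R U) v a.1 -> a.2 = odd (d a.1) -> path (dadj ends U) a p ->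
      (last a p).2 = odd (d (last a p).1).
    elim: p a => [|b p IHp] a //= conn_a def_a /andP[/andP[ab neq_ab] pathp].
    have conn_b : connect (R U) v b.1 by apply: connect_trans conn_a (connect1 ab).
    apply: IHp => //; have ba : R U b.1 a.1 by rewrite adj_inC.
    have neq_d : d a.1 != d b.1.
      have /adj_inP[e eU def_e] := ab; move: noe; rewrite negb_exists => /forallP/(_ e).
      by rewrite eU; case: def_e => -> /=; rewrite ?conn_a ?conn_b //= eq_sym.
    have [def_b|def_b] : d b.1 = (d a.1).+1 \/ d a.1 = (d b.1).+1.
      have := step _ _ conn_a ab; have := step _ _ conn_b ba.
      by move: neq_d; move: (d a.1) (d b.1); clear; lia.
      by move: neq_ab; rewrite def_a def_b /=; case: (b.2); case: (odd _).
    by move: neq_ab; rewrite def_a def_b /=; case: (b.2); case: (odd _).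
  have /connectP[p pathp lastp] := oddC.
  have := inv p (v, false) (connect0 _ _) _ pathp; rewrite -lastp /= d0 => /(_ erefl).
  by [].
have conn2 : connect (R U) v (ends e0).2 by apply: connect_trans conn1 (connect1 (adj_ein e0U)).
have [P0 geo0] := geo_exist lev vU conn1; have [P0' geo0'] := geo_exist lev vU conn2.
have conn x : x \in U -> connect (R U) v x.
  have geo_conn t P : geo U v d t P -> x \in P -> connect (R U) v x.
    move=> geoP xP; have [_ PU _ _ _] := geoP.
    exact: connect_adjS PU (dconn_adj (geo_walk lev geoP xP)).
  move=> xU; have : x \in P0 :|: P0' by rewrite (cover e0).
  by rewrite inE => /orP[xP|xP]; [exact: geo_conn geo0 xP | exact: geo_conn geo0' xP].
have geoE t : t \in U -> exists P, geo U v d t P by move=> tU; apply: geo_exist (conn t tU).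
have ends_U e : e \in ein U -> (ends e).1 \in U /\ (ends e).2 \in U by rewrite inE => /andP.
(* The ends of a level edge are the only vertices of the highest level, so all level edges have the
   same ends. *)
have level_edge e f : e \in ein U -> f \in ein U -> d (ends e).1 = d (ends e).2 ->
    d (ends f).1 = d (ends f).2 -> e = f.
  move=> eU fU eq_e eq_f.
  have [e1 e2] := ends_U e eU; have [f1 f2] := ends_U f fU.
  have [Pe geo_e] := geoE _ e1; have [Pe' geo_e'] := geoE _ e2.
  have [Pf geo_f] := geoE _ f1; have [Pf' geo_f'] := geoE _ f2.
  have le_of g P P' x : g \in ein U -> d (ends g).1 = d (ends g).2 -> geo U v d (ends g).1 P ->
      geo U v d (ends g).2 P' -> x \in U -> (d x <= d (ends g).1)%N.
    move=> gU eq_g geoP geoP'; rewrite -(cover g P P') // inE.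
    by case: geoP geoP' => [_ _ leP _ _] [_ _ leP' _ _] /orP[/leP//|/leP']; rewrite eq_g.
  have eq_ef : d (ends e).1 = d (ends f).1.
    by apply/eqP; rewrite eqn_leq (le_of f Pf Pf') // (le_of e Pe Pe').
  have top x : x \in U -> d x = d (ends f).1 -> x = (ends f).1 \/ x = (ends f).2.
    rewrite -(cover f Pf Pf') // inE.
    case: geo_f geo_f' => [f1P _ _ injP _] [f2P _ _ injP' _] /orP[xP|xP] eq_x; [left | right].
      exact: injP.
    by apply: injP' => //; rewrite -eq_f.
  apply: simple; have neq_e := loopless e; rewrite /joins.
  have t1 := top _ e1 eq_ef; have t2 := top _ e2 (etrans (esym eq_e) eq_ef).
  case: t1 => def1; case: t2 => def2.
  - by move: neq_e; rewrite def1 def2 eqxx.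
  - by rewrite [ends e]surjective_pairing def1 def2 eqxx.
  - by rewrite [ends e]surjective_pairing def1 def2 eqxx orbT.
  - by move: neq_e; rewrite def1 def2 eqxx.
have parent y q q' : y \in U -> R U q y -> R U q' y -> d y = (d q).+1 -> d y = (d q').+1 -> q = q'.
  move=> yU qy q'y def_q def_q'; apply/eqP/negPn/negP => neq_q.
  have [qU q'U] : q \in U /\ q' \in U by case/and3P: qy => ->; case/and3P: q'y.
  have eq_qq : d q = d q' by apply: succn_inj; rewrite -def_q -def_q'.
  (* Rerouting one geodesic through the other neighbour misses the first one. *)
  have reroute s s' P P' a b : geo U v d s P -> geo U v d s' P' ->
      (forall N, geo U v d s N -> N :|: P' = U) -> y \in P -> R U b y -> d y = (d b).+1 ->
      d a = d b -> a != b -> a \in U -> b \in P' -> False.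
    move=> geoP geoP' covN yP by_ def_b eq_ab neq_ab aU bP'.
    have geoN := geo_splice geoP yP (geo_down geoP' bP') by_ def_b.
    have /setP/(_ a) := covN _ geoN; rewrite aU !inE.
    have aP' : a \in P' = false.
      apply/negP => aP'; have [_ _ _ injP' _] := geoP'.
      by rewrite (injP' a b) ?eqxx in neq_ab.
    by rewrite aP' /= def_b -eq_ab ltnn andbF.
  have side s s' P P' : geo U v d s P -> geo U v d s' P' ->
      (forall N, geo U v d s N -> N :|: P' = U) -> y \in P -> False.
    move=> geoP geoP' covN yP.
    have [qP'|qP'] := boolP (q \in P').
      by apply: (reroute s s' P P' q' q) => //; rewrite // eq_sym.
    have [q'P'|q'P'] := boolP (q' \in P').
      exact: (reroute s s' P P' q q').
    move: qU q'U; rewrite -(covN P geoP) !inE (negPf qP') (negPf q'P') !orbF => qP q'P.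
    have [_ _ _ injP _] := geoP; by rewrite (injP q q') ?eqxx in neq_q.
  have : y \in P0 :|: P0' by rewrite (cover e0).
  rewrite inE => /orP[yP|yP].
    by apply: (side _ _ P0 P0' geo0 geo0' _ yP) => N geoN; apply: (cover e0).
  by apply: (side _ _ P0' P0 geo0' geo0 _ yP) => N geoN; rewrite setUC; apply: (cover e0).
(* Pairing with the sign of [d] cancels every edge between consecutive levels and leaves twice the
   coefficient of the only level edge. *)
have l_level e : l 0 e != 0 -> d (ends e).1 != d (ends e).2.
  move=> le; apply/eqP => eq_e; have eU := lU e le.
  have : \sum_x (-1) ^+ d x * vd l x = 0 by rewrite big1 // => x _; rewrite l0 mulr0.
  rewrite sum_vd (bigD1 e) //= big1 ?addr0 => [|f neq_f].
    move/eqP; rewrite mulf_eq0 (negPf le) -eq_e -mulr2n -mulr_natr mulf_eq0 pnatr_eq0 orbF.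
    by rewrite signr_eq0.
  have [->|lf] := eqVneq (l 0 f) 0; first by rewrite mul0r.
  have fU := lU f lf; have [f1 f2] := ends_U f fU.
  have neq_d : d (ends f).1 != d (ends f).2.
    by apply: contraNneq neq_f => eq_f; apply/eqP/level_edge.
  have := step _ _ (conn _ f1) (adj_ein fU).
  have := step _ _ (conn _ f2) (_ : R U _ (ends f).1); rewrite adj_inC => /(_ (adj_ein fU)).
  move: neq_d; case: (ltngtP (d (ends f).1) (d (ends f).2)) => // lt_d _ le1 le2.
    have -> : d (ends f).2 = (d (ends f).1).+1 by move: lt_d le1 le2; clear; lia.
    by rewrite exprS mulN1r subrr mulr0.
  have -> : d (ends f).1 = (d (ends f).2).+1 by move: lt_d le1 le2; clear; lia.
  by rewrite exprS mulN1r addNr mulr0.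
apply/rowP => e; rewrite [RHS]mxE; apply/eqP/negPn/negP => le.
pose top f := maxn (d (ends f).1) (d (ends f).2).
(* At the upper end [y] of a highest edge of the support, any other edge of the support would go
   down to the same unique lower neighbour, so the degree of [l] at [y] is [l 0 e]. *)
case: (@arg_maxnP _ e (fun f => l 0 f != 0) top le) => {le}e le max_e.
have eU := lU e le; have [e1 e2] := ends_U e eU.
have [y [z [je lt_zy]]] : exists y z, joins ends e z y /\ (d z < d y)%N.
  case: (ltngtP (d (ends e).1) (d (ends e).2)) (l_level e le) => // lt_d _.
    by exists (ends e).2, (ends e).1; rewrite /joins -surjective_pairing eqxx.
  by exists (ends e).1, (ends e).2; rewrite /joins -surjective_pairing eqxx orbT.
have topE f x w : joins ends f x w -> top f = maxn (d x) (d w).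
  by rewrite /top => /orP[] /eqP -> //=; rewrite maxnC.
have joinU f x w : f \in ein U -> joins ends f x w -> [/\ x \in U, w \in U & R U x w].
  move=> fU jf; have [f1 f2] := ends_U f fU.
  have xw : R U x w by apply/adj_inP; exists f => //; case/orP: jf => /eqP; auto.
  by case/and3P: (xw).
have [zU yU zy] := joinU e z y eU je.
have def_y : d y = (d z).+1 by apply/eqP; rewrite eqn_leq lt_zy step // conn.
have := l0 y; rewrite vdE (bigD1 e) //= big1 ?addr0 => [|f neq_f].
  move/eqP; rewrite mulf_eq0 (negPf le) pnatr_eq0 edge_mnmE.
  by case/orP: je => /eqP -> /=; rewrite eqxx ?addn1.
have [->|lf] := eqVneq (l 0 f) 0; first by rewrite mul0r.
have [|yf] := eqVneq (edge_mnm ends f y) 0%N; first by move=> ->; rewrite mulr0.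
have [w jf] : exists w, joins ends f w y.
  move: yf; rewrite edge_mnmE; have [<- _|_] := eqVneq (ends f).1 y.
    by exists (ends f).2; rewrite /joins -surjective_pairing eqxx orbT.
  have [<- _|//] := eqVneq (ends f).2 y.
  by exists (ends f).1; rewrite /joins -surjective_pairing eqxx.
have fU := lU f lf; have [wU _ wy] := joinU f w y fU jf.
have := max_e f lf; rewrite (topE f w y jf) (topE e z y je) => le_top.
have neq_d : d w != d y.
  by have := l_level f lf; case/orP: jf => /eqP -> //=; rewrite eq_sym.
have step1 : (d y <= (d w).+1)%N by apply: step => //; apply: conn.
have def_y' : d y = (d w).+1 by move: step1 neq_d le_top lt_zy; clear; lia.
have eq_wz := parent y w z yU wy zy def_y' def_y; rewrite eq_wz in jf.
by case/eqP: neq_f; apply: joins_uniq jf je.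
Qed.

End Levels.

(** * Uniqueness of the generator with a doubled vertex *)

Section UniqueExceptional.
Variables (K : fieldType) (n m : nat) (ends : 'I_m -> 'I_n * 'I_n).
Hypothesis loopless : forall i, (ends i).1 != (ends i).2.
Hypothesis simple : forall i j, joins ends i (ends j).1 (ends j).2 -> i = j.
Local Notation vdeg := (wdeg (edge_mnm ends)).
Local Notation ein := (ein ends).
Local Notation phi := (phi ends).
Local Notation vd := (vd ends).
Local Notation touch := (touch ends).
Local Notation odd_at := (odd_at ends).
Local Notation insupp := (insupp ends).
Local Notation comp := (comp ends).
Local Notation lobe := (lobe ends).
Local Notation R U := (adj_in ends U setT).
Implicit Types (U V W C D P : {set 'I_n}) (l : 'rV[rat]_m) (u w : 'X_{1..m}) (e : 'I_m)
  (v x : 'I_n) (q p : 'X_{1..m} * 'X_{1..m}) (S : seq ('X_{1..m} * 'X_{1..m})).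

Lemma connect_restrict U V x y : connect (R U) x y ->
  (forall z, connect (R U) x z -> z \in V) -> connect (R V) x y.
Proof.
case/connectP=> s; elim: s x => [|x' s IHs] x /=; first by move=> _ -> _; apply: connect0.
case/andP=> xx' paths def_y inV; have xV := inV x (connect0 _ _).
have x'V := inV x' (connect1 xx').
apply: (@connect_trans _ _ x'); last first.
  by apply: IHs => // z conn_z; apply/inV/(connect_trans (connect1 xx')).
apply/connect1/adj_inP; have /adj_inP[e eU def_e] := xx'; exists e => //.
by rewrite inE; case: def_e => ->; rewrite xV x'V.
Qed.

(** Edges of [W] at a vertex of [C] stay in [v |: C], so among these vertices only the degree at [v]
    can change, and it becomes [phi v C l]. *)
Lemma lobe_restrict_vd W v C l : lobe W v C -> (forall e, l 0 e != 0 -> e \in ein W) ->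
  (forall x, vd l x = 0) -> phi v C l = 0 -> forall x, vd (resl (ein (v |: C)) l) x = 0.
Proof.
move=> lC lW l0 phi0 x; have [->|neq_xv] := eqVneq x v; first exact: phi0.
have [xC|xC] := boolP (x \in C).
  rewrite -[RHS](l0 x) !vdE; apply: eq_bigr => e _; rewrite mxE.
  case: ifPn => // eC; have [->//|le] := eqVneq (l 0 e) 0; rewrite mul0r.
  rewrite edge_mnmE; case: eqP => [e1|_]; first by rewrite lC.2 ?lW // /touch e1 xC in eC.
  by case: eqP => [e2|_]; [rewrite lC.2 ?lW // /touch e2 xC orbT in eC | rewrite !mulr0].
rewrite vdE big1 // => e _; rewrite mxE; case: ifP; rewrite ?mul0r // !inE edge_mnmE.
have [-> |_] := eqVneq (ends e).1 x; first by rewrite (negPf neq_xv) (negPf xC).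
by have [-> |_] := eqVneq (ends e).2 x; [rewrite (negPf neq_xv) (negPf xC) andbF | rewrite mulr0].
Qed.

(** With one vertex per level, edges inside [P] join consecutive levels, so the parity of [d] is a
    proper colouring. *)
Lemma geodesic_even U v d P : levels ends U v d -> (forall x, x \in P -> connect (R U) v x) ->
  P \subset U -> {in P &, injective d} -> ~~ connect (dadj ends P) (v, false) (v, true).
Proof.
move=> [d0 _ step] connP PU injP; apply/negP => /connectP[s paths lasts].
have inv a s' : a.2 = odd (d a.1) -> path (dadj ends P) a s' ->
    (last a s').2 = odd (d (last a s').1).
  elim: s' a => [|b s' IHs] a //= def_a /andP[/andP[ab neq_ab] paths'].
  apply: IHs => //; have /and3P[aP bP _] := ab.
  have /adj_inP[e eP def_e] := ab; have eU := subsetP (einS _ PU) e eP.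
  have abU : R U a.1 b.1 by apply/adj_inP; exists e.
  have baU : R U b.1 a.1 by rewrite adj_inC.
  have neq_d : d a.1 != d b.1.
    apply/eqP => /injP eq_ab; have := loopless e.
    by case: def_e => ->; rewrite /= eq_ab ?eqxx.
  have [def_b|def_b] : d b.1 = (d a.1).+1 \/ d a.1 = (d b.1).+1.
    have := step _ _ (connP _ aP) abU; have := step _ _ (connP _ bP) baU.
    by move: neq_d; move: (d a.1) (d b.1); clear; lia.
    by move: neq_ab; rewrite def_a def_b /=; case: (b.2); case: (odd _).
  by move: neq_ab; rewrite def_a def_b /=; case: (b.2); case: (odd _).
by have := inv (v, false) s; rewrite -lasts /= d0 => /(_ erefl paths).
Qed.

Section System.
Variable S : seq ('X_{1..m} * 'X_{1..m}).
Hypothesis gS : generates (map (@bin K m) S) (mono_ideal (edge_mnm ends)).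
Hypothesis indS : indep S.

(** [phi] sums to zero over the components at [v], so it is nonzero on at least two of them, and [z]
    lies in at most one. *)
Lemma deg2_lobe_avoiding v z q : q \in S -> (2 <= vdeg q.1 v)%N -> z != v ->
  exists y, [/\ y \in setT :\ v, z \notin comp setT v y & phi v (comp setT v y) (pv q) != 0].
Proof.
move=> qS deg2 neq_zv; have [y yT phiy] := deg2_lobe loopless gS indS qS (insuppT _ _) deg2.
have [zC|] := boolP (z \in comp setT v y); last by exists y.
have lobeC := comp_lobe ends yT.
have inT e : pv q 0 e != 0 -> e \in ein setT by rewrite !inE.
have phiD : phi v (setT :\ v :\: comp setT v y) (pv q) != 0.
  by rewrite lobe_phi_compl ?in_setT // (vd_S gS v qS) sub0r oppr_eq0.
have lD := lobe_compl (in_setT v) lobeC.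
have [y' y'D phi'] := phi_comp_neq0 loopless (in_setT v) lD inT phiD.
move: y'D; rewrite inE => /andP[y'C y'T]; exists y'; split=> //.
apply: contra y'C => zC'; rewrite -(comp_eq zC) (comp_eq zC').
by rewrite inE connect0.
Qed.

Lemma phi_edge v C l : v \notin C -> phi v C l != 0 -> exists e y, y \in C /\ joins ends e v y.
Proof.
move=> vC; rewrite phiE; have [/existsP[e /andP[eC ev]]|noe] :=
  boolP [exists e in ein (v |: C), edge_mnm ends e v != 0%N]; last first.
  rewrite big1 ?eqxx // => e eC; move: noe; rewrite negb_exists => /forallP/(_ e).
  by rewrite eC negbK => /eqP ->; rewrite mulr0.
move=> _; exists e; have := ein_loop loopless vC eC; move: ev eC; rewrite edge_mnmE /touch !inE /joins.
case: (ends e) => x y /=; have [->|_] := eqVneq x v.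
  by rewrite (negPf vC) /= => _ _ yC; exists y; rewrite eqxx.
have [->|//] := eqVneq y v; rewrite (negPf vC) => _ _; rewrite orbF => xC.
by exists x; rewrite eqxx orbT.
Qed.

(** Let [q] and [q'] differ. Odd components [A] at [v] and [A'] at [v'], joined by a shortest walk
    [P], give a separated pair at [v]; its generator must be [q], which is thus supported on [A],
    [P] and [A']. As [q] has degree at most one at [v'], its part in [A'] can be cut off, and the
    rest would need an odd closed walk inside [P]. *)
Lemma deg2_all v v' q q' : (forall x y : 'I_n, connect (R setT) x y) ->
  q \in S -> q' \in S -> (2 <= vdeg q.1 v)%N -> (2 <= vdeg q'.1 v')%N -> q = q'.
Proof.
move=> connG qS q'S deg_q deg_q'; apply/eqP/negPn/negP => neq_q.
have uniq_v := @deg2_unique K n m ends loopless S gS indS.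
have neq_v : v' != v.
  by apply: contraNneq neq_q => eq_v; apply/eqP/(uniq_v v) => //; rewrite -eq_v.
have neq_v' : v != v' by rewrite eq_sym.
have le_q : (vdeg q.1 v' <= 1)%N.
  by rewrite leqNgt; apply: contra neq_q => deg2; apply/eqP/(uniq_v v').
have [y [yT v'A phiA]] := deg2_lobe_avoiding qS deg_q neq_v.
have [y' [y'T vA' phiA']] := deg2_lobe_avoiding q'S deg_q' neq_v'.
have lA := comp_lobe ends yT; have lA' := comp_lobe ends y'T.
set A := comp setT v y in v'A phiA lA; set A' := comp setT v' y' in vA' phiA' lA'.
have vA := lobe_notin lA; have v'A' := lobe_notin lA'.
have inT l : forall e, l 0 e != 0 -> e \in ein setT by move=> e _; rewrite !inE.
have oddA : odd_at v A by apply: lobe_odd lA (inT _) (fun x => vd_S gS x qS) phiA.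
have oddA' : odd_at v' A' by apply: lobe_odd lA' (inT _) (fun x => vd_S gS x q'S) phiA'.
have [e0 [y0 [y0A je0]]] := phi_edge vA phiA.
have connA a : a \in A -> connect (R (setT :\ v')) v a.
  move=> aA; have conn_y0 : connect (R (setT :\ v')) y0 a.
    apply: (connect_restrict (U := setT :\ v)).
      by have := aA; rewrite /A -(comp_eq y0A) inE.
    move=> z conn_z; rewrite !inE andbT; apply: contraNneq v'A => <-.
    by rewrite /A -(comp_eq y0A) inE.
  apply: connect_trans (connect1 _) conn_y0; apply/adj_inP; exists e0.
    have neq_y0 : y0 != v' by apply: contraNneq v'A => <-.
    by rewrite !inE; case/orP: je0 => /eqP ->; rewrite /= neq_v' neq_y0.
  by case/orP: je0 => /eqP; auto.
have disAA' : [disjoint A & A'].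
  rewrite -setI_eq0; apply/eqP/setP => a; rewrite in_setI in_set0; apply/negP => /andP[aA aA'].
  case/negP: vA'; move: aA'; rewrite !inE => /connect_trans; apply.
  by rewrite adj_in_sym connA.
have sepAA' e : touch A e -> touch A' e -> False.
  move=> tA; have eT : e \in ein setT by rewrite !inE.
  have := lA.2 e eT tA; rewrite inE /touch => /andP[e1 e2].
  have nA' x : x \in v |: A -> x \in A' -> False.
    rewrite in_setU1 => /predU1P[->|xA]; first by rewrite (negPf vA').
    by rewrite (disjointFr disAA' xA).
  by case/orP; [apply: nA' e1 | apply: nA' e2].
have [d lev] := levels_exist ends setT v; have [d0 par step] := lev.
have [P geoP] := geo_exist lev (in_setT v) (connG v v').
have [v'P _ leP injP parP] := geoP; have vP := geo_root geoP.
(* Apart from [v], the walk stays in the component of [v'], hence off [A]. *)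
have connP t : t \in P -> t != v -> t \in comp setT v v'.
  have chain k : (k < d v')%N -> exists2 z, z \in P & d z = (d v' - k)%N /\ z \in comp setT v v'.
    elim: k => [|k IHk] lt_k; first by exists v'; rewrite ?subn0 ?inE ?connect0.
    have [z zP [dz zC]] := IHk (ltnW lt_k).
    have neq_zv : z != v by apply/eqP => def_z; move: dz lt_k; rewrite def_z d0; clear; lia.
    have [x xP [xz dx]] := parP z zP neq_zv; exists x => //; split; first by move: dx dz; clear; lia.
    move: zC; rewrite !inE => /connect_trans; apply; apply: connect1.
    have neq_xv : x != v by apply/eqP => def_x; move: dx dz lt_k; rewrite def_x d0; clear; lia.
    rewrite adj_inC; have /adj_inP[e _ def_e] := xz; apply/adj_inP; exists e => //.
    by rewrite !inE; case: def_e => -> /=; rewrite neq_xv neq_zv.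
  move=> tP neq_tv; have le_t := leP t tP.
  have d_gt0 : (0 < d t)%N.
    by rewrite lt0n; apply: contra neq_tv => /eqP dt; apply/eqP/injP; rewrite // dt d0.
  have [|z zP [dz zC]] := chain (d v' - d t)%N; first by move: d_gt0 le_t; clear; lia.
  by rewrite (injP t z) // dz; move: d_gt0 le_t; clear; lia.
pose C2 := (P :\ v) :|: A'.
have vC2 : v \notin C2 by rewrite in_setU in_setD1 eqxx.
have disAP : [disjoint A & P :\ v].
  rewrite -setI_eq0; apply/eqP/setP => a; rewrite in_setI in_setD1 in_set0; apply/negP => /and3P[aA neq_av aP].
  case/negP: v'A; rewrite /A -(comp_eq aA) inE adj_in_sym.
  by have := connP a aP neq_av; rewrite inE.
have sepAC2 e : touch A e -> touch C2 e -> False.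
  move=> tA tC2; have [tP|ntP] := boolP (touch (P :\ v) e).
    by apply: (lobe_sep lA _ disAP) tA tP; apply: setSD; apply: subsetT.
  apply: sepAA' tA _; move: tC2 ntP; rewrite /touch /C2 !(in_setU _ (P :\ v)) negb_or.
  by case: (_ \in P :\ v) => //; case: (_ \in P :\ v) => //.
have sPC2 : P \subset v |: C2.
  by apply/subsetP => x xP; rewrite !inE xP andbT; case: eqP.
have oddC2 : odd_at v C2.
  have walkP := dconnS sPC2 (geo_walk lev geoP v'P).
  have oddb b : connect (dadj ends (v |: C2)) (v', b) (v', ~~ b).
    have sA'C2 : v' |: A' \subset v |: C2.
      rewrite subUset sub1set (subsetP sPC2) //=.
      by apply/subsetP => x xA'; rewrite in_setU1 in_setU xA' !orbT.
    have := dconnS sA'C2 oddA'; case: b => //.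
    by rewrite -dconn_flip dconnC.
  apply: connect_trans (walkP) _; apply: connect_trans (oddb _) _.
  by rewrite -dconn_flip /flip /= negbK dconnC; exact: walkP.
have [p pS [Hp phip]] := separated_generator loopless gS vA vC2 sepAC2 oddA oddC2.
have deg_p := phi_deg2 loopless gS pS (insuppT _ _) lA phip.
have Hq : insupp (v |: (A :|: C2)) q.1.
  by rewrite -(uniq_v v p q).
have phi_q' : phi v' A' (pv q) = 0.
  apply/eqP; apply: contraLR le_q => /(phi_deg2 loopless gS qS (insuppT _ _) lA').
  by rewrite -ltnNge.
pose l1 := pv q - resl (ein (v' |: A')) (pv q).
have vd_q x : vd (pv q) x = 0 := vd_S gS x qS.
have vd_l1 x : vd l1 x = 0.
  by rewrite vdB vd_q (lobe_restrict_vd lA' (inT _) vd_q phi_q') subrr.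
have l1E e : l1 0 e = if e \in ein (v' |: A') then 0 else pv q 0 e.
  by rewrite !mxE; case: ifP; rewrite ?subrr ?subr0.
pose Z := v |: A :|: P.
have l1Z e : l1 0 e != 0 -> e \in ein Z.
  rewrite l1E; case: ifPn => [|eA']; first by rewrite eqxx.
  move/(pv_ein (S_wdeg gS qS) Hq); have ntA' : ~~ touch A' e.
    by apply: contra eA' => tA'; apply: lA'.2 => //; rewrite !inE.
  move: ntA'; rewrite /touch negb_or => /andP[n1 n2].
  have inZ x : x \notin A' -> x \in v |: (A :|: C2) -> x \in Z.
    rewrite !inE => /negPf ->; rewrite orbF.
    by case: (x == v) => //=; case: (x \in comp _ _ _) => //=.
  by rewrite inE => /andP[/(inZ _ n1) z1 /(inZ _ n2) z2]; rewrite inE z1.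
have phi_l1 : phi v A l1 = phi v A (pv q).
  rewrite !phiE; apply: eq_bigr => e eA; rewrite l1E; case: ifPn => // eA'.
  case: (sepAA' e (ein_loop loopless vA eA) (ein_loop loopless v'A' eA')).
have vZ : v \in Z by rewrite !inE eqxx.
have lAZ : lobe Z v A.
  split=> [|e _ tA]; last by apply: lA.2 => //; rewrite !inE.
  apply/subsetP => x xA; rewrite !inE; apply/andP; split.
    by apply: contraNneq vA => <-.
  by move: xA; rewrite inE => ->; rewrite orbT.
have phiD : phi v (Z :\ v :\: A) l1 != 0.
  by rewrite lobe_phi_compl // vd_l1 sub0r oppr_eq0 phi_l1.
have oddD := lobe_odd (lobe_compl vZ lAZ) l1Z vd_l1 phiD.
have /negP := geodesic_even lev (fun x _ => connG v x) (subsetT P) injP; apply.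
apply: dconnS oddD; apply/subsetP => x; rewrite in_setU1 => /predU1P[->//|].
by rewrite !in_setD in_set1 !in_setU in_set1 => /and3P[xA /negPf -> /=]; rewrite (negPf xA).
Qed.

(* Every separated pair inside the support of [q] gives back [q], so both sides
   are minimal and carry no relation of their own. *)
Lemma deg2_support v W q p : q \in S -> (2 <= vdeg q.1 v)%N ->
  (forall x, x \in W -> (0 < vdeg q.1 x)%N) -> insupp W q.1 -> p \in S -> insupp W p.1 -> p = q.
Proof.
move=> qS deg2 suppW Wq pS Wp; apply/eqP/negPn/negP => neq_pq.
have uniq_v := @deg2_unique K n m ends loopless S gS indS v.
have vW : v \in W by apply: insupp_mem Wq (leq_trans _ deg2).
have [y yW phiC] := deg2_lobe loopless gS indS qS Wq deg2.
have lC := comp_lobe ends yW; set C := comp W v y in phiC lC.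
pose D := W :\ v :\: C; have lD : lobe W v D := lobe_compl vW lC.
have qW e : pv q 0 e != 0 -> e \in ein W := pv_ein (S_wdeg gS qS) Wq.
have vd_q x : vd (pv q) x = 0 := vd_S gS x qS.
have phiD : phi v D (pv q) != 0 by rewrite lobe_phi_compl // vd_q sub0r oppr_eq0.
have oddC := lobe_odd lC qW vd_q phiC; have oddD := lobe_odd lD qW vd_q phiD.
have disCD : [disjoint C & D].
  by rewrite -setI_eq0; apply/eqP/setP => x; rewrite in_setI in_setD in_set0; case: (x \in C).
(* An odd [X] inside [A] still forms a separated pair with [B]; its generator is again [q], whose
   support is all of [W]. *)
have min_side A B : lobe W v A -> lobe W v B -> [disjoint A & B] -> odd_at v B ->
    forall X : {set 'I_n}, X \subset A -> odd_at v X -> X = A.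
  move=> lA lB disAB oddB X sXA oddX; have vA := lobe_notin lA; have vB := lobe_notin lB.
  have vX : v \notin X by apply: contra vA; apply: (subsetP sXA).
  have sZW : v |: (X :|: B) \subset W.
    rewrite !subUset sub1set vW /=; apply/andP; split.
      by apply: subset_trans sXA (subset_trans lA.1 _); apply: subD1set.
    by apply: subset_trans lB.1 _; apply: subD1set.
  have eW e : touch X e -> touch A e.
    by rewrite /touch => /orP[] /(subsetP sXA) ->; rewrite ?orbT.
  have lX : lobe (v |: (X :|: B)) v X.
    split=> [|e eZ tX].
      apply/subsetP => x xX; rewrite !inE xX orbT andbT.
      by apply: contraNneq vX => <-.
    have := lA.2 e (subsetP (einS _ sZW) e eZ) (eW e tX).
    have inX x : x \in v |: (X :|: B) -> x \in v |: A -> x \in v |: X.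
      rewrite !inE => /orP[-> //|/orP[-> |xB]]; first by rewrite orbT.
      by rewrite (disjointFl disAB xB) orbF => ->.
    have einE V : (e \in ein V) = ((ends e).1 \in V) && ((ends e).2 \in V) by rewrite inE.
    move: eZ; rewrite !einE => /andP[z1 z2] /andP[a1 a2].
    by rewrite (inX _ z1 a1) (inX _ z2 a2).
  have sep e : touch X e -> touch B e -> False.
    by move=> /eW tA; apply: (lobe_sep lA lB.1 disAB) tA.
  have [r rS [Zr phir]] := separated_generator loopless gS vX vB sep oddX oddB.
  have deg_r := phi_deg2 loopless gS rS Zr lX phir.
  have eq_rq := uniq_v _ _ rS qS deg_r deg2; rewrite eq_rq in Zr.
  apply/eqP; rewrite eqEsubset sXA; apply/subsetP => x xA.
  have xW : x \in W by have := subsetP lA.1 x xA; rewrite !inE => /andP[].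
  have := insupp_mem Zr (suppW x xW); rewrite !inE (disjointFr disAB xA) orbF.
  by case/predU1P=> // def_x; rewrite -def_x xA in vA.
have pW e : pv p 0 e != 0 -> e \in ein W := pv_ein (S_wdeg gS pS) Wp.
have vd_p x : vd (pv p) x = 0 := vd_S gS x pS.
(* [p] has degree at most one at [v], so its restriction to a side is itself a relation, and a
   minimal odd side supports none. *)
have side A B : lobe W v A -> lobe W v B -> [disjoint A & B] -> odd_at v A -> odd_at v B ->
    resl (ein (v |: A)) (pv p) = 0.
  move=> lA lB disAB oddA oddB.
  have phi0 : phi v A (pv p) = 0.
    apply/eqP; apply: contraNT neq_pq => /(phi_deg2 loopless gS pS Wp lA) deg_p.
    by apply/eqP/uniq_v.
  apply: (minimal_odd_relation loopless simple (lobe_notin lA) oddA (min_side A B lA lB disAB oddB)).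
    by move=> e; rewrite mxE; case: ifP; rewrite ?eqxx.
  exact: lobe_restrict_vd lA pW vd_p phi0.
have rC := side C D lC lD disCD oddC oddD.
have rD := side D C lD lC ltac:(by rewrite disjoint_sym) oddD oddC.
have pv0 : pv p = 0.
  apply/rowP => e; rewrite [RHS]mxE; apply/eqP/negPn/negP => pe.
  have eW := pW e pe; have [tC|ntC] := boolP (touch C e).
    by have /rowP/(_ e) := rC; rewrite mxE (lC.2 e eW tC) [RHS]mxE => /eqP; rewrite (negPf pe).
  have tD : touch D e.
    move: ntC eW; rewrite /touch negb_or !inE => /andP[-> ->] /andP[-> ->] /=.
    by rewrite !andbT -negb_and; apply: contra (loopless e) => /andP[/eqP -> /eqP ->].
  by have /rowP/(_ e) := rD; rewrite mxE (lD.2 e eW tD) [RHS]mxE => /eqP; rewrite (negPf pe).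
case: (indS.2 p [::] pS) => // x _.
by rewrite pv0 mul0mx.
Qed.

End System.
End UniqueExceptional.

(** * Restriction of ideals to induced subgraphs *)

Section Faces.
Variables (K : fieldType) (n m : nat) (ends : 'I_m -> 'I_n * 'I_n).
Local Notation vdeg := (wdeg (edge_mnm ends)).
Local Notation ein := (ein ends).
Local Notation insupp := (insupp ends).
Implicit Types (W : {set 'I_n}) (u w : 'X_{1..m}) (S : seq ('X_{1..m} * 'X_{1..m})).

Definition restrict W (p : {mpoly K[m]}) : {mpoly K[m]} :=
  p \mPo [tuple (if e \in ein W then 'X_e else 0) | e < m].

Lemma restrictX W u : restrict W 'X_[u] = if insupp W u then 'X_[u] else 0.
Proof.
rewrite /restrict comp_mpolyX; case: ifPn => [/insuppP uW|].
  rewrite [RHS]mpolyXE_id; apply: eq_bigr => e _; rewrite tnth_mktuple.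
  by have [->|/uW ->] := eqVneq (u e) 0%N; rewrite ?expr0.
move/insuppP => nuW; have [e ue eW] : exists2 e, u e != 0%N & e \notin ein W.
  apply: NNPP => noe; apply: nuW => e ue; apply/negPn/negP => eW.
  by apply: noe; exists e.
by rewrite (bigD1 e) //= tnth_mktuple (negPf eW) expr0n (negPf ue) mul0r.
Qed.

Lemma restrict_id W p : (forall u, u \in msupp p -> insupp W u) -> restrict W p = p.
Proof.
move=> pW; rewrite /restrict comp_mpolyEX [RHS]mpolyE; apply: eq_big_seq => u /pW Wu.
by rewrite -/(restrict _ _) restrictX Wu.
Qed.

(** Killing the variables outside [W] fixes [p] and annihilates each generator not supported in [W],
    as its two monomials have the same multidegree. *)
Lemma face_ideal W S p : (forall q, q \in S -> vdeg q.1 = vdeg q.2) ->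
  (forall u, u \in msupp p -> insupp W u) -> in_ideal (map (@bin K m) S) p ->
  in_ideal (map (@bin K m) [seq q <- S | insupp W q.1]) p.
Proof.
move=> S_L pW [c def_p]; rewrite -(restrict_id pW) {1}def_p /restrict raddf_sum /=.
have idJ := in_ideal_is_ideal (map (@bin K m) [seq q <- S | insupp W q.1]).
apply: ideal_sum => // i _; rewrite rmorphM /=; case: (idJ) => J0 _; apply.
have lti : (i < size S)%N by rewrite -(size_map (@bin K m)).
rewrite (nth_map (0%MM, 0%MM)) //; set q := nth _ S i; have qS : q \in S by apply: mem_nth.
rewrite /bin raddfB /= -!/(restrict _ _) !restrictX -(insupp_wdeg _ (S_L q qS)).
case: ifPn => Wq; last by rewrite subrr.
by apply: mem_in_ideal; apply: (map_f (@bin K m)); rewrite mem_filter Wq.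
Qed.

Lemma msupp_bin u w y : y \in msupp (bin (u, w) : {mpoly K[m]}) -> y = u \/ y = w.
Proof. by move=> /msuppB_le; rewrite !msuppX mem_cat !inE => /orP[] /eqP ->; auto. Qed.

(** The two factors are inverse to each other, hence constant, and one coefficient decides the
    sign. *)
Lemma bin_scale (p r : {mpoly K[m]}) q q' : q.1 <> q.2 ->
  bin q' = p * bin q -> bin q = r * bin q' ->
  bin q' = bin q :> {mpoly K[m]} \/ bin q' = - bin q :> {mpoly K[m]}.
Proof.
case: q q' => [u w] [u' w'] /= /eqP neq_uw def_q' def_q.
have bin_neq0 : bin (u, w) != 0 :> {mpoly K[m]}.
  apply: contraNneq neq_uw => /(congr1 (mcoeff u)); rewrite /bin mcoeffB !mcoeffX /= eqxx mcoeff0.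
  by case: eqP => [->//|_ /eqP]; rewrite subr0 oner_eq0.
have rp1 : r * p = 1 by apply: (mulIf bin_neq0); rewrite mul1r -mulrA -def_q' -def_q.
have [c def_p] : exists c, p = c%:MP.
  have p0 : p != 0 by apply: contraTneq isT => p0; move/eqP: rp1; rewrite p0 mulr0 eq_sym oner_eq0.
  have r0 : r != 0 by apply: contraTneq isT => r0; move/eqP: rp1; rewrite r0 mul0r eq_sym oner_eq0.
  have := msizeM r0 p0; rewrite rp1 msize1 => size_rp.
  exists (p@_0); apply: msize1_polyC.
  have: (0 < msize r)%N by rewrite lt0n msize_poly_eq0.
  by move: size_rp; move: (msize r) (msize p) => i j; lia.
move: def_q'; rewrite def_p mul_mpolyC => def_q'.
have c_neq0 : c != 0.
  by apply: contraTneq isT => c0; move: rp1; rewrite def_p c0 mpolyC0 mulr0 => /eqP; rewrite eq_sym oner_eq0.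
have /(congr1 (mcoeff u)) := def_q'; rewrite mcoeffZ !mcoeffB !mcoeffX /= eqxx.
rewrite [w == u]eq_sym (negPf neq_uw) subr0 mulr1 def_q' => def_c.
have [eq_u|neq_u] := eqVneq u' u; have [eq_w|neq_w] := eqVneq w' u.
- by move: def_c; rewrite eq_u eq_w eqxx subrr => c0; rewrite -c0 eqxx in c_neq0.
- by left; move: def_c; rewrite eq_u eqxx (negPf neq_w) subr0 => <-; rewrite scale1r.
- by right; move: def_c; rewrite eq_w eqxx (negPf neq_u) sub0r => <-; rewrite scaleN1r.
- by move: def_c; rewrite (negPf neq_u) (negPf neq_w) subrr => c0; rewrite -c0 eqxx in c_neq0.
Qed.

End Faces.

Section ExceptionalGenerator.
Variables (K : fieldType) (n m : nat) (ends : 'I_m -> 'I_n * 'I_n).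
Hypothesis loopless : forall i, (ends i).1 != (ends i).2.
Hypothesis simple : forall i j, joins ends i (ends j).1 (ends j).2 -> i = j.
Hypothesis connG : forall x y : 'I_n, connect (adj_in ends setT setT) x y.
Local Notation vdeg := (wdeg (edge_mnm ends)).
Local Notation I := (@mono_ideal K m n (edge_mnm ends)).
Local Notation bins S := (map (@bin K m) S).
Implicit Types (S : seq ('X_{1..m} * 'X_{1..m})).

(** That the two sides of [q] are odd does not refer to [S], so [S'] too has a generator there with
    degree two at [v]; uniqueness within [S'] identifies it with [q']. *)
Lemma exceptional_support S S' q q' v v' :
  generates (bins S) I -> indep S -> generates (bins S') I -> indep S' ->
  q \in S -> q' \in S' -> (2 <= vdeg q.1 v)%N -> (2 <= vdeg q'.1 v')%N ->
  insupp ends [set x | (0 < vdeg q.1 x)%N] q'.1.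
Proof.
move=> gS indS gS' indS' qS q'S' deg_q deg_q'; set W := [set x | _].
have Wq : insupp ends W q.1.
  by apply/forallP => x; rewrite inE -eqn0Ngt implybb.
have vW : v \in W by rewrite inE (leq_trans _ deg_q).
have [y yW phiC] := deg2_lobe loopless gS indS qS Wq deg_q.
have lC := comp_lobe ends yW; set C := comp ends W v y in phiC lC.
pose D := W :\ v :\: C; have lD : lobe ends W v D := lobe_compl vW lC.
have qW e : pv q 0 e != 0 -> e \in ein ends W := pv_ein (S_wdeg gS qS) Wq.
have vd_q x : vd ends (pv q) x = 0 := vd_S gS x qS.
have phiD : phi ends v D (pv q) != 0 by rewrite lobe_phi_compl // vd_q sub0r oppr_eq0.
have oddC := lobe_odd lC qW vd_q phiC; have oddD := lobe_odd lD qW vd_q phiD.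
have disCD : [disjoint C & D].
  by rewrite -setI_eq0; apply/eqP/setP => x; rewrite in_setI in_setD in_set0; case: (x \in C).
have [p pS' [Wp phip]] := separated_generator loopless gS' (lobe_notin lC) (lobe_notin lD)
  (lobe_sep lC lD.1 disCD) oddC oddD.
have sW : v |: (C :|: D) \subset W.
  rewrite !subUset sub1set vW (subset_trans lC.1) ?subD1set //=.
  by rewrite (subset_trans lD.1) ?subD1set.
have {}Wp := insuppS sW Wp.
have deg_p := phi_deg2 loopless gS' pS' Wp lC phip.
by rewrite -(deg2_all loopless gS' indS' connG pS' q'S' deg_p deg_q').
Qed.

(** Each binomial is supported where the other is the only generator of its system, so each is a
    multiple of the other. *)
Lemma exceptional_unique S S' q q' v v' :
  generates (bins S) I -> indep S -> generates (bins S') I -> indep S' ->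
  q \in S -> q' \in S' -> (2 <= vdeg q.1 v)%N -> (2 <= vdeg q'.1 v')%N ->
  bin q' = bin q :> {mpoly K[m]} \/ bin q' = - bin q :> {mpoly K[m]}.
Proof.
have [idI _ _] := @mono_ideal_prime K m n (edge_mnm ends).
have multiple T q1 q2 x : generates (bins T) I -> indep T -> q1 \in T -> (2 <= vdeg q1.1 x)%N ->
    vdeg q2.1 = vdeg q2.2 -> insupp ends [set y | (0 < vdeg q1.1 y)%N] q2.1 ->
    exists c, bin q2 = c * bin q1 :> {mpoly K[m]}.
  move=> gT indT q1T deg1 eq_q2 Wq2; set W := [set y | _] in Wq2.
  have Wq1 : insupp ends W q1.1 by apply/forallP => y; rewrite inE -eqn0Ngt implybb.
  have [_ IT] := (generatesP _ idI).1 gT.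
  have suppW u : u \in msupp (bin q2 : {mpoly K[m]}) -> insupp ends W u.
    by case: (q2) eq_q2 Wq2 => a b /= eq_ab Wa /msupp_bin[] -> //; rewrite -(insupp_wdeg _ eq_ab).
  have Iq2 : I (bin q2) by case: (q2) eq_q2 => a b /= eq_ab; apply/mono_ideal_bin.
  have := face_ideal (fun q => S_wdeg gT (q := q)) suppW (IT _ Iq2).
  apply: (@in_ideal_min K m _ (fun p => exists c, p = c * bin q1)).
    split; first by exists 0; rewrite mul0r.
      by move=> _ _ [c ->] [d ->]; exists (c + d); rewrite mulrDl.
    by move=> r _ [c ->]; exists (r * c); rewrite mulrA.
  move=> s /mapP[p]; rewrite mem_filter => /andP[Wp pT] ->; exists 1; rewrite mul1r.
  have posW z : z \in W -> (0 < vdeg q1.1 z)%N by rewrite inE.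
  by rewrite (deg2_support loopless simple gT indT q1T deg1 posW Wq1 pT Wp).
move=> gS indS gS' indS' qS q'S' deg_q deg_q'.
have sq := exceptional_support gS indS gS' indS' qS q'S' deg_q deg_q'.
have sq' := exceptional_support gS' indS' gS indS q'S' qS deg_q' deg_q.
have [c def_q'] := multiple S q q' v gS indS qS deg_q (S_wdeg gS' q'S') sq.
have [c' def_q] := multiple S' q' q v' gS' indS' q'S' deg_q' (S_wdeg gS qS) sq'.
apply: bin_scale def_q' def_q => eq_q.
case: (indS.2 q [::] qS) => // x _; rewrite /pv eq_q subrr.
exact: mul0mx.
Qed.

End ExceptionalGenerator.

(** * Generators of degree at most one at every vertex *)

Section EvenCycles.
Variables (K : fieldType) (n m : nat) (ends : 'I_m -> 'I_n * 'I_n).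
Hypothesis loopless : forall i, (ends i).1 != (ends i).2.
Hypothesis simple : forall i j, joins ends i (ends j).1 (ends j).2 -> i = j.
Local Notation vdeg := (wdeg (edge_mnm ends)).
Implicit Types (u w : 'X_{1..m}) (e f : 'I_m) (x y z : 'I_n) (W : {set 'I_n}).

(** [eu x] is the matching edge at [x], [al x] its other end. The involution law covers all
    vertices, which makes [al] injective. *)
Definition is_matching u W (eu : 'I_n -> 'I_m) (al : 'I_n -> 'I_n) :=
  [/\ forall x, x \in W -> u (eu x) = 1%N /\ joins ends (eu x) x (al x),
      forall x, x \in W -> al x \in W /\ al x != x,
      forall x, al (al x) = x,
      forall x, x \in W -> eu (al x) = eu x
    & forall f x y, u f != 0%N -> joins ends f x y -> x \in W /\ f = eu x].

Lemma joins_ends e : joins ends e (ends e).1 (ends e).2.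
Proof. by rewrite /joins -surjective_pairing eqxx. Qed.

Lemma joins_edge e x y z : joins ends e x y -> edge_mnm ends e z = ((x == z) + (y == z))%N.
Proof. by rewrite edge_mnmE => /orP[] /eqP -> //=; rewrite addnC. Qed.

Lemma joins_neq e x y : joins ends e x y -> x != y.
Proof. by have := loopless e => neq /orP[] /eqP def_e; move: neq; rewrite def_e //= eq_sym. Qed.

Lemma matching_exists u W (e0 : 'I_m) : (forall x, vdeg u x = (x \in W)) ->
  exists eu al, is_matching u W eu al.
Proof.
move=> deg_u.
have /fin_all_exists[eu euP] x : exists e, x \in W ->
    [/\ u e = 1%N, edge_mnm ends e x = 1%N
      & forall f, u f != 0%N -> edge_mnm ends f x != 0%N -> f = e].
  have [xW|] := boolP (x \in W); last by exists e0.
  have := deg_u x; rewrite xW wdegE => sum1.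
  have [/existsP[e ex]|] := boolP [exists e, (edge_mnm ends e x * u e)%N != 0%N]; last first.
    rewrite negb_exists => /forallP no_e; move: sum1; rewrite big1 // => e _.
    by apply/eqP; have := no_e e; rewrite negbK.
  exists e => _; move: sum1; rewrite (bigD1 e) //= => sum1.
  have e1 : (edge_mnm ends e x * u e = 1)%N.
    by move: sum1 ex; move: (_ * _)%N (\sum_(_ | _) _)%N => a b; clear; lia.
  move/eqP: (e1); rewrite muln_eq1 => /andP[/eqP ex1 /eqP ue1]; split=> // f uf fx.
  apply/eqP/negPn/negP => neq_fe; move: sum1; rewrite e1 (bigD1 f) //= => /eqP.
  by rewrite eqSS addn_eq0 muln_eq0 (negPf uf) (negPf fx).
(* Fixing the vertices outside [W] makes [al] an involution everywhere. *)
pose al x := if x \in W then other ends x (eu x) else x.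
have joins_al x : x \in W -> joins ends (eu x) x (al x).
  move=> xW; rewrite /al xW /other; have [_ ex _] := euP x xW; move: ex; rewrite edge_mnmE.
  have [def1 _|neq1] := eqVneq (ends (eu x)).1 x; first by rewrite -[X in joins _ _ X]def1 joins_ends.
  have [def2 _|//] := eqVneq (ends (eu x)).2 x.
  by rewrite joinsC -[X in joins _ _ _ X]def2 joins_ends.
have joinsW f x y : u f != 0%N -> joins ends f x y -> x \in W /\ f = eu x.
  move=> uf jf; have fx : edge_mnm ends f x != 0%N by rewrite (joins_edge _ jf) eqxx.
  have xW : x \in W.
    have := deg_u x; rewrite wdegE (bigD1 f) //=; case: (x \in W) => // /eqP.
    by rewrite addn_eq0 muln_eq0 (negPf uf) (negPf fx).
  by split=> //; have [_ _] := euP x xW; apply.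
have alW x : x \in W -> al x \in W /\ eu (al x) = eu x.
  move=> xW; have [ue _ _] := euP x xW.
  have [] := joinsW (eu x) (al x) x; rewrite ?ue //; first by rewrite joinsC joins_al.
exists eu, al; split=> // [x xW|x xW|x|x xW].
- by split; [have [] := euP x xW | apply: joins_al].
- by have [alxW _] := alW x xW; split; rewrite // eq_sym (joins_neq (joins_al x xW)).
- have [xW|nxW] := boolP (x \in W); last by rewrite /al !(negPf nxW).
  have [alxW eq_e] := alW x xW; have jal := joins_al (al x) alxW; rewrite eq_e in jal.
  have jx := joins_al x xW; have neq := joins_neq jx.
  have := joins_edge x jal; rewrite (joins_edge x jx) eqxx [al x == x]eq_sym (negPf neq) add0n.
  by case: eqP => // _; case: eqP.
- by have [] := alW x xW.
Qed.

Section Alternating.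
Variables (u w : 'X_{1..m}) (W : {set 'I_n}) (eu ew : 'I_n -> 'I_m) (al be : 'I_n -> 'I_n).
Hypothesis Mu : is_matching u W eu al.
Hypothesis Mw : is_matching w W ew be.
Hypothesis disj : forall e, u e != 0%N -> w e != 0%N -> False.
Variable x0 : 'I_n.
Hypothesis x0W : x0 \in W.

(** Rotation by two steps along an alternating cycle; the orbit of [x0] gives the even positions. *)
Definition turn x := be (al x).

Fixpoint vseq j := if j is j'.+1 then (if odd j' then be (vseq j') else al (vseq j')) else x0.

Definition eseq j := if odd j then ew (vseq j) else eu (vseq j).

Lemma vseq_in j : vseq j \in W.
Proof.
have [_ alW _ _ _] := Mu; have [_ beW _ _ _] := Mw.
by elim: j => //= j IHj; case: ifP => _; [have [] := beW _ IHj | have [] := alW _ IHj].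
Qed.

Lemma vseq_even i : vseq i.*2 = iter i turn x0.
Proof. by elim: i => //= i IHi; rewrite odd_double /= IHi. Qed.

Lemma vseq_odd i : vseq i.*2.+1 = al (iter i turn x0).
Proof. by rewrite /= odd_double vseq_even. Qed.

Lemma turn_inj : injective turn.
Proof.
have [_ _ alK _ _] := Mu; have [_ _ beK _ _] := Mw.
by apply: inj_comp (can_inj beK) (can_inj alK).
Qed.

(* A reflection taking [z] to its own rotation orbit would have a fixed point. *)
Lemma al_neq_turn t z : z \in W -> al z != iter t turn z.
Proof.
have [_ alW alK _ _] := Mu; have [_ beW beK _ _] := Mw.
have [s] := ubnP t; elim: s t z => // s IHs [|[|t]] z lt_ts zW.
- by have [] := alW z zW.
- by have [alzW _] := alW z zW; have [_] := beW _ alzW; rewrite eq_sym.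
have tzW : turn z \in W by have [alzW _] := alW z zW; have [] := beW _ alzW.
apply: contraNneq (IHs t (turn z) ltac:(lia) tzW) => eq_z.
have : al (iter t.+1 turn z) = turn z by rewrite /turn eq_z /= /turn beK.
by move=> eq_t; rewrite -iterSr -[iter t.+1 turn z]alK eq_t.
Qed.

Let k := order turn x0.

Lemma iter_turn_in i : iter i turn x0 \in W.
Proof. by rewrite -vseq_even vseq_in. Qed.

Lemma iter_turn_inj i j : (i < k)%N -> (j < k)%N -> iter i turn x0 = iter j turn x0 -> i = j.
Proof. by move=> lti ltj eq_ij; rewrite -(findex_iter lti) -(findex_iter ltj) eq_ij. Qed.

Lemma al_iter_neq i j : al (iter i turn x0) <> iter j turn x0.
Proof.
move=> eq_ij; have [le_ij|/ltnW le_ji] := leqP i j.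
  have := al_neq_turn (j - i) (iter_turn_in i); rewrite eq_ij -iterD subnK //.
  by rewrite eqxx.
have [_ _ alK _ _] := Mu; have := al_neq_turn (i - j) (iter_turn_in j).
by rewrite -eq_ij alK eq_ij -iterD subnK // eqxx.
Qed.

Lemma vseqE j : vseq j = if odd j then al (iter j./2 turn x0) else iter j./2 turn x0.
Proof. by rewrite -{1}[j]odd_double_half; case: (odd j); rewrite ?vseq_odd ?vseq_even. Qed.

Lemma vseq_inj i j : (i < k.*2)%N -> (j < k.*2)%N -> vseq i = vseq j -> i = j.
Proof.
have [_ _ alK _ _] := Mu => lti ltj; rewrite !vseqE.
have {}lti : (i./2 < k)%N by move: lti; clear; lia.
have {}ltj : (j./2 < k)%N by move: ltj; clear; lia.
have al_inj : injective al by apply: can_inj alK.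
have eq_half : odd i = odd j -> i./2 = j./2 -> i = j.
  by move=> eq_o eq_h; rewrite -[i]odd_double_half -[j]odd_double_half eq_o eq_h.
case oi: (odd i); case oj: (odd j).
- by move/al_inj/(iter_turn_inj lti ltj); apply: eq_half; rewrite oi oj.
- by move/al_iter_neq.
- by move/esym/al_iter_neq.
- by move/(iter_turn_inj lti ltj); apply: eq_half; rewrite oi oj.
Qed.

Lemma vseq_period : vseq k.*2 = x0.
Proof. by rewrite vseq_even iter_order //; apply: turn_inj. Qed.

Lemma eseq_joins j : joins ends (eseq j) (vseq j) (vseq j.+1).
Proof.
have [euP _ _ _ _] := Mu; have [ewP _ _ _ _] := Mw.
rewrite /eseq /=; case: (odd j); first by have [] := ewP _ (vseq_in j).
by have [] := euP _ (vseq_in j).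
Qed.

Lemma eseq_mem j : if odd j then w (eseq j) = 1%N else u (eseq j) = 1%N.
Proof.
have [euP _ _ _ _] := Mu; have [ewP _ _ _ _] := Mw.
by rewrite /eseq; case: (odd j); [have [] := ewP _ (vseq_in j) | have [] := euP _ (vseq_in j)].
Qed.

(** A cycle of length two would be an edge common to both matchings, by simplicity. *)
Lemma k_gt1 : (1 < k)%N.
Proof.
have [_ _ alK _ _] := Mu; have [_ _ beK _ _] := Mw.
have k_gt0 : (0 < k)%N by apply: order_gt0.
rewrite ltn_neqAle k_gt0 andbT; apply/eqP => k1.
have := vseq_period; rewrite -k1 /= => turn_x0.
have j0 := eseq_joins 0; have j1 := eseq_joins 1.
rewrite /= turn_x0 joinsC in j1; have eq_e := joins_uniq simple j0 j1.
by apply: (@disj (eseq 0)); rewrite ?(eseq_mem 0) // eq_e (eseq_mem 1).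
Qed.

Lemma joins_cases e x y x' y' : joins ends e x y -> joins ends e x' y' ->
  (x = x' /\ y = y') \/ (x = y' /\ y = x').
Proof.
by rewrite /joins => /orP[] /eqP -> /orP[] /eqP [-> ->]; auto.
Qed.

Lemma eseq_inj i j : (i < k.*2)%N -> (j < k.*2)%N -> eseq i = eseq j -> i = j.
Proof.
move=> lti ltj eq_e.
have par : odd i = odd j.
  apply/eqP/negPn/negP => neq; have := eseq_mem i; have := eseq_mem j.
  rewrite eq_e; move: neq; case: (odd i); case: (odd j) => // _ m1 m2;
    by apply: (@disj (eseq j)); rewrite ?m1 ?m2.
have ji := eseq_joins i; have jj := eseq_joins j; rewrite eq_e in ji.
case: (joins_cases ji jj) => [[eq_v _]|[eq_v _]]; first exact: vseq_inj eq_v.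
have [lt_j1|ge_j1] := ltnP j.+1 k.*2.
  by have def_i := vseq_inj lti lt_j1 eq_v; move: par; rewrite def_i /=; case: (odd j).
have def_j : j.+1 = k.*2 by apply/eqP; rewrite eqn_leq ltj.
have i0 : i = 0%N by apply: vseq_inj (leq_ltn_trans (leq0n _) lti) _ => //; rewrite eq_v def_j vseq_period.
have : odd j.+1 by rewrite /= -par i0.
by rewrite def_j odd_double.
Qed.

Definition orb : {set 'I_n} := [set x | fconnect turn x0 x || fconnect turn x0 (al x)].

Lemma al_orb x : x \in orb -> al x \in orb.
Proof. by have [_ _ alK _ _] := Mu; rewrite !inE alK orbC. Qed.

Lemma be_orb x : x \in orb -> be x \in orb.
Proof.
have [_ _ alK _ _] := Mu; have [_ _ beK _ _] := Mw; rewrite !inE => /orP[conn_x|conn_x].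
  pose y := finv turn x; have def_x : turn y = x by rewrite f_finv //; apply: turn_inj.
  have -> : al (be x) = y by rewrite -def_x /turn beK alK.
  suff -> : fconnect turn x0 y by rewrite orbT.
  apply: connect_trans conn_x _; rewrite fconnect_sym; last exact: turn_inj.
  by have := fconnect1 turn y; rewrite def_x.
by rewrite (connect_trans conn_x) //; have := fconnect1 turn (al x); rewrite /turn alK.
Qed.

Lemma orb_vseq x : x \in orb -> exists2 j, (j < k.*2)%N & vseq j = x.
Proof.
have [_ _ alK _ _] := Mu; rewrite inE => /orP[conn_x|conn_x].
  exists (findex turn x0 x).*2; first by rewrite ltn_double findex_max.
  by rewrite vseq_even iter_findex.
exists (findex turn x0 (al x)).*2.+1; last by rewrite vseq_odd iter_findex.
by have := findex_max conn_x; rewrite -/k; clear; lia.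
Qed.

Lemma x0_orb : x0 \in orb.
Proof. by rewrite inE connect0. Qed.

(** Testing one end suffices: if [O] is closed under the matching, both ends of a matching edge are
    in [O] or neither is. *)
Definition part (O : {set 'I_n}) (y : 'X_{1..m}) : 'X_{1..m} :=
  [multinom (if (ends e).1 \in O then y e else 0%N) | e < m].

Lemma vdeg_part (O : {set 'I_n}) (y : 'X_{1..m}) ey ga : is_matching y W ey ga -> (forall x, x \in O -> ga x \in O) ->
  forall x, vdeg (part O y) x = if x \in O then vdeg y x else 0%N.
Proof.
move=> [yP _ gaK _ uniq_y] gaO x.
have both e : y e != 0%N -> ((ends e).1 \in O) = ((ends e).2 \in O).
  move=> ye; have [W1 def_e] := uniq_y e _ _ ye (joins_ends e).
  have [_] := yP _ W1; rewrite -def_e => je.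
  have -> : (ends e).2 = ga (ends e).1.
    case: (joins_cases (joins_ends e) je) => [[]//|[def1 def2]].
    by have := loopless e; rewrite def2 eqxx.
  by apply/idP/idP => [/gaO //|/gaO]; rewrite gaK.
rewrite !wdegE; case: ifPn => xO; [apply: eq_bigr | apply: big1] => e _; rewrite edge_mnmE mnmE.
  have [->|ye] := eqVneq (y e) 0%N; first by rewrite if_same.
  have [def_x|_] := eqVneq (ends e).1 x; first by rewrite def_x xO.
  by have [def_x|_] := eqVneq (ends e).2 x; [rewrite both // def_x xO | rewrite !mul0n].
case: ifPn => eO; last by rewrite muln0.
have [->|ye] := eqVneq (y e) 0%N; first by rewrite muln0.
have [def_x|_] := eqVneq (ends e).1 x; first by rewrite -def_x eO in xO.
by have [def_x|_] := eqVneq (ends e).2 x; [rewrite -def_x -both // eO in xO | rewrite mul0n].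
Qed.

Lemma part_split (O : {set 'I_n}) (y : 'X_{1..m}) : y = (part O y + part (~: O) y)%MM.
Proof. by apply/mnmP => e; rewrite mnmDE !mnmE inE; case: ifP; rewrite ?addn0. Qed.

Hypothesis eq_uw : vdeg u = vdeg w.
Hypothesis irred : forall u1 u2 w1 w2, u = (u1 + u2)%MM -> w = (w1 + w2)%MM ->
  vdeg u1 = vdeg w1 -> vdeg u2 = vdeg w2 -> u1 != 0%MM -> u2 = 0%MM.

(** The cycle and its complement split both monomials compatibly, so [irred] leaves nothing outside
    the cycle. *)
Lemma all_orb e : u e != 0%N \/ w e != 0%N -> (ends e).1 \in orb.
Proof.
have [euP _ alK _ _] := Mu; have [ewP _ beK _ _] := Mw.
have alC x : x \in ~: orb -> al x \in ~: orb.
  by rewrite !in_setC; apply: contra => /al_orb; rewrite alK.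
have beC x : x \in ~: orb -> be x \in ~: orb.
  by rewrite !in_setC; apply: contra => /be_orb; rewrite beK.
have eq2 : vdeg (part (~: orb) u) = vdeg (part (~: orb) w).
  by apply/mnmP => x; rewrite (vdeg_part Mu) // (vdeg_part Mw) // eq_uw.
have u2_0 : part (~: orb) u = 0%MM.
  apply: irred (part_split orb u) (part_split orb w) _ eq2 _.
    by apply/mnmP => x; rewrite (vdeg_part Mu al_orb) (vdeg_part Mw be_orb) eq_uw.
  apply/negP => /eqP/mnmP/(_ (eu x0)); rewrite mnmE mnm0E.
  have [ue je] := euP x0 x0W; have o2 := al_orb x0_orb; have o1 := x0_orb; rewrite ue.
  by case/orP: je => /eqP -> /=; rewrite ?o1 ?o2.
have w2_0 : part (~: orb) w = 0%MM.
  apply/mnmP => f; rewrite mnm0E; have [le _] := leq_vdeg ends (part (~: orb) w) f.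
  apply/eqP; rewrite -leqn0; apply: leq_trans le _.
  by rewrite -eq2 u2_0 wdegE big1 // => g _; rewrite mnm0E muln0.
case=> ye; apply: contraTT isT => eO.
  by have /mnmP/(_ e) := u2_0; rewrite mnmE inE eO mnm0E => ue; rewrite ue eqxx in ye.
by have /mnmP/(_ e) := w2_0; rewrite mnmE inE eO mnm0E => we; rewrite we eqxx in ye.
Qed.

Definition cyc := mkseq eseq k.*2.

Lemma mask_mkseq (P : pred nat) : mask [seq P j | j <- iota 0 (size cyc)] cyc =
  [seq eseq j | j <- iota 0 k.*2 & P j].
Proof. by rewrite size_mkseq /cyc /mkseq -map_mask -filter_mask. Qed.

Lemma cyc_even : even_cycle ends cyc.
Proof.
have sz : size cyc = k.*2 by rewrite size_mkseq.
have ltE j : (j \in iota 0 k.*2) = (j < k.*2)%N by rewrite mem_iota.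
split; rewrite ?sz ?odd_double //.
- by have := k_gt1; clear; lia.
- by rewrite map_inj_in_uniq ?iota_uniq // => i j; rewrite !ltE; apply: eseq_inj.
exists (mkseq vseq k.*2); split; first by rewrite size_mkseq.
  by rewrite map_inj_in_uniq ?iota_uniq // => i j; rewrite !ltE; apply: vseq_inj.
move=> j d dv lt_j; rewrite !nth_mkseq //; last first.
  by rewrite ltn_mod double_gt0 (leq_trans _ k_gt1).
have [lt_j1|ge_j1] := ltnP j.+1 k.*2; first by rewrite modn_small //; apply: eseq_joins.
have def_j : j.+1 = k.*2 by apply/eqP; rewrite eqn_leq lt_j.
by have := eseq_joins j; rewrite def_j modnn vseq_period.
Qed.

Lemma prod_monomial (y : 'X_{1..m}) (s : seq 'I_m) : uniq s ->
  (forall e, e \in s = (y e != 0%N)) -> (forall e, (y e <= 1)%N) ->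
  \prod_(e <- s) 'X_e = 'X_[y] :> {mpoly K[m]}.
Proof.
move=> Us sE y1; rewrite big_uniq // [RHS]mpolyXE_id [LHS]big_mkcond; apply: eq_bigr => e _.
rewrite sE; have := y1 e; case: (y e) => [|[|//]] _ /=; first by rewrite expr0.
by rewrite expr1.
Qed.

Lemma cyc_Bw : Bw K cyc = bin (u, w).
Proof.
have [euP _ alK eu_al uniq_u] := Mu; have [ewP _ beK ew_be uniq_w] := Mw.
have ltE j : (j \in iota 0 k.*2) = (j < k.*2)%N by rewrite mem_iota.
have U P : uniq [seq eseq j | j <- iota 0 k.*2 & P j].
  rewrite map_inj_in_uniq ?filter_uniq ?iota_uniq // => i j; rewrite !mem_filter !ltE.
  by move=> /andP[_ lti] /andP[_ ltj]; apply: eseq_inj.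
have le1 (y : 'X_{1..m}) ey ga : is_matching y W ey ga -> forall e, (y e <= 1)%N.
  move=> [yP _ _ _ uniq_y] e; have [->//|ye] := eqVneq (y e) 0%N.
  by have [W1 ->] := uniq_y e _ _ ye (joins_ends e); have [->] := yP _ W1.
rewrite /Bw /odd_places /even_places !mask_mkseq; congr (_ - _); apply: prod_monomial => //.
- move=> e; apply/mapP/idP => [[j]|ue].
    rewrite mem_filter => /andP[/negPf ev _] ->.
    by have := eseq_mem j; rewrite ev => ->.
  have [W1 def_e] := uniq_u e _ _ ue (joins_ends e).
  have [j ltj def_j] := orb_vseq (all_orb (or_introl ue)); rewrite -def_j in def_e.
  have [oj|ej] := boolP (odd j); last first.
    by exists j; rewrite ?mem_filter ?ej ?ltE // /eseq (negPf ej).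
  (* The vertex is the far end of the edge, which therefore occurs at the preceding index. *)
  case: j oj ltj {def_j} def_e => // j oj ltj def_e.
  exists j; rewrite ?mem_filter ?ltE ?(ltnW ltj) ?andbT //.
  move: oj => /= /negPf ej; rewrite def_e /eseq /= ej eu_al //.
  exact: vseq_in.
- exact: le1 Mu.
- move=> e; apply/mapP/idP => [[j]|we].
    rewrite mem_filter => /andP[od _] ->.
    by have := eseq_mem j; rewrite od => ->.
  have [W1 def_e] := uniq_w e _ _ we (joins_ends e).
  have [j0 ltj0 def_j0] := orb_vseq (all_orb (or_intror we)).
  (* Position 0 is renamed [k.*2], so that a preceding index exists. *)
  have [j le_j def_j] : exists2 j, (0 < j <= k.*2)%N & vseq j = (ends e).1.
    case: j0 ltj0 def_j0 => [|j] ltj def_j; last by exists j.+1 => //=; apply: ltnW.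
    exists k.*2; last by rewrite vseq_period.
    by rewrite leqnn double_gt0 (leq_trans _ k_gt1).
  rewrite -def_j in def_e; have [oj|ej] := boolP (odd j).
    exists j; last by rewrite def_e /eseq oj.
    rewrite mem_filter oj ltE ltn_neqAle; case/andP: le_j => _ ->; rewrite !andbT /=.
    by apply: contraTneq oj => ->; rewrite odd_double.
  case: j ej le_j {def_j} def_e => // j oj ltj def_e; rewrite /= negbK in oj.
  exists j; first by rewrite mem_filter oj ltE.
  by rewrite def_e /eseq /= oj ew_be // vseq_in.
- exact: le1 Mw.
Qed.

End Alternating.
End EvenCycles.

Section CycleGenerators.
Variables (K : fieldType) (n m : nat) (ends : 'I_m -> 'I_n * 'I_n).
Hypothesis loopless : forall i, (ends i).1 != (ends i).2.
Hypothesis simple : forall i j, joins ends i (ends j).1 (ends j).2 -> i = j.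
Local Notation vdeg := (wdeg (edge_mnm ends)).
Variable S : seq ('X_{1..m} * 'X_{1..m}).
Hypothesis gS : generates (map (@bin K m) S) (mono_ideal (edge_mnm ends)).
Hypothesis indS : indep S.

(** Both parts of a splitting lie in the span of the generators of degree below that of [q], and
    then so does [q]. *)
Lemma indep_irreducible q (u1 u2 w1 w2 : 'X_{1..m}) : q \in S ->
  q.1 = (u1 + u2)%MM -> q.2 = (w1 + w2)%MM -> vdeg u1 = vdeg w1 -> vdeg u2 = vdeg w2 ->
  u1 != 0%MM -> u2 = 0%MM.
Proof.
move=> qS def_u def_w eq1 eq2 u1_neq0; apply/eqP/negPn/negP => u2_neq0.
pose low (y : 'X_{1..m}) := (mdeg y < mdeg q.1)%N.
have lowE u w : vdeg u = vdeg w -> low u = low w.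
  by move=> eq_uw; rewrite /low (wdeg_mdeg (mdeg_edge ends) eq_uw).
have lowD u w : low (u + w)%MM -> low w.
  by rewrite /low mdegD; apply: leq_ltn_trans; apply: leq_addl.
have span u w := @generates_span K m n (edge_mnm ends) S low u w gS lowE lowD.
case: (indS.2 q [seq p <- S | low p.1] qS) => [p||x x0].
- by rewrite mem_filter => /andP[].
- by rewrite mem_filter /low ltnn.
have pv_q : pv q = pv (u1, w1) + pv (u2, w2).
  by rewrite /pv def_u def_w !mvecD opprD addrACA.
have lt1 : low u1 by rewrite /low def_u mdegD -[X in (X < _)%N]addn0 ltn_add2l lt0n mdeg_eq0.
have lt2 : low u2 by rewrite /low def_u mdegD -[X in (X < _)%N]add0n ltn_add2r lt0n mdeg_eq0.
by rewrite pv_q mulmxDl (span _ _ eq1 lt1 x x0) (span _ _ eq2 lt2 x x0) addr0.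
Qed.

Lemma indep_neq q : q \in S -> q.1 <> q.2.
Proof.
move=> qS eq_q; case: (indS.2 q [::] qS) => // x _.
by rewrite /pv eq_q subrr mul0mx.
Qed.

Lemma cycle_generator q : q \in S -> (forall x, (vdeg q.1 x <= 1)%N) ->
  exists c, even_cycle ends c /\ bin q = Bw K c.
Proof.
case: q => u w qS /= le1; have neq_uw := indep_neq qS; have eq_uw := S_wdeg gS qS.
rewrite /= in neq_uw eq_uw; pose W := [set x | vdeg u x == 1%N].
have deg_u x : vdeg u x = (x \in W) by rewrite inE; have := le1 x; case: (vdeg u x) => [|[]].
have deg_w x : vdeg w x = (x \in W) by rewrite -eq_uw deg_u.
have eq_mdeg := wdeg_mdeg (mdeg_edge ends) eq_uw.
have [e0 ue0] : exists e, u e != 0%N.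
  have [/existsP //|] := boolP [exists e, u e != 0%N]; rewrite negb_exists => /forallP u0.
  case: neq_uw.
  have {}u0 : u = 0%MM by apply/mnmP => e; apply/eqP; rewrite mnm0E; have := u0 e; rewrite negbK.
  by apply/esym/eqP; rewrite u0 -mdeg_eq0 -eq_mdeg u0 mdeg0.
have [eu [al Mu]] := matching_exists loopless e0 deg_u.
have [ew [be Mw]] := matching_exists loopless e0 deg_w.
have irred u1 u2 w1 w2 : u = (u1 + u2)%MM -> w = (w1 + w2)%MM ->
    vdeg u1 = vdeg w1 -> vdeg u2 = vdeg w2 -> u1 != 0%MM -> u2 = 0%MM := indep_irreducible qS.
(* A common edge would split off as a trivial pair. *)
have disj e : u e != 0%N -> w e != 0%N -> False.
  rewrite -!lep1mP => /submK def_u /submK def_w.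
  have eq_sub : vdeg (u - U_(e))%MM = vdeg (w - U_(e))%MM.
    by apply: (@addIm _ (vdeg U_(e)%MM)); rewrite -!wdegD def_u def_w.
  have u0 : (u - U_(e))%MM = 0%MM.
    apply: (irred U_(e)%MM _ U_(e)%MM) eq_sub _; rewrite ?mnm1_eq0 //.
      by rewrite addmC def_u.
    by rewrite addmC def_w.
  have w0 : (w - U_(e))%MM = 0%MM.
    by apply/eqP; rewrite -mdeg_eq0 -(wdeg_mdeg (mdeg_edge ends) eq_sub) u0 mdeg0.
  by apply: neq_uw; rewrite -def_u -def_w u0 w0.
have x0W : (ends e0).1 \in W.
  by have [_ _ _ _ /(_ _ _ _ ue0 (joins_ends _ e0))[]] := Mu.
exists (cyc eu ew al be (ends e0).1); split.
  exact: (cyc_even simple Mu Mw disj x0W).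
by rewrite (cyc_Bw K loopless simple Mu Mw disj x0W eq_uw irred).
Qed.

End CycleGenerators.

(** * Induced subgraphs and blocks *)

Section InducedSubgraph.
Variables (K : fieldType) (n m : nat) (ends : 'I_m -> 'I_n * 'I_n) (V : {set 'I_n}).
Local Notation vdeg := (wdeg (edge_mnm ends)).
Local Notation Es := (ein ends V).
Local Notation sub := (sub_ends ends Es).
Local Notation sdeg := (wdeg (edge_mnm sub)).
Local Notation insupp := (insupp ends).
Local Notation bins := (map (@bin _ _)).
Implicit Types (u w : 'X_{1..m}) (y z : 'X_{1..#|Es|}) (q : 'X_{1..m} * 'X_{1..m})
  (S : seq ('X_{1..m} * 'X_{1..m})).

Definition pull u : 'X_{1..#|Es|} := [multinom u (enum_val j) | j < #|Es|].
Definition push y : 'X_{1..m} := wdeg (fun j : 'I_#|Es| => U_(enum_val j)%MM) y.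
Definition pullq q := (pull q.1, pull q.2).

Lemma push_val y j : push y (enum_val j) = y j.
Proof.
rewrite wdegE (bigD1 j) //= mnm1E eqxx mul1n big1 ?addn0 // => i /negPf neq_ij.
by rewrite mnm1E (inj_eq enum_val_inj) neq_ij.
Qed.

Lemma push_out y e : e \notin Es -> push y e = 0%N.
Proof.
move=> eE; rewrite wdegE big1 // => j _; rewrite mnm1E.
by case: eqP => // def_e; rewrite -def_e enum_valP in eE.
Qed.

Lemma pullK u : insupp V u -> push (pull u) = u.
Proof.
move/insuppP => uV; apply/mnmP => e; have [eE|eE] := boolP (e \in Es).
  by rewrite -(enum_rankK_in eE eE) push_val mnmE.
by rewrite push_out //; apply/esym/eqP; apply: contraR eE; apply: uV.
Qed.

Lemma pushK y : pull (push y) = y.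
Proof. by apply/mnmP => j; rewrite mnmE push_val. Qed.

Lemma push_in y : insupp V (push y).
Proof. by apply/insuppP => e; apply: contraR => /push_out ->. Qed.

Lemma vdeg_push y : vdeg (push y) = sdeg y.
Proof.
apply/mnmP => x; rewrite !wdegE.
rewrite (bigID (mem Es)) /= [X in (_ + X)%N]big1 ?addn0 => [|e eE]; last by rewrite push_out ?muln0.
by rewrite big_enum_val; apply: eq_bigr => j _; rewrite push_val.
Qed.

Lemma sdeg_pull u : insupp V u -> sdeg (pull u) = vdeg u.
Proof. by move/pullK => {2}<-; rewrite vdeg_push. Qed.

Definition iota_mp (p : {mpoly K[#|Es|]}) : {mpoly K[m]} :=
  p \mPo [tuple 'X_(enum_val j) | j < #|Es|].

(** The inner sum is the variable of [e], or the empty sum 0 when [e] lies outside the subgraph. *)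
Definition rho_mp (p : {mpoly K[m]}) : {mpoly K[#|Es|]} :=
  p \mPo [tuple \sum_(j | enum_val j == e) 'X_j | e < m].

Lemma iota_bin y z : iota_mp (bin (y, z)) = bin (push y, push z).
Proof. by rewrite /iota_mp /bin raddfB /= !comp_monoX. Qed.

Lemma rhoX u : insupp V u -> rho_mp 'X_[u] = 'X_[pull u].
Proof.
move/insuppP => uV; rewrite /rho_mp comp_mpolyX [RHS]mpolyXE_id.
rewrite (bigID (mem Es)) /= [X in _ * X]big1 ?mulr1 => [|e eE]; last first.
  by have [->|/uV eV] := eqVneq (u e) 0%N; [rewrite expr0 | rewrite eV in eE].
rewrite big_enum_val; apply: eq_bigr => j _; rewrite tnth_mktuple mnmE; congr (_ ^+ _).
by rewrite (bigD1 j) //= big1 ?addr0 // => i /andP[/eqP/enum_val_inj -> /eqP].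
Qed.

Lemma rho_bin q : insupp V q.1 -> vdeg q.1 = vdeg q.2 -> rho_mp (bin q) = bin (pullq q).
Proof.
move=> Vq eq_q; have Vq2 : insupp V q.2 by rewrite -(insupp_wdeg _ eq_q).
by rewrite /bin /rho_mp raddfB /= -!/(rho_mp _) !rhoX.
Qed.

Definition inner S := [seq q <- S | insupp V q.1].

Lemma pull_generates S : generates (bins S) (@mono_ideal K _ _ (edge_mnm ends)) ->
  generates (bins (map pullq (inner S))) (@mono_ideal K _ _ (edge_mnm sub)).
Proof.
move=> gS; have [idI _ _] := @mono_ideal_prime K _ _ (edge_mnm ends).
have [idB _ _] := @mono_ideal_prime K _ _ (edge_mnm sub).
have [_ IS] := (generatesP _ idI).1 gS; apply/generatesP => //; split.
  move=> _ /mapP[_ /mapP[q + ->] ->]; rewrite mem_filter => /andP[Vq qS].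
  have eq_q := S_wdeg gS qS; apply/mono_ideal_bin; rewrite !sdeg_pull //.
  by rewrite -(insupp_wdeg _ eq_q).
move=> p; apply: mono_ideal_ind => [|y z eq_yz]; first exact: in_ideal_is_ideal.
have Ipush : mono_ideal (edge_mnm ends) (bin (push y, push z) : {mpoly K[m]}).
  by apply/mono_ideal_bin; rewrite !vdeg_push.
have suppV u : u \in msupp (bin (push y, push z) : {mpoly K[m]}) -> insupp V u.
  by case/msupp_bin => ->; apply: push_in.
have [c def_c] := face_ideal (fun q => S_wdeg gS (q := q)) suppV (IS _ Ipush).
have := congr1 rho_mp def_c; rewrite rho_bin ?push_in ?vdeg_push // /pullq !pushK => ->.
rewrite /rho_mp raddf_sum; apply: ideal_sum => [|i _]; first exact: in_ideal_is_ideal.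
rewrite /= rmorphM /=; have [_ _] := in_ideal_is_ideal (bins (map pullq (inner S)) : seq {mpoly K[_]}); apply.
have lti : (i < size (inner S))%N by rewrite -(size_map (@bin K m)).
rewrite (nth_map (0%MM, 0%MM)) //=; set q := nth _ _ i.
have : q \in inner S by apply: mem_nth.
rewrite mem_filter => /andP[Vq qS]; rewrite -/(rho_mp _) rho_bin ?(S_wdeg gS qS) //.
by apply/mem_in_ideal/map_f/map_f; rewrite mem_filter Vq.
Qed.

Lemma pullq_inj S q q' : (forall q, q \in S -> vdeg q.1 = vdeg q.2) ->
  q \in inner S -> q' \in inner S -> pullq q = pullq q' -> q = q'.
Proof.
move=> S_L; rewrite !mem_filter => /andP[Vq qS] /andP[Vq' q'S] eq_qq.
have eq1 : pull q.1 = pull q'.1 := congr1 fst eq_qq.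
have eq2 : pull q.2 = pull q'.2 := congr1 snd eq_qq.
have [Vq2 Vq'2] : insupp V q.2 /\ insupp V q'.2 by rewrite -!(insupp_wdeg _ (S_L _ _)).
by rewrite [q]surjective_pairing [q']surjective_pairing -(pullK Vq) -(pullK Vq2) eq1 eq2 !pullK.
Qed.

Lemma pull_irredundant S : (forall q, q \in S -> vdeg q.1 = vdeg q.2) -> uniq S ->
  irredundant K S -> irredundant K (map pullq (inner S)).
Proof.
move=> S_L US irrS _ /mapP[q qI ->] [c def_c].
have qS : q \in S by move: qI; rewrite mem_filter => /andP[].
have pushq p : p \in inner S -> (push (pullq p).1, push (pullq p).2) = p.
  rewrite mem_filter => /andP[Vp pS]; rewrite /= !pullK -?surjective_pairing //.
  by rewrite -(insupp_wdeg _ (S_L p pS)).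
apply: (irrS q qS); have := congr1 iota_mp def_c; rewrite iota_bin pushq // => ->.
rewrite /iota_mp raddf_sum; apply: ideal_sum => [|i _]; first exact: in_ideal_is_ideal.
rewrite /= rmorphM /=; have [_ _] := in_ideal_is_ideal (bins (rem q S) : seq {mpoly K[m]}); apply.
move: (mem_nth 0 (ltn_ord i)); case/mapP => p' p'R ->.
have UI : uniq (map pullq (inner S)).
  rewrite map_inj_in_uniq ?filter_uniq // => p1 p2 p1I p2I; exact: (pullq_inj S_L).
move: p'R; rewrite mem_rem_uniq // => /andP[neq_p' /mapP[p pI def_p']].
rewrite def_p' -/(iota_mp _) iota_bin pushq //; apply/mem_in_ideal/map_f.
rewrite mem_rem_uniq // inE; move: pI; rewrite mem_filter => /andP[_ ->]; rewrite andbT.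
by apply: contraNneq neq_p' => <-; rewrite def_p'.
Qed.

(** The column extends the functional [x] by zero to the edges outside the subgraph. *)
Lemma pv_push q (x : 'cV[rat]_#|Es|) : insupp V q.1 -> vdeg q.1 = vdeg q.2 ->
  pv q *m (\col_e \sum_(j | enum_val j == e) x j 0) = pv (pullq q) *m x.
Proof.
move=> Vq eq_q; apply/rowP => i; rewrite !mxE ord1.
rewrite (bigID (mem Es)) /= [X in _ + X]big1 ?addr0 => [|e eE]; last first.
  rewrite mxE (_ : pv q 0 e = 0) ?mul0r //; apply/eqP; apply: contraR eE.
  exact: pv_ein.
rewrite big_enum_val; apply: eq_bigr => j _; rewrite !mxE !mnmE; congr (_ * _).
by rewrite (bigD1 j) //= big1 ?addr0 // => i' /andP[/eqP/enum_val_inj -> /eqP].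
Qed.

Lemma pv_pull q (x : 'cV[rat]_m) : insupp V q.1 -> vdeg q.1 = vdeg q.2 ->
  pv (pullq q) *m (\col_j x (enum_val j) 0) = pv q *m x.
Proof.
move=> Vq eq_q; apply/rowP => i; rewrite !mxE ord1.
rewrite [RHS](bigID (mem Es)) /= [X in _ + X]big1 ?addr0 => [|e eE]; last first.
  rewrite (_ : pv q 0 e = 0) ?mul0r //; apply/eqP; apply: contraR eE.
  exact: pv_ein.
by rewrite [RHS]big_enum_val; apply: eq_bigr => j _; rewrite !mxE !mnmE.
Qed.

Lemma indep_pull S : (forall q, q \in S -> vdeg q.1 = vdeg q.2) ->
  indep (inner S) <-> indep (map pullq (inner S)).
Proof.
move=> S_L; have inP q : q \in inner S -> insupp V q.1 /\ vdeg q.1 = vdeg q.2.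
  by rewrite mem_filter => /andP[-> /S_L].
have inj q q' := @pullq_inj S q q' S_L.
split=> -[Uin ind].
  split=> [|_ S' /mapP[q qI ->] subS' qS' span_q]; first by rewrite map_inj_in_uniq // => p p'; apply: inj.
  pose S'' := [seq p <- inner S | pullq p \in S'].
  case: (ind q S'' qI) => [p||x x0]; first by rewrite mem_filter => /andP[].
    by rewrite mem_filter negb_and qS'.
  have [Vq eq_q] := inP q qI; rewrite -pv_pull //; apply: span_q => p' p'S'.
  have /mapP[p pI def_p'] := subS' p' p'S'; rewrite def_p'; have [Vp eq_p] := inP p pI.
  by rewrite pv_pull // x0 // mem_filter -def_p' p'S'.
split=> [|q S' qI subS' qS' span_q]; first exact: map_uniq Uin.
case: (ind (pullq q) (map pullq S')); first exact: map_f.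
- by move=> _ /mapP[p pS' ->]; apply/map_f/subS'.
- by apply/mapP => -[p pS' eq_pq]; case/negP: qS'; rewrite (inj q p) // subS'.
move=> x x0; have [Vq eq_q] := inP q qI; rewrite -pv_push //; apply: span_q => p pS'.
have [Vp eq_p] := inP p (subS' p pS'); rewrite pv_push // x0 //.
exact: map_f.
Qed.

End InducedSubgraph.

(** * Blocks of a graph *)

Section Blocks.
Variables (n m : nat) (ends : 'I_m -> 'I_n * 'I_n).
Hypothesis loopless : forall i, (ends i).1 != (ends i).2.
Local Notation ein := (ein ends).
Implicit Types (Vs V : {set 'I_n}) (Es E : {set 'I_m}) (x y v : 'I_n) (e : 'I_m).

Lemma sub_connectedS Vs Es Es' : Es \subset Es' ->
  sub_connected ends Vs Es -> sub_connected ends Vs Es'.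
Proof.
move=> sE conn x y xV yV; apply: connect_sub (conn x y xV yV) => a b.
case/and3P=> aV bV /existsP[i /andP[iE ji]]; apply: connect1; apply/and3P; split=> //.
by apply/existsP; exists i; rewrite (subsetP sE).
Qed.

Lemma sub_connected_union V1 V2 E1 E2 z : z \in V1 -> z \in V2 ->
  sub_connected ends V1 E1 -> sub_connected ends V2 E2 ->
  sub_connected ends (V1 :|: V2) (E1 :|: E2).
Proof.
move=> z1 z2 conn1 conn2.
have lift (V : {set 'I_n}) (E : {set 'I_m}) x y : V \subset V1 :|: V2 -> E \subset E1 :|: E2 ->
    connect (adj_in ends V E) x y -> connect (adj_in ends (V1 :|: V2) (E1 :|: E2)) x y.
  move=> sV sE; apply: connect_sub => a b /and3P[aV bV /existsP[i /andP[iE ji]]].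
  apply/connect1/and3P; split; rewrite ?(subsetP sV) //.
  by apply/existsP; exists i; rewrite (subsetP sE).
have to_z x : x \in V1 :|: V2 -> connect (adj_in ends (V1 :|: V2) (E1 :|: E2)) x z.
  rewrite inE => /orP[xV|xV].
    by apply: lift (conn1 x z xV z1); rewrite subsetUl.
  by apply: lift (conn2 x z xV z2); rewrite subsetUr.
have sym : connect_sym (adj_in ends (V1 :|: V2) (E1 :|: E2)) by apply/sym_connect_sym/adj_inC.
move=> x y xV yV; apply: connect_trans (to_z x xV) _.
by rewrite sym; apply: to_z.
Qed.

Lemma biconnected_extend Vs Es : biconnected ends Vs Es ->
  exists Vs' Es', [/\ is_block ends Vs' Es', Vs \subset Vs' & Es \subset Es'].
Proof.
have [k] := ubnP (n + m - (#|Vs| + #|Es|)); elim: k Vs Es => // k IHk Vs Es lt_k bi.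
have [blk|nblk] := classic (is_block ends Vs Es); first by exists Vs, Es.
have [Vs' [Es' [bi' sV sE neq]]] : exists Vs' Es', [/\ biconnected ends Vs' Es',
    Vs \subset Vs', Es \subset Es' & ~ (Vs' = Vs /\ Es' = Es)].
  apply: NNPP => none; apply: nblk; split=> // Vs' Es' bi' sV sE.
  by apply: NNPP => neq; apply: none; exists Vs', Es'.
have [|Vs2 [Es2 [blk2 sV2 sE2]]] := IHk Vs' Es' _ bi'; last first.
  by exists Vs2, Es2; split; rewrite // ?(subset_trans sV) ?(subset_trans sE).
have le_V := subset_leq_card sV; have le_E := subset_leq_card sE.
have V_max : (#|Vs'| <= n)%N by rewrite -[X in (_ <= X)%N](card_ord n) max_card.
have E_max : (#|Es'| <= m)%N by rewrite -[X in (_ <= X)%N](card_ord m) max_card.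
have lt_card : (#|Vs| + #|Es| < #|Vs'| + #|Es'|)%N.
  rewrite ltnNge; apply/negP => le_card; apply: neq; split; apply/esym/eqP.
    rewrite eqEcard sV; move: le_card le_E; clear; lia.
  by rewrite eqEcard sE; move: le_card le_V; clear; lia.
by move: lt_k lt_card V_max E_max; clear; lia.
Qed.

(** Adding edges between its vertices keeps a subgraph biconnected, so a maximal one has them
    all. *)
Lemma block_induced Vs Es : is_block ends Vs Es -> Es = ein Vs.
Proof.
move=> [[sub V0 conn conn_del] maxB].
have sE : Es \subset ein Vs by apply/subsetP => e /sub; rewrite inE.
have [|_ -> //] := maxB Vs (ein Vs) _ (subxx _) sE.
split=> // [e||v vV]; first by rewrite inE.
  exact: sub_connectedS sE conn.
apply: sub_connectedS (conn_del v vV); apply/subsetP => e; rewrite !inE => /andP[/sub -> ->].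
by [].
Qed.

Lemma del_vertex_connected Vs Es v : biconnected ends Vs Es ->
  sub_connected ends (Vs :\ v) [set i in Es | ((ends i).1 != v) && ((ends i).2 != v)].
Proof.
move=> [sub _ conn conn_del]; have [vV|vV] := boolP (v \in Vs); first exact: conn_del.
have -> : Vs :\ v = Vs by apply/setP => x; rewrite !inE andb_idl //; apply: contraTneq => ->.
apply: sub_connectedS conn; apply/subsetP => i iE; rewrite inE iE /=.
by case/andP: (sub i iE) => i1 i2; apply/andP; split; apply: contraNneq vV => <-.
Qed.

(** Deleting one vertex spares [x] or [y], which still links both parts. *)
Lemma biconnected_union V1 V2 E1 E2 x y : x != y ->
  x \in V1 -> x \in V2 -> y \in V1 -> y \in V2 ->
  biconnected ends V1 E1 -> biconnected ends V2 E2 ->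
  biconnected ends (V1 :|: V2) (E1 :|: E2).
Proof.
move=> neq_xy x1 x2 y1 y2 bi1 bi2; have [sub1 _ conn1 _] := bi1; have [sub2 _ conn2 _] := bi2.
split.
- move=> i; rewrite inE => /orP[/sub1|/sub2] /andP[i1 i2]; rewrite !inE i1 i2 ?orbT //.
- by apply/set0Pn; exists x; rewrite inE x1.
- exact: sub_connected_union x1 x2 conn1 conn2.
move=> v _ /=.
have -> : (V1 :|: V2) :\ v = (V1 :\ v) :|: (V2 :\ v) by rewrite setDUl.
have -> : [set i in E1 :|: E2 | ((ends i).1 != v) && ((ends i).2 != v)] =
   [set i in E1 | ((ends i).1 != v) && ((ends i).2 != v)] :|:
   [set i in E2 | ((ends i).1 != v) && ((ends i).2 != v)].
  by apply/setP => i; rewrite !inE andb_orl.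
have del1 := del_vertex_connected (v := v) bi1; have del2 := del_vertex_connected (v := v) bi2.
have [eq_xv|neq_xv] := eqVneq x v; last by apply: (sub_connected_union (z := x)) => //; rewrite !inE neq_xv.
by apply: (sub_connected_union (z := y)) => //; rewrite !inE -eq_xv eq_sym neq_xy.
Qed.

Lemma block_unique V1 V2 E1 E2 e : is_block ends V1 E1 -> is_block ends V2 E2 ->
  e \in ein V1 -> e \in ein V2 -> V1 = V2.
Proof.
move=> [bi1 max1] [bi2 max2]; rewrite !inE => /andP[x1 y1] /andP[x2 y2].
have biU := biconnected_union (loopless e) x1 x2 y1 y2 bi1 bi2.
have [eq1 _] := max1 _ _ biU (subsetUl _ _) (subsetUl _ _).
have [eq2 _] := max2 _ _ biU (subsetUr _ _) (subsetUr _ _).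
exact: etrans (esym eq1) eq2.
Qed.

Lemma edge_in_block e : exists Vs, is_block ends Vs (ein Vs) /\ e \in ein Vs.
Proof.
have [|Vs [Es [blk sV sE]]] := @biconnected_extend [set (ends e).1; (ends e).2] [set e].
  have conn_sub : sub_connected ends [set (ends e).1; (ends e).2] [set e].
    have sym := @sym_connect_sym _ _ (adj_inC ends [set (ends e).1; (ends e).2] [set e]).
    have c12 : connect (adj_in ends [set (ends e).1; (ends e).2] [set e]) (ends e).1 (ends e).2.
      apply/connect1/and3P; split; rewrite ?inE ?eqxx ?orbT //.
      by apply/existsP; exists e; rewrite inE eqxx joins_ends.
    by move=> x y; rewrite !inE => /orP[] /eqP -> /orP[] /eqP -> //; rewrite sym.
  split=> //.
  - by move=> i; rewrite inE => /eqP ->; rewrite !inE !eqxx orbT.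
  - by apply/set0Pn; exists (ends e).1; rewrite !inE eqxx.
  move=> v; rewrite !inE => vV x y; rewrite !inE => /andP[nx xV] /andP[ny yV].
  suff -> : x = y by apply: connect0.
  by case/orP: vV nx ny => /eqP ->; case/orP: xV => /eqP ->; case/orP: yV => /eqP ->; rewrite ?eqxx.
have defE := block_induced blk; exists Vs; rewrite -defE; split=> //.
by rewrite (subsetP sE) ?inE.
Qed.

(** A cycle is biconnected, hence extends to a block. Its positions are read modulo the length. *)
Lemma cycle_in_block c : even_cycle ends c ->
  exists2 Vs, is_block ends Vs (ein Vs) & forall e, e \in c -> e \in ein Vs.
Proof.
move=> [_ size_c Uc [vs [size_vs Uvs joins_vs]]].
set L := size c in size_c size_vs joins_vs; have L_gt0 : (0 < L)%N by apply: leq_trans size_c.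
have [d _] : exists d : 'I_m, True by case: c @L size_c {Uc size_vs joins_vs L_gt0} => // d; exists d.
have [dv _] : exists dv : 'I_n, True by exists (ends d).1.
pose x j := nth dv vs (j %% L); pose g j := nth d c (j %% L).
have ltm j : (j %% L < L)%N by rewrite ltn_mod.
have xg j : joins ends (g j) (x j) (x j.+1).
  have := joins_vs (j %% L)%N d dv (ltm j).
  by rewrite /x /g -[in X in _ -> joins _ _ _ (nth _ _ X)](addn1 j) -modnDml addn1.
have x_mem j : x j \in vs by rewrite mem_nth // size_vs.
have g_mem j : g j \in c by rewrite mem_nth.
have x_inj i j : x i = x j -> (i = j %[mod L])%N.
  by move/eqP; rewrite nth_uniq ?size_vs // => /eqP.
have x_all y : y \in vs -> exists j, y = x j.
  by move=> yvs; exists (index y vs); rewrite /x modn_small -?size_vs ?index_mem // nth_index.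
have g_all e : e \in c -> exists j, e = g j.
  by move=> ec; exists (index e c); rewrite /g modn_small ?index_mem // nth_index.
pose Vs := [set y in vs]; pose Es := [set e in c].
have [|Vs' [Es' [blk sV sE]]] := @biconnected_extend Vs Es.
  split.
  - move=> e; rewrite inE => /g_all[j ->]; have := xg j; have := x_mem j; have := x_mem j.+1.
    by rewrite !inE => m1 m2 /orP[] /eqP -> /=; rewrite m1 m2.
  - by apply/set0Pn; exists (x 0); rewrite inE x_mem.
  - have sym := @sym_connect_sym _ _ (adj_inC ends Vs Es).
    have c0 j : connect (adj_in ends Vs Es) (x 0) (x j).
      elim: j => [|j IHj]; first exact: connect0.
      apply: connect_trans IHj (connect1 _); apply/and3P; split; rewrite ?inE ?x_mem //.
      by apply/existsP; exists (g j); rewrite inE g_mem xg.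
    move=> y z; rewrite !inE => /x_all[i ->] /x_all[j ->].
    by apply: connect_trans (c0 j); rewrite sym.
  move=> v; rewrite inE => /x_all[i ->] /=.
  set V' := Vs :\ x i; set E' := [set e in Es | _].
  have sym := @sym_connect_sym _ _ (adj_inC ends V' E').
  (* Deleting [x i] leaves a path, whose vertices are the [x (i + t.+1)] with [t < L.-1]. *)
  have neq_t t : (t < L.-1)%N -> x (i + t.+1) != x i.
    move=> lt_t; apply/eqP => /x_inj/eqP; rewrite -[X in _ == X %[mod _]]addn0 eqn_modDl mod0n.
    by rewrite modn_small //; move: lt_t L_gt0; clear; lia.
  have ci t : (t < L.-1)%N -> connect (adj_in ends V' E') (x (i + 1)) (x (i + t.+1)).
    elim: t => [|t IHt] lt_t; first exact: connect0.
    apply: connect_trans (IHt (ltnW lt_t)) (connect1 _).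
    have n1 := neq_t t (ltnW lt_t); have n2 := neq_t t.+1 lt_t.
    apply/and3P; split; rewrite ?inE ?n1 ?n2 ?x_mem //.
    apply/existsP; exists (g (i + t.+1)); have jg := xg (i + t.+1)%N; rewrite -addnS in jg.
    rewrite jg andbT !inE g_mem /=; case/orP: jg => /eqP ->; rewrite /= ?n1 ?n2 //.
  have all_t y : y \in V' -> exists2 t, (t < L.-1)%N & y = x (i + t.+1).
    rewrite !inE => /andP[neq_y /x_all[j def_y]]; rewrite {}def_y in neq_y *.
    have [r [r_gt0 lt_r eq_r]] : exists r, [/\ (0 < r)%N, (r < L)%N & ((i + r) %% L = j %% L)%N].
      have lti := ltm i; have ltj := ltm j.
      have neq_ij : (i %% L != j %% L)%N by apply: contraNneq neq_y; rewrite /x => ->.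
      have [lt_ij|] := ltnP (i %% L) (j %% L).
        exists (j %% L - i %% L)%N; rewrite subn_gt0 lt_ij -modnDml (subnKC (ltnW lt_ij)) modn_mod.
        by split=> //; exact: leq_ltn_trans (leq_subr (i %% L) (j %% L)) ltj.
      rewrite leq_eqVlt eq_sym (negPf neq_ij) /= => lt_ji.
      exists (L - i %% L + j %% L)%N; rewrite -modnDml addnA (subnKC (ltnW lti)) modnDl modn_mod.
      by split=> //; move: lti lt_ji; clear; lia.
    case: r r_gt0 lt_r eq_r => // r _ lt_r eq_r; exists r.
      by move: lt_r; clear; lia.
    by rewrite /x eq_r.
  move=> y z /all_t[s lts ->] /all_t[t ltt ->].
  by apply: connect_trans (ci t ltt); rewrite sym; apply: ci.
have defE := block_induced blk; exists Vs'; rewrite -?defE // => e ec.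
by rewrite (subsetP sE) ?inE.
Qed.

End Blocks.

(** * Gluing independence over blocks *)

Section BlockDecomposition.
Variables (K : fieldType) (n m : nat) (ends : 'I_m -> 'I_n * 'I_n).
Hypothesis loopless : forall i, (ends i).1 != (ends i).2.
Local Notation vdeg := (wdeg (edge_mnm ends)).
Local Notation I := (@mono_ideal K m n (edge_mnm ends)).
Local Notation bins S := (map (@bin K m) S).
Local Notation ein := (ein ends).
Local Notation insupp := (insupp ends).
Implicit Types (S : seq ('X_{1..m} * 'X_{1..m})) (q : 'X_{1..m} * 'X_{1..m}) (V : {set 'I_n}).

Lemma block_indep S V : uniq S -> irredundant K S -> generates (bins S) I ->
  complete_intersection (@mono_ideal K _ _ (edge_mnm (sub_ends ends (ein V)))) ->
  indep (inner ends V S).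
Proof.
move=> US irrS gS ciV; have S_L q := @S_wdeg K n m ends S gS q.
apply/(indep_pull V S_L); apply: (complete_intersection_indep (mdeg_edge _) ciV).
- rewrite map_inj_in_uniq ?filter_uniq // => p1 p2; exact: (pullq_inj S_L).
- exact: pull_irredundant.
- exact: pull_generates.
Qed.

Lemma prod_vars (s : seq 'I_m) :
  exists2 u : 'X_{1..m}, \prod_(e <- s) 'X_e = 'X_[u] :> {mpoly K[m]} & forall e, u e != 0%N -> e \in s.
Proof.
elim: s => [|e s [u def_u u_s]]; first by exists 0%MM => [|e]; rewrite ?big_nil ?mpolyX0 // mnm0E.
exists (U_(e) + u)%MM => [|x]; first by rewrite big_cons def_u mpolyXD.
by rewrite mnmDE mnm1E inE [e == x]eq_sym; have [//|_] := eqVneq x e; apply: u_s.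
Qed.

Lemma Bw_support q c V : q.1 <> q.2 -> bin q = Bw K c -> (forall e, e \in c -> e \in ein V) ->
  insupp V q.1.
Proof.
move=> /eqP neq_q def_q cV; apply/insuppP => e qe; apply: cV.
have [u def_u u_s] := prod_vars (odd_places c); have [w def_w w_s] := prod_vars (even_places c).
have : q.1 \in msupp (bin (u, w) : {mpoly K[m]}).
  rewrite /bin /= -def_u -def_w -/(Bw K c) -def_q /bin mcoeff_msupp mcoeffB !mcoeffX eqxx.
  by rewrite [q.2 == _]eq_sym (negPf neq_q) subr0 oner_eq0.
by case/msupp_bin => def_e; rewrite def_e in qe; apply: mem_mask; [apply: u_s qe | apply: w_s qe].
Qed.

Variable B : 'I_m -> {set 'I_n}.
Hypothesis B_block : forall e, is_block ends (B e) (ein (B e)).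
Hypothesis B_mem : forall e, e \in ein (B e).

Definition in_block q := [exists e, insupp (B e) q.1].

Lemma B_disjoint e e' e1 : e1 \in ein (B e) -> e1 \in ein (B e') -> B e = B e'.
Proof. exact: (block_unique loopless). Qed.

Variable S : seq ('X_{1..m} * 'X_{1..m}).
Hypotheses (US : uniq S) (gS : generates (bins S) I) (irrS : irredundant K S).
Hypothesis indB : forall e, indep (inner ends (B e) S).
Local Notation Sreg := [seq q <- S | in_block q].

(** Blocks share no edges, so truncating a functional to one block keeps its values on the
    generators of that block and kills those of other blocks. *)
Lemma pv_restrict q e (x : 'cV[rat]_m) : q \in S -> in_block q ->
  pv q *m (\col_e' if e' \in ein (B e) then x e' 0 else 0) =
  if insupp (B e) q.1 then pv q *m x else 0.
Proof.
move=> qS /existsP[e0 q0]; have eq_q := S_wdeg gS qS.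
case: ifPn => [qe|qe]; apply/rowP => i; rewrite !mxE.
  apply: eq_bigr => e1 _; rewrite [X in _ * X]mxE ord1.
  have [->|/(pv_ein eq_q qe) ->//] := eqVneq (pv q 0 e1) 0.
  by rewrite !mul0r.
apply: big1 => e1 _; rewrite [X in _ * X]mxE.
have [->|] := eqVneq (pv q 0 e1) 0; first by rewrite mul0r.
move/(pv_ein eq_q q0) => e1_0; case: ifP => [e1_e|]; last by rewrite mulr0.
by rewrite (B_disjoint e1_e e1_0) q0 in qe.
Qed.

Lemma in_block_indep : indep Sreg.
Proof.
split=> [|q S' + subS' qS' span_q]; first exact: filter_uniq.
rewrite mem_filter => /andP[rq qS]; have /existsP[e qe] := rq.
case: ((indB e).2 q [seq p <- S' | insupp (B e) p.1]).
- by rewrite mem_filter qe.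
- move=> p; rewrite !mem_filter => /andP[-> /subS'].
  by rewrite mem_filter => /andP[].
- by rewrite mem_filter negb_and qS' orbT.
move=> x x0; have := pv_restrict e x qS rq; rewrite qe => <-; apply: span_q => p pS'.
have := subS' p pS'; rewrite mem_filter => /andP[rp pS]; rewrite pv_restrict //.
by case: ifP => // pe; apply: x0; rewrite mem_filter pe.
Qed.

Let res V (u : 'X_{1..m}) : 'X_{1..m} := [multinom if e \in ein V then u e else 0%N | e < m].

(** If [f] were in the span, its part in each block would be a relation of that block, hence a
    binomial generated there without [f]. The monomials of [f] are products of their block parts, so
    telescoping puts [bin f] into the ideal of the other generators. *)
Lemma exceptional_not_in_span f : f \in S -> ~~ in_block f -> ~ in_span Sreg (pv f).
Proof.
move=> fS rf span_f; apply: (irrS fS); set J := in_ideal _.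
have idJ : is_ideal J := in_ideal_is_ideal _.
have [idI _ _] := @mono_ideal_prime K m n (edge_mnm ends).
have [_ IS] := (generatesP _ idI).1 gS.
have vd_f e x : vd ends (resl (ein (B e)) (pv f)) x = 0.
  have -> : vd ends (resl (ein (B e)) (pv f)) x = (pv f *m
     (\col_e' if e' \in ein (B e) then (\col_e1 (edge_mnm ends e1 x)%:R : 'cV[rat]_m) e' 0 else 0)) 0 0.
    rewrite vdE mxE; apply: eq_bigr => e' _; rewrite !mxE.
    by case: ifP => _; rewrite ?mul0r ?mulr0.
  rewrite span_f ?mxE // => q; rewrite mem_filter => /andP[rq qS]; rewrite pv_restrict //.
  case: ifP => // _; apply/rowP => i; rewrite ord1 [RHS]mxE -(vd_S gS x qS) vdE mxE.
  by apply: eq_bigr => e' _; rewrite [X in _ * X]mxE.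
have J_res e : J (bin (res (B e) f.1, res (B e) f.2)).
  have eq_res : vdeg (res (B e) f.1) = vdeg (res (B e) f.2).
    apply/mnmP => x; apply/eqP; rewrite -(eqr_nat rat) -subr_eq0 -vd_pv -(vd_f e x); apply/eqP.
    rewrite !vdE; apply: eq_bigr => e' _; congr (_ * _); rewrite !mxE !mnmE.
    by case: ifP => _; rewrite ?subrr.
  have res_in u : insupp (B e) (res (B e) u).
    by apply/insuppP => e'; rewrite mnmE; case: ifP.
  have : in_ideal (bins [seq q <- S | insupp (B e) q.1]) (bin (res (B e) f.1, res (B e) f.2)).
    apply: face_ideal; first by move=> q; exact: (S_wdeg gS).
      by move=> u /msupp_bin[] ->.
    by apply: IS; apply/mono_ideal_bin.
  apply: in_ideal_sub => _ /mapP[q + ->]; rewrite mem_filter => /andP[qe qS].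
  apply/mem_in_ideal/map_f; rewrite mem_rem_uniq // inE qS andbT.
  by apply: contraNneq rf => <-; apply/existsP; exists e.
have J_add (u1 w1 u2 w2 : 'X_{1..m}) : J (bin (u1, w1)) -> J (bin (u2, w2)) ->
    J (bin ((u1 + u2)%MM, (w1 + w2)%MM)).
  case: idJ => _ Jadd Jmul J1 J2.
  have -> : bin ((u1 + u2)%MM, (w1 + w2)%MM) =
      'X_[u2] * bin (u1, w1) + 'X_[w1] * bin (u2, w2) :> {mpoly K[m]}.
    by rewrite /bin /= !mpolyXD; ring.
  by apply: Jadd; apply: Jmul.
pose Bs := [set B e | e : 'I_m].
have sum_res u : u = (\sum_(V in Bs) res V u)%MM.
  apply/mnmP => e; rewrite mnm_sumE (bigD1 (B e)) /=; last exact: imset_f.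
  rewrite mnmE B_mem big1 ?addn0 // => _ /andP[/imsetP[e' _ ->] neq_e]; rewrite mnmE.
  by case: ifP => // e_e'; rewrite (B_disjoint e_e' (B_mem e)) eqxx in neq_e.
rewrite [f]surjective_pairing [f.1]sum_res [f.2]sum_res.
apply: (big_ind2 (fun u w => J (bin (u, w)))) => //.
- by rewrite /bin subrr; case: idJ.
by move=> _ /imsetP[e _ ->]; apply: J_res.
Qed.

Lemma indep_of_blocks :
  (forall q q', q \in S -> q' \in S -> ~~ in_block q -> ~~ in_block q' -> q = q') -> indep S.
Proof.
move=> exc1; split=> // q S' qS subS' qS' span_q.
have mono S1 S2 l : {subset S1 <= S2} -> in_span S1 l -> in_span S2 l.
  by move=> sub12 span1 x x0; apply: span1 => p /sub12/x0.
have [rq|rq] := boolP (in_block q); last first.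
  apply: (exceptional_not_in_span qS rq); apply: mono span_q => p pS'.
  rewrite mem_filter subS' // andbT; apply: contraNT qS' => rp.
  by rewrite (exc1 q p) // subS'.
pose R := [seq p <- S' | in_block p].
have subR : {subset R <= Sreg}.
  by move=> p; rewrite !mem_filter => /andP[-> /subS' ->].
have qSreg : q \in Sreg by rewrite mem_filter rq.
have nspan : ~ in_span R (pv q).
  by apply: in_block_indep.2 => //; rewrite mem_filter negb_and qS' orbT.
have [x0 [Rx0 qx0]] : exists x0 : 'cV[rat]_m, (forall p, p \in R -> pv p *m x0 = 0) /\ pv q *m x0 <> 0.
  apply: NNPP => none; apply: nspan => x Rx; apply: NNPP => qx.
  by apply: none; exists x.
have [/hasP[f fS' rf]|/hasPn allR] := boolP (has (fun p => ~~ in_block p) S'); last first.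
  apply: qx0; apply: span_q => p pS'; apply: Rx0; rewrite mem_filter pS' andbT.
  by have := allR p pS'; rewrite negbK.
have SR p : p \in S' -> p = f \/ p \in R.
  move=> pS'; have [rp|rp] := boolP (in_block p); first by right; rewrite mem_filter rp.
  by left; apply: exc1 => //; apply: subS'.
have sc (A : 'M[rat]_1) : A = (A 0 0)%:M by rewrite -mx11_scalar.
have fx0 : (pv f *m x0) 0 0 != 0.
  apply/eqP => f0; apply: qx0; apply: span_q => p /SR[->|/Rx0//].
  by rewrite [LHS]sc f0 raddf0.
apply: (exceptional_not_in_span (subS' f fS') rf) => x Sx.
(* [x - t *: x0] vanishes at [f] too, hence on [S'] and at [q]. As [x] vanishes at [q] and [x0] does
   not, [t] is zero, so [x] vanishes at [f]. *)
pose t := (pv f *m x) 0 0 / (pv f *m x0) 0 0.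
have : pv q *m (x - t *: x0) = 0.
  apply: span_q => p /SR[->|pR]; rewrite mulmxBr -scalemxAr; last first.
    by rewrite (Sx p (subR p pR)) (Rx0 p pR) scaler0 subrr.
  by apply/rowP => i; rewrite ord1; move: fx0 @t; move: (pv f *m x) (pv f *m x0) => a b b0 t; rewrite !mxE divfK ?subrr.
rewrite mulmxBr -scalemxAr (Sx q qSreg) sub0r => /eqP; rewrite oppr_eq0 scaler_eq0.
case/orP=> [|/eqP//]; rewrite mulf_eq0 invr_eq0 (negPf fx0) orbF => /eqP f0.
by rewrite [LHS]sc f0 raddf0.
Qed.

End BlockDecomposition.

Theorem theorem5p5 (K : fieldType) (n m : nat) (ends : 'I_m -> 'I_n * 'I_n) :
  simple_graph ends -> graph_connected ends ->
  (complete_intersection (toric_ideal ends K) <->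
   ((exists f0 : {mpoly K[m]},
       forall g, minimal_generator (toric_ideal ends K) g ->
         g = f0 \/ g = - f0 \/ exists w, even_cycle ends w /\ g = Bw K w) /\
    (forall (Vs : {set 'I_n}) (Es : {set 'I_m}), is_block ends Vs Es ->
       complete_intersection (toric_ideal (sub_ends ends Es) K)))).
Proof.
move=> [loopless simple] [_ connG]; rewrite toric_idealE.
set I := @mono_ideal K m n (edge_mnm ends).
have [Sp0 minSp0] := @mono_ideal_minimal K m n (edge_mnm ends).
have [S0 [US0 S0Sp gS0 irrS0]] := minimal_system_pairs minSp0.
split=> [ciI|[[f0 minG] ciB]].
  have gen_pairs g : minimal_generator I g -> exists S q,
      [/\ generates (map (@bin K m) S) I, indep S, q \in S & g = bin q].
    move=> [Sp [minSp gSp]]; have [S [US SSp gS irrS]] := minimal_system_pairs minSp.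
    have [q qS def_g] : exists2 q, q \in S & g = bin q by apply/mapP; rewrite SSp.
    by exists S, q; split=> //; apply: (complete_intersection_indep (mdeg_edge _) ciI).
  split; last first.
    move=> Vs Es blk; rewrite (block_induced blk) toric_idealE.
    have indS0 : indep S0 by apply: (complete_intersection_indep (mdeg_edge _) ciI).
    have S_L q := @S_wdeg K n m ends S0 gS0 q.
    apply: (indep_complete_intersection (pull_generates (V := Vs) gS0)).
    apply/(indep_pull Vs S_L); apply: (sub_indep indS0); first exact: filter_uniq.
    by move=> q; rewrite mem_filter => /andP[].
  (* Exceptional means degree at least two at some vertex; all other generators are even cycles. *)
  pose exc S q := [/\ generates (map (@bin K m) S) I, indep S, q \in S &
    exists v, (2 <= wdeg (edge_mnm ends) q.1 v)%N].
  have cyc S q : generates (map (@bin K m) S) I -> indep S -> q \in S -> ~ exc S q ->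
      exists w, even_cycle ends w /\ bin q = Bw K w.
    move=> gS indS qS nexc; apply: (cycle_generator loopless simple gS indS qS) => x.
    by rewrite leqNgt; apply/negP => deg_x; apply: nexc; split=> //; exists x.
  have [[S [q excq]]|none] := classic (exists S q, exc S q).
    exists (bin q) => g /gen_pairs[S' [q' [gS' indS' q'S' ->]]].
    have [[_ _ _ [v' deg_q']]|/(cyc _ _ gS' indS' q'S')] := classic (exc S' q'); last by right; right.
    have [gS indS qS [v deg_q]] := excq.
    by case: (exceptional_unique loopless simple connG gS indS gS' indS' qS q'S' deg_q deg_q'); auto.
  (* With no exceptional generator in any system, 0 is an arbitrary value. *)
  exists 0 => g /gen_pairs[S' [q' [gS' indS' q'S' ->]]]; right; right.
  by apply: (cyc S') => // excq'; apply: none; exists S', q'.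
have [B BP] : exists B : 'I_m -> {set 'I_n}, forall e,
    is_block ends (B e) (ein ends (B e)) /\ e \in ein ends (B e).
  apply: (fin_all_exists (P := fun e V => is_block ends V (ein ends V) /\ e \in ein ends V)) => e.
  exact: edge_in_block.
have B_block e := (BP e).1; have B_mem e := (BP e).2.
have indB e : indep (inner ends (B e) S0).
  by apply: (block_indep US0 irrS0 gS0); rewrite -toric_idealE; apply: ciB.
apply: (indep_complete_intersection gS0).
apply: (indep_of_blocks loopless B_block B_mem US0 gS0 irrS0 indB) => q q' qS q'S.
(* An even cycle lies in one block, so a generator outside all blocks is [f0] up to sign. *)
have exc p : p \in S0 -> ~~ in_block ends B p -> bin p = f0 \/ bin p = - f0.
  move=> pS np; have : minimal_generator I (bin p) by exists Sp0; rewrite -S0Sp map_f.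
  case/minG => [|[|[c [cyc_c def_p]]]]; [by left | by right |].
  have [V blkV cV] := cycle_in_block cyc_c.
  have pV := Bw_support (irredundant_neq irrS0 pS) def_p cV.
  case/existsP: np; have [_ size_c _ _] := cyc_c.
  case: c size_c cV {cyc_c def_p} => // e c _ cV; exists e.
  by rewrite (block_unique loopless (B_block e) blkV (B_mem e) (cV e (mem_head _ _))).
(* Two such generators agree up to sign, so one of them would be redundant. *)
move=> /(exc q qS) exc_q /(exc q' q'S) exc_q'; apply: NNPP => /eqP neq_q.
apply: (irrS0 q qS); have q'R : q' \in rem q S0 by rewrite mem_rem_uniq // inE eq_sym neq_q.
have Jq' := mem_in_ideal (map_f (@bin K m) q'R).
have idJ := in_ideal_is_ideal (map (@bin K m) (rem q S0)).
have [->|->] : bin q = bin q' :> {mpoly K[m]} \/ bin q = - bin q' :> {mpoly K[m]}.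
  by case: exc_q exc_q' => -> [] ->; rewrite ?opprK; auto.
- exact: Jq'.
- exact: idealN.
Qed.
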